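(* Let $Q>0$, let $(Z,d,\mu)$ be a $Q$-Ahlfors regular metric measure space, let $\lambda\in(0,Q]$, and let $F\subset Z$ be a closed $\lambda$-Ahlfors regular subset, equipped with the metric $d_{|F}$ and the Hausdorff $\lambda$-measure $\nu$. Suppose that $0<s<1$, $\max\big(Q/(\lambda+s),(Q-\lambda)/s\big)<p<\infty$ and $0<q\le\infty$. Then there exist bounded linear operators $$\mathcal R\colon \dot{\mathcal B}^{s}_{p,q}(Z)\to \dot{\mathcal B}^{s-\frac{Q-\lambda}{p}}_{p,q}(F)\quad\text{and}\quad \mathcal E\colon \dot{\mathcal B}^{s-\frac{Q-\lambda}{p}}_{p,q}(F)\to\dot{\mathcal B}^{s}_{p,q}(Z)$$ such that (i) $\mathcal R f=f_{|F}$ for all continuous functions $f$ in $\dot{\mathcal B}^{s}_{p,q}(Z)$, and (ii) $\mathcal R(\mathcal E f)=f$ for all $f\in\dot{\mathcal B}^{s-\frac{Q-\lambda}{p}}_{p,q}(F)$ (pointwise $\nu$-almost everywhere in $F$).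
   Context: **Metric measure spaces.** All metric measure spaces $(Z,d,\mu)$ are such that $\mu$ is Borel regular and every ball $B(\xi,r)=\{\eta: d(\eta,\xi)<r\}$ has positive and finite measure. $(Z,d,\mu)$ is $Q$-Ahlfors regular if $\mu(B(\xi,r))\approx r^Q$ uniformly in $\xi\in Z$ and $0<r<\operatorname{diam}Z$. A closed subset $F\subset Z$ (of Hausdorff dimension $\lambda$) is $\lambda$-Ahlfors regular if the metric measure space $(F,d_{|F},\nu)$, with $\nu$ the Hausdorff $\lambda$-measure on $F$, is $\lambda$-Ahlfors regular. $L^1_{\rm loc}(Z)$ denotes the complex-valued $\mu$-measurable functions on $Z$ that are integrable on every ball. **Hyperbolic filling.** For each $n\in\mathbb Z$ let $(\xi_x)_{x\in X_n}$ be a maximal set of points of $Z$ with $d(\xi_x,\xi_{x'})\ge 2^{-n-1}$ for distinct $x,x'\in X_n$ ($X_n$ an index set). Put $B(x):=B(\xi_x,2^{-n})$ and $|x|:=n$ for $x\in X_n$, and $X:=\bigsqcup_{n\in\mathbb Z}X_n$. The graph $(X,E)$ has an edge joining $x$ and $x'$ (written $x\sim x'$) iff $x\ne x'$, $||x|-|x'||\le1$ and $B(x)\cap B(x')\neq\emptyset$. Each edge is given one orientation, with starting point $e_-$ and endpoint $e_+$, such that $e_+$ is the vertex of higher level when the levels differ. Put $|e|:=\min(|e_-|,|e_+|)$ and $B(e):=B(e_-)\cup B(e_+)$. For $u\colon X\to\mathbb C$ let $du(e):=u(e_+)-u(e_-)$, $e\in E$. For $f\in L^1_{\rm loc}(Z)$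 let $Pf(x):=\frac1{\mu(B(x))}\int_{B(x)}f\,d\mu$, $x\in X$. **Besov space.** For a $Q$-Ahlfors regular space $Z$, $0<s\le1$, $Q/(Q+s)<p\le\infty$ and $0<q\le\infty$, $\dot{\mathcal B}^s_{p,q}(Z)$ is the space of $f\in L^1_{\rm loc}(Z)$ such that $$\|f\|_{\dot{\mathcal B}^s_{p,q}(Z)}:=\Big(\sum_{k\in\mathbb Z}2^{ksq}\Big\|\sum_{|e|=k}|d(Pf)(e)|\chi_{B(e)}\Big\|_{L^p(Z)}^q\Big)^{1/q}<\infty$$ (supremum over $k$ if $q=\infty$). Different choices of the hyperbolic filling give equivalent quasi-norms. Strictly speaking this is a quasi-normed space after dividing out functions that are constant $\mu$-almost everywhere; ''$f\in\dot{\mathcal B}^s_{p,q}$'' is used both for functions and for equivalence classes. The spaces on $F$ are defined in the same way with $(F,d_{|F},\nu)$ and $\lambda$ in place of $(Z,d,\mu)$ and $Q$. *)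

(* Defs.v *)
From HB Require Import structures.
From mathcomp Require Import all_boot all_order all_algebra.
From mathcomp Require Import all_classical all_reals all_analysis.
From mathcomp.real_closed Require Import complex.

Set Implicit Arguments.
Unset Strict Implicit.
Unset Printing Implicit Defensive.

Import Order.TTheory GRing.Theory Num.Theory.
Import numFieldNormedType.Exports.

Local Open Scope classical_set_scope.
Local Open Scope ring_scope.

(* Nonempty metric spaces: the measurable types of the library are pointed.
   The chosen point plays no role. *)
#[short(type="pmetricType")]
HB.structure Definition PointedMetric (K : numDomainType) :=
  {M of Pointed M & Metric K M}.

Definition submetric (R : realType) (Z : pmetricType R) (F : set Z)
  of F !=set0 : Type := set_type F.

Section submetric.
Context {R : realType} {Z : pmetricType R} (F : set Z) (F0 : F !=set0).

Local Notation T := (submetric F0).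

HB.instance Definition _ := PseudoMetric.copy T (set_type F).

Let submetric_point : T := exist _ (sval (cid F0)) (mem_set (svalP (cid F0))).

HB.instance Definition _ := isPointed.Build T submetric_point.

Let dist (x y : T) : R := mdist (set_val x) (set_val y).

Let dist_ge0 x y : 0 <= dist x y.
Proof. exact: mdist_ge0. Qed.

Let dist_positivity x y : dist x y = 0 -> x = y.
Proof. by move=> /mdist_positivity; exact: val_inj. Qed.

Let ball_dist (x : T) (d : R) : ball x d = [set y | dist x y < d].
Proof.
rewrite -[ball x d]/(set_val @^-1` (ball (set_val x) d)).
by rewrite (ballEmdist (set_val x : Z)).
Qed.

HB.instance Definition _ := @PseudoMetric_isMetric.Build R T
  dist dist_ge0 dist_positivity ball_dist.

End submetric.

Section metric_measure.
Context {R : realType} {T : pmetricType R}.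
Implicit Types (A B : set T) (Q lam : R).
Local Open Scope ereal_scope.

Definition diam A : \bar R :=
  ereal_sup ([set 0] `|` [set (mdist xy.1 xy.2)%:E | xy in A `*` A]).

(* [mu] is an outer measure on all subsets of [T]; "mu-measurable" means
   Caratheodory measurable. *)
Definition borel_regular (mu : {outer_measure set T -> \bar R}) :=
  (forall B, <<s [set U : set T | open U] >> B -> mu.-caratheodory B) /\
  (forall A, exists B, [/\ <<s [set U : set T | open U] >> B, A `<=` B &
                          mu B = mu A]).

Definition metric_measure_space (mu : {outer_measure set T -> \bar R}) :=
  borel_regular mu /\
  (forall (x : T) (r : R), (0 < r)%R -> 0 < mu (ball x r) < +oo).

Definition ahlfors_regular (mu : {outer_measure set T -> \bar R}) Q :=
  metric_measure_space mu /\
  exists2 C : R, (0 < C)%R & forall (x : T) (r : R),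
    (0 < r)%R -> r%:E < diam [set: T] ->
    (C^-1 * r `^ Q)%:E <= mu (ball x r) <= (C * r `^ Q)%:E.

(* Hausdorff measure without a normalizing constant. The case [A == set0]
   matters only for [lam <= 0]. *)
Definition hausdorff_gauge lam A : \bar R :=
  if A == set0 then 0 else diam A `^ lam.

Definition hausdorff_pre lam (delta : {posnum R}) A : \bar R :=
  ereal_inf [set \sum_(i <oo) hausdorff_gauge lam (U i) |
    U in [set U : (set T)^nat |
      (forall i, diam (U i) <= delta%:num%:E) /\ A `<=` \bigcup_i U i]].

Definition hausdorff_measure lam A : \bar R :=
  ereal_sup [set hausdorff_pre lam delta A | delta in [set: {posnum R}]].

End metric_measure.

Section hausdorff_outer_measure.
Context {R : realType} {T : pmetricType R}.
Implicit Types (A B : set T) (lam : R) (delta : {posnum R}).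
Local Open Scope ereal_scope.

Lemma le_diam A B : A `<=` B -> diam A <= diam B.
Proof.
move=> AB; apply: ge_ereal_sup => _ [->|[[x y] [Ax Ay]] <-].
  by apply: ereal_sup_ubound; left.
by apply: ereal_sup_ubound; right; exists (x, y) => //; split; exact: AB.
Qed.

Lemma diam_set0 : diam (set0 : set T) = 0.
Proof.
by rewrite /diam setX0 image_set0 setU0 ereal_sup1.
Qed.

Lemma hausdorff_gauge0 lam : hausdorff_gauge lam (set0 : set T) = 0.
Proof. by rewrite /hausdorff_gauge eqxx. Qed.

Lemma hausdorff_gauge_ge0 lam A : 0 <= hausdorff_gauge lam A.
Proof. by rewrite /hausdorff_gauge; case: ifPn => // _; exact: poweR_ge0. Qed.

(* [hausdorff_pre lam delta] is the outer measure generated by the gauge on the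
   semiring of sets of diameter at most [delta]. *)
Definition small_sets delta : Type := T.

Section small_sets.
Variable delta : {posnum R}.
Let small : set (set (small_sets delta)) :=
  [set A : set T | diam A <= delta%:num%:E].

Let small0 : small set0.
Proof. by rewrite /small/= diam_set0 lee_fin. Qed.

Let smallI : setI_closed small.
Proof. by move=> A B sA _; apply: le_trans sA; apply: le_diam; exact: subIsetl. Qed.

Let smallD : semi_setD_closed small.
Proof.
move=> A B sA _; exists [set A `\` B]; split => //.
- by move=> C ->; apply: le_trans sA; apply: le_diam; exact: subDsetl.
- by rewrite bigcup_set1.
- by move=> C D -> ->.
Qed.

HB.instance Definition _ := Pointed.copy (small_sets delta) T.
HB.instance Definition _ := @isSemiRingOfSets.Build default_measure_display
  (small_sets delta) small small0 smallI smallD.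

End small_sets.

Lemma hausdorff_preE lam delta :
  hausdorff_pre lam delta =
  mu_ext (hausdorff_gauge lam : set (small_sets delta) -> \bar R).
Proof. by []. Qed.

Lemma hausdorff_measure0 lam : hausdorff_measure lam (set0 : set T) = 0.
Proof.
apply/eqP; rewrite eq_le; apply/andP; split.
  apply: ge_ereal_sup => _ [delta _ <-].
  by rewrite hausdorff_preE mu_ext0// ?hausdorff_gauge0// => A;
    exact: hausdorff_gauge_ge0.
apply: le_trans (ereal_sup_ubound _); last by exists (1%R)%:pos%R.
by rewrite hausdorff_preE; apply: mu_ext_ge0; exact: hausdorff_gauge_ge0.
Qed.

Lemma hausdorff_measure_ge0 lam A : 0 <= hausdorff_measure lam A.
Proof.
apply: le_trans (ereal_sup_ubound _); last by exists (1%R)%:pos%R.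
by rewrite hausdorff_preE; apply: mu_ext_ge0; exact: hausdorff_gauge_ge0.
Qed.

Lemma le_hausdorff_measure lam :
  {homo (hausdorff_measure lam : set T -> \bar R) : A B / A `<=` B >-> A <= B}.
Proof.
move=> A B AB; apply: ge_ereal_sup => _ [delta _ <-].
apply: le_trans (ereal_sup_ubound _); last by exists delta.
by rewrite hausdorff_preE; exact: le_mu_ext.
Qed.

Lemma hausdorff_measure_sigma_subadditive lam :
  sigma_subadditive (hausdorff_measure lam : set T -> \bar R).
Proof.
move=> A; apply: ge_ereal_sup => _ [delta _ <-].
apply: (@le_trans _ _ (\sum_(i <oo) hausdorff_pre lam delta (A i))).
  rewrite hausdorff_preE; apply: mu_ext_sigma_subadditive.
  exact: hausdorff_gauge_ge0.
apply: lee_nneseries => [i _ _|i _].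
  by rewrite hausdorff_preE; apply: mu_ext_ge0; exact: hausdorff_gauge_ge0.
by apply: ereal_sup_ubound; exists delta.
Qed.

HB.instance Definition _ lam := isOuterMeasure.Build R T
  (hausdorff_measure lam) (hausdorff_measure0 lam) (hausdorff_measure_ge0 lam)
  (@le_hausdorff_measure lam) (@hausdorff_measure_sigma_subadditive lam).

End hausdorff_outer_measure.

Section hyperbolic_filling.
Context {R : realType} {T : pmetricType R}.

Definition separated (r : R) (A : set T) :=
  forall x y, A x -> A y -> x != y -> r <= mdist x y.

Definition maximal_separated (r : R) (A : set T) :=
  separated r A /\ forall B, separated r B -> A `<=` B -> B = A.

(* Since the points of a level are distinct, the index set [X_n] is identified
   with the set of its points; a vertex is a pair (level, point). *)
Definition vertex : Type := (int * T)%type.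
Definition level (x : vertex) : int := x.1.
Definition vball (x : vertex) : set T := ball x.2 ((2 : R) ^ (- level x)).

Definition is_vertex (X : int -> set T) : set vertex :=
  [set x | X (level x) x.2].

Definition adjacent (X : int -> set T) (x y : vertex) :=
  [/\ is_vertex X x, is_vertex X y, x <> y, `|level x - level y| <= 1 &
      vball x `&` vball y !=set0].

(* [(x, y)] in [edges] is an edge starting at [x] and ending at [y]. *)
Record hyperbolic_filling := HyperbolicFilling {
  net : int -> set T ;
  edges : set (vertex * vertex) ;
  net_maximal : forall n : int, maximal_separated (2 ^ (- n - 1)) (net n) ;
  edges_adjacent : forall e, edges e -> adjacent net e.1 e.2 ;
  edges_oriented : forall x y, adjacent net x y ->
    (edges (x, y) <-> ~ edges (y, x)) ;
  edges_upward : forall e, edges e -> level e.1 <= level e.2 }.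

Definition elevel (e : vertex * vertex) : int :=
  Num.min (level e.1) (level e.2).
Definition eball (e : vertex * vertex) : set T := vball e.1 `|` vball e.2.

End hyperbolic_filling.
Arguments vertex {R} T.
Arguments hyperbolic_filling {R} T.

Section besov.
Context {R : realType} {T : pmetricType R}.
Variable mu : {outer_measure set T -> \bar R}.
Implicit Types (f : T -> R[i]) (X : hyperbolic_filling T).

(* [mu] as a measure on the sigma-algebra of [mu]-measurable sets. *)
Definition cara : {measure set (caratheodory_type mu) -> \bar R} :=
  (mu : set (caratheodory_type mu) -> \bar R).

Definition L1loc f :=
  [/\ measurable_fun [set: caratheodory_type mu] (fun z => complex.Re (f z)),
      measurable_fun [set: caratheodory_type mu] (fun z => complex.Im (f z)) &
      forall (x : T) (r : R), 0 < r ->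
        cara.-integrable (ball x r) (fun z => (complex.Re (f z))%:E) /\
        cara.-integrable (ball x r) (fun z => (complex.Im (f z))%:E)].

Definition mean (A : set T) f : R[i] :=
  Complex ((fine (mu A))^-1 * \int[cara]_(z in A) complex.Re (f z))
          ((fine (mu A))^-1 * \int[cara]_(z in A) complex.Im (f z)).

Definition ball_mean f (x : vertex T) : R[i] := mean (vball x) f.

Definition du (u : vertex T -> R[i]) (e : vertex T * vertex T) : R[i] :=
  u e.2 - u e.1.

Definition besov_level X (p : \bar R) f (k : int) : \bar R :=
  'N[cara]_p[(fun z => \esum_(e in [set e | edges X e /\ elevel e = k])
    (Normc.normc (du (ball_mean f) e) * \1_(eball e) z)%:E)]%E.

(* [q] is meant to be positive; the branch [q = -oo] is junk. *)
Definition besov_norm X (s : R) (p q : \bar R) f : \bar R :=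
  (match q with
  | r%:E => (\esum_(k in [set: int])
       (2 `^ (k%:~R * s * r))%:E * besov_level X p f k `^ r) `^ r^-1
  | _ => ereal_sup [set (2 `^ (k%:~R * s))%:E * besov_level X p f k |
                     k in [set: int]]
  end)%E.

Definition besov X (s : R) (p q : \bar R) : set (T -> R[i]) :=
  [set f | L1loc f /\ (besov_norm X s p q f < +oo)%E].

Definition ae_const f := exists c : R[i], f = cst c %[ae cara].

End besov.

Section operators.
Context {R : realType} {T1 T2 : pmetricType R}.

(* An operator is given by its action on functions; it respects equality
   almost everywhere, and descends to the quotients by the almost everywhere
   constant functions, which are the actual quasi-normed spaces. *)
Definition bounded_linear_besov
    (mu1 : {outer_measure set T1 -> \bar R}) (X1 : hyperbolic_filling T1)
    (s1 : R)
    (mu2 : {outer_measure set T2 -> \bar R}) (X2 : hyperbolic_filling T2)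
    (s2 : R) (p q : \bar R) (A : (T1 -> R[i]) -> (T2 -> R[i])) :=
  let B1 := besov mu1 X1 s1 p q in
  let B2 := besov mu2 X2 s2 p q in
  [/\ (forall f, B1 f -> B2 (A f)),
      (forall f g, B1 f -> B1 g -> f = g %[ae cara mu1] ->
         A f = A g %[ae cara mu2]),
      (forall f g, B1 f -> B1 g -> ae_const mu1 (f \- g) ->
         ae_const mu2 (A f \- A g)),
      (forall (a : R[i]) f g, B1 f -> B1 g ->
         A (fun x => a * f x + g x) = (fun y => a * A f y + A g y)
           %[ae cara mu2]) &
      exists2 C : R, 0 <= C & forall f, B1 f ->
        (besov_norm mu2 X2 s2 p q (A f) <=
           C%:E * besov_norm mu1 X1 s1 p q f)%E].

End operators.

(* Main.v *)
(* For an edge e write g(e) = |d(Pf)(e)|, and put sigma = s p - Q, which is also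
   (s - (Q - lam)/p) p - lam.  By regularity and bounded overlap, the k-th term
   of the Besov norm on either space, raised to the power p, is comparable to
   alpha_k = 2^(k sigma) times the sum of g(e)^p over the edges of level k.  So an
   operator is bounded, for all q at once, as soon as the sequence alpha of the
   image is dominated by the convolution of alpha with 2^(-d |j|) for some d > 0.

   Restriction: Rf(w) is the limit of Pf(x_n) along vertices x_n of level n whose
   balls contain w in F.  Telescoping bounds |Rf(w) - Pf(x_m)| by the sum of g(e)
   over the edges e of level at least m with w in B(e), and d(P(Rf)) is bounded by
   the averages of these tails over balls of F.  Averaging a step function of
   scale 2^-j over balls of scale 2^-k, j >= k, is controlled by Jensen's
   inequality if p >= 1 and by the inclusion of l^p in l^1 if p <= 1; the
   exponents add up because lam min(p, 1) + sigma > 0.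

   Extension: Ef(z) is the limit of the averages of f over F against a tent
   function centered at z of radius max(dist(z, F), 2^-n).  Changing the center
   and the radius at scale 2^-i changes the average by the oscillation of f on a
   ball of F of scale 2^-i, hence, by Lebesgue differentiation on F, by an average
   over this ball of a tail of d(Pf).  Scales coarser than 2^-k contribute to
   d(P(Ef)) on level k with a factor 2^(i - k), which is summable because s < 1,
   and finer scales as before, because Q min(p, 1) + sigma > 0.

   Finally P(Ef)(x_n) - f(w) tends to 0 almost everywhere, since its p-th power
   integrates to at most a multiple of 2^(- n (lam + sigma)) plus the tails above,
   and lam + sigma > 0. *)

(* Three obstacles shape the proof. Levels run over all integers, and at scales above the diameter
   the lower bound on the measure of balls fails. There every ball is the whole space, so the
   differences to be bounded vanish, and lower bounds are used only once this case is set aside.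
   Secondly, p may be below 1, where L^p has no triangle inequality; all estimates are therefore
   made on sums of p-th powers, and min(p, 1) records the two ways of bounding a power of a sum.
   Thirdly, only limits along selected vertices are needed, so no maximal function appears: finite
   tails give convergence, and the limit is identified in L^1 by density of Lipschitz functions and
   Fatou's lemma. The averages of the extension use tents, not balls, because Lipschitz weights make
   an average move by a fraction 2^(i - k) of the oscillation at scale 2^-i when its centre moves by
   2^-k. The tail estimates are stated for an isometric map [io]: it is the inclusion of F for the
   restriction and the identity of F for the extension. Operators are built on real functions and
   applied to real and imaginary parts. *)
Require Import Defs.
From mathcomp Require Import all_boot all_order all_algebra finmap.
From mathcomp Require Import all_classical all_reals all_analysis.
From mathcomp Require Import measurable_realfun.
From mathcomp.real_closed Require Import complex.
From mathcomp Require Import zify ring lra.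

Set Implicit Arguments.
Unset Strict Implicit.
Unset Printing Implicit Defensive.

Import Order.TTheory GRing.Theory Num.Theory.
Import numFieldNormedType.Exports.

Local Open Scope classical_set_scope.
Local Open Scope ring_scope.

(** * Unconditional sums and powers *)

Section esum_extra.
Context {R : realType}.
Local Open Scope ereal_scope.

Lemma esum_le_fsets (I : choiceType) (E : set I) (a : I -> \bar R) (M : \bar R) :
  (forall A, finite_set A -> A `<=` E -> \sum_(i \in A) a i <= M) ->
  \esum_(i in E) a i <= M.
Proof. by move=> H; apply: ge_ereal_sup => _ [A [fA AE] <-]; exact: H. Qed.

Lemma esum_ge_term (I : choiceType) (E : set I) (a : I -> \bar R) i :
  E i -> a i <= \esum_(i in E) a i.
Proof.
move=> Ei; apply: esum_ge; exists [set i]; last by rewrite fsbig_set1.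
by split; [exact: finite_set1|move=> _ ->].
Qed.

Lemma le_esum_set (I : choiceType) (E F : set I) (a : I -> \bar R) :
  E `<=` F -> \esum_(i in E) a i <= \esum_(i in F) a i.
Proof.
move=> EF; apply: esum_le_fsets => A fA AE.
apply: esum_ge; exists A => //; split => //; exact: subset_trans AE EF.
Qed.

Lemma esumZl_le (I : choiceType) (E : set I) (a : I -> \bar R) (c : \bar R) :
  0 <= c -> (forall i, 0 <= a i) ->
  \esum_(i in E) (c * a i) <= c * \esum_(i in E) a i.
Proof.
move=> c0 a0; apply: esum_le_fsets => A fA AE.
rewrite -ge0_mule_fsumr//; apply: lee_wpmul2l => //.
by apply: esum_ge; exists A.
Qed.

Lemma esumZl (I : choiceType) (E : set I) (a : I -> \bar R) (c : R) :
  (0 <= c)%R -> (forall i, 0 <= a i) ->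
  \esum_(i in E) (c%:E * a i) = c%:E * \esum_(i in E) a i.
Proof.
move=> c0 a0; apply/eqP; rewrite eq_le esumZl_le ?lee_fin//=.
have [->|cn0] := eqVneq c 0%R.
  by rewrite mul0e; apply: esum_ge0 => *; rewrite mul0e.
have {cn0}c0 : (0 < c)%R by rewrite lt_neqAle eq_sym cn0.
rewrite muleC -lee_pdivlMr// muleC.
apply: le_trans (esumZl_le _ _ _); rewrite ?lee_fin ?invr_ge0 ?(ltW c0)//; last first.
  by move=> i; rewrite mule_ge0// lee_fin ltW.
apply: le_esum => i _; rewrite muleA -EFinM mulVf ?mul1e//.
by rewrite gt_eqF.
Qed.

Lemma esum_exchange (I J : choiceType) (E : set I) (F : set J)
    (a : I -> J -> \bar R) :
  (forall i j, 0 <= a i j) ->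
  \esum_(i in E) \esum_(j in F) a i j = \esum_(j in F) \esum_(i in E) a i j.
Proof.
move=> a0; rewrite !esum_esum//.
rewrite (@reindex_esum _ _ _ (F `*`` fun=> E) (E `*`` fun=> F)
  (fun x => (x.2, x.1)))//.
split; first by move=> [j i] [].
  by move=> [j i] [j' i'] _ _ /= [-> ->].
by move=> [i j] [/= Ei Fj]; exists (j, i).
Qed.

Lemma esum_eq0 (I : choiceType) (E : set I) (a : I -> \bar R) :
  (forall i, 0 <= a i) -> \esum_(i in E) a i = 0 -> forall i, E i -> a i = 0.
Proof.
move=> a0 a00 i Ei; apply/eqP; rewrite eq_le a0 andbT -a00.
exact: esum_ge_term.
Qed.

(** Let b be the right-hand side. Every a_i^p is at most b, so a_i <= b^(1/p - 1) a_i^p because 1/p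
    >= 1, and summation gives b^(1/p). *)
Lemma esum_poweR_le1 (I : choiceType) (E : set I) (a : I -> \bar R) (p : R) :
  (0 < p)%R -> (p <= 1)%R -> (forall i, 0 <= a i) ->
  (\esum_(i in E) a i) `^ p <= \esum_(i in E) a i `^ p.
Proof.
move=> p0 p1 a0; set B := \esum_(i in E) a i `^ p.
have B0 : 0 <= B by apply: esum_ge0 => *; exact: poweR_ge0.
have [B00|Bn0] := eqVneq B 0.
  rewrite B00 esum1; first by rewrite poweR0r// gt_eqF.
  move=> i Ei; have := esum_eq0 (fun=> poweR_ge0 _ _) B00 Ei.
  by move/poweR_eq0_eq0; exact.
move: B0 Bn0; case Bb: B => [b| |] // b0 bn0; last by rewrite leey.
have {bn0 b0}b0 : (0 < b)%R by rewrite lt_neqAle eq_sym -lee_fin b0 andbT.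
rewrite -[leRHS]poweRe1 ?lee_fin ?(ltW b0)// -(mulVf (lt0r_neq0 p0)) poweRrM.
apply: (gt0_ler_poweR (ltW p0)); rewrite ?in_itv/= ?leey ?andbT ?esum_ge0//.
  by rewrite lee_fin powR_ge0.
have -> : (b `^ p^-1)%:E = (b `^ (p^-1 - 1))%:E * B.
  rewrite Bb -EFinM; congr EFin.
  by rewrite mulrC mulr_powRB1 ?invr_gt0// ltW.
rewrite -esumZl ?powR_ge0//; last by move=> *; exact: poweR_ge0.
apply: le_esum => i Ei.
have : a i `^ p <= b%:E by rewrite -Bb; exact: esum_ge_term.
case: (a i) (a0 i) => [x|_|//]; last by rewrite poweRyr ?gt_eqF// leye_eq.
rewrite lee_fin => x0; rewrite poweR_EFin lee_fin => xb.
rewrite -EFinM lee_fin.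
have [->|xn0] := eqVneq x 0%R; first by rewrite mulr_ge0// powR_ge0.
have {1}-> : x = ((x `^ p) `^ (p^-1 - 1) * x `^ p)%R.
  rewrite -powRrM mulrBr mulfV ?gt_eqF// mulr1 -powRD.
    by rewrite subrK powRr1.
  by rewrite subrK oner_eq0.
apply: ler_wpM2r; first exact: powR_ge0.
apply: ge0_ler_powR; rewrite ?nnegrE ?powR_ge0 ?(ltW b0)//.
by rewrite subr_ge0 invf_ge1.
Qed.

(** Jensen's inequality for the weights [m], up to the factor 2^p, by a threshold instead of
    convexity: a term is at most [l], or else at most l^(1-p) a_i^p since 1 - p <= 0. *)
Lemma esum_poweR_ge1 (I : choiceType) (E : set I) (a m : I -> \bar R)
    (p M : R) :
  (1 <= p)%R -> (0 < M)%R -> (forall i, 0 <= a i) -> (forall i, 0 <= m i) ->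
  \esum_(i in E) m i <= M%:E ->
  (\esum_(i in E) (a i * m i)) `^ p <=
  (2 `^ p * M `^ (p - 1))%:E * \esum_(i in E) (a i `^ p * m i).
Proof.
move=> p1 M0 a0 m0 mM; set B := \esum_(i in E) (a i `^ p * m i).
have p0 : (0 < p)%R by rewrite (lt_le_trans _ p1).
have amp0 i : 0 <= a i `^ p * m i by rewrite mule_ge0// poweR_ge0.
have B0 : 0 <= B by apply: esum_ge0.
have [B00|Bn0] := eqVneq B 0.
  rewrite B00 mule0 esum1; first by rewrite poweR0r// gt_eqF.
  move=> i Ei; have /eqP := esum_eq0 amp0 B00 Ei.
  rewrite mule_eq0 => /orP[/eqP/poweR_eq0_eq0->//|/eqP->].
    by rewrite mul0e.
  by rewrite mule0.
move: B0 Bn0; case Bb: B => [b| |] // b0 bn0; last first.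
  by rewrite gt0_muley ?leey// lte_fin mulr_gt0 ?powR_gt0.
have {bn0 b0}b0 : (0 < b)%R by rewrite lt_neqAle eq_sym -lee_fin b0 andbT.
(* This threshold balances the two resulting sums: with b = l^p M, the sum l^(1-p) b equals l M. *)
have [l l0 lE] : exists2 l : R, (0 < l)%R & (l `^ p = b / M)%R.
  exists ((b / M) `^ p^-1)%R; first by rewrite powR_gt0// divr_gt0.
  by rewrite -powRrM mulVf ?gt_eqF// powRr1// ltW// divr_gt0.
have key i : a i * m i <= l%:E * m i + (l `^ (1 - p))%:E * (a i `^ p * m i).
  rewrite muleA -ge0_muleDl ?lee_fin ?(ltW l0)//; last first.
    by rewrite mule_ge0 ?poweR_ge0// lee_fin powR_ge0.
  apply: lee_wpmul2r => //.
  case: (a i) (a0 i) => [x|_|//]; last first.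
    have lp0 : (0 < l `^ (1 - p))%R by exact: powR_gt0.
    by rewrite poweRyr ?gt_eqF// gt0_muley ?lte_fin// addey ?leey.
  rewrite lee_fin => x0; rewrite poweR_EFin -EFinM -EFinD lee_fin.
  have [xl|lx] := leP x l.
    by rewrite (le_trans xl)// lerDl mulr_ge0// powR_ge0.
  have xx0 : (0 < x)%R by exact: lt_trans lx.
  rewrite (@le_trans _ _ (l `^ (1 - p) * x `^ p))%R// ?lerDr ?(ltW l0)//.
  have {1}-> : x = (x `^ (1 - p) * x `^ p)%R.
    by rewrite -powRD ?subrK ?powRr1 ?ltW// oner_eq0.
  apply: ler_wpM2r; first exact: powR_ge0.
  rewrite -[(1 - p)%R]opprB !powRN lef_pV2 ?posrE ?powR_gt0//.
  by apply: ge0_ler_powR; rewrite ?nnegrE ?subr_ge0 ?(ltW l0) ?(ltW xx0) ?(ltW lx).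
have {key}key : \esum_(i in E) (a i * m i) <= (2 * M * l)%:E.
  apply: (@le_trans _ _ (l%:E * M%:E + (l `^ (1 - p))%:E * b%:E)).
    rewrite -Bb -esumZl ?powR_ge0//; apply: le_trans.
      apply: le_esum => i _; exact: key.
    rewrite esumD; [|move=> i _..].
    - rewrite leeD2r// esumZl ?(ltW l0)//; apply: lee_wpmul2l => //.
      by rewrite lee_fin ltW.
    - by rewrite mule_ge0// lee_fin ltW.
    - by rewrite mule_ge0// lee_fin powR_ge0.
  rewrite -!EFinM -EFinD lee_fin.
  suff -> : (l `^ (1 - p) * b = l * M)%R by lra.
  have -> : b = (l `^ p * M)%R.
    by rewrite lE divfK// gt_eqF.
  by rewrite mulrA -powRD ?subrK ?powRr1 ?ltW// oner_eq0.
apply: (@le_trans _ _ ((2 * M * l)%:E `^ p)).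
  apply: (gt0_ler_poweR (ltW p0)) => //; rewrite ?in_itv/= ?leey ?andbT.
    by apply: esum_ge0 => i _; rewrite mule_ge0.
  by rewrite lee_fin !mulr_ge0// ltW.
rewrite poweR_EFin -EFinM lee_fin !powRM ?mulr_ge0 ?(ltW l0) ?(ltW M0)//.
rewrite lE powRB; last by rewrite (gt_eqF M0) implybT.
rewrite (powRr1 (ltW M0)).
suff -> : (2 `^ p * M `^ p * (b / M) = 2 `^ p * (M `^ p / M) * b)%R by [].
by field; rewrite gt_eqF.
Qed.

End esum_extra.

(** * Sequences dominated by exponentially weighted sums *)

Section weights.
Context {R : realType}.

Definition wt (d : R) (j k : int) : R := 2 `^ (- d * `|j%:~R - k%:~R|).

Lemma wt_ge0 (d : R) j k : 0 <= wt d j k. Proof. exact: powR_ge0. Qed.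

Lemma wt_gt0 (d : R) j k : 0 < wt d j k. Proof. exact: powR_gt0. Qed.

Lemma wtC (d : R) j k : wt d j k = wt d k j. Proof. by rewrite /wt distrC. Qed.

Lemma le_wt (d e : R) j k : d <= e -> wt e j k <= wt d j k.
Proof.
by move=> de; rewrite ler_powR ?ler1n// !mulNr lerN2 ler_wpM2r.
Qed.

Lemma wtD (d e : R) j k : wt d j k * wt e j k = wt (d + e) j k.
Proof.
rewrite /wt -powRD; last by rewrite pnatr_eq0 implybT.
by congr (_ `^ _); ring.
Qed.

(** The decay is split in two: half pays for the triangle inequality between i, j and k, half is
    kept so that [dom_trans] can still sum over j. *)
Lemma wtMM (d : R) i j k : 0 <= d -> wt d i j * wt d j k <= wt (d / 2) i k * wt (d / 2) j k.
Proof.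
move=> d0; rewrite /wt -!powRD ?pnatr_eq0 ?implybT// ler_powR ?ler1n//.
have := ler_distD (j%:~R : R) i%:~R k%:~R.
set a := `|_|; set b := `|_|; set c := `|_| => abc.
have : d * a <= d * b + d * c by rewrite -mulrDr ler_wpM2l.
have : 0 <= d * b by rewrite mulr_ge0// normr_ge0.
lra.
Qed.

Lemma esum_geometric (x : R) : 0 <= x -> x < 1 ->
  (\esum_(n in [set: nat]) (x ^+ n)%:E <= (1 - x)^-1%:E)%E.
Proof.
move=> x0 x1; rewrite -nneseries_esumT; last first.
  by move=> n; rewrite lee_fin exprn_ge0.
apply: lime_le.
  by apply: is_cvg_nneseries => n _ _; rewrite lee_fin exprn_ge0.
apply: nearW => n; rewrite sumEFin lee_fin.
rewrite -[leRHS]mul1r ler_pdivlMr ?subr_gt0//.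
have := subrX1 x n; rewrite big_mkord => e.
have := exprn_ge0 n x0.
by rewrite mulrC -opprB mulNr -e opprB; lra.
Qed.

Lemma wt_esum_fin (d : R) : 0 < d -> exists2 M : R, 0 < M &
  forall k, (\esum_(j in [set: int]) (wt d j k)%:E <= M%:E)%E.
Proof.
move=> d0; pose x : R := 2 `^ (- d).
have x0 : 0 <= x by exact: powR_ge0.
have x1 : x < 1.
  rewrite /x powRN invf_lt1 ?powR_gt0//.
  have e : 1 `^ d = 1 :> R by rewrite powR1.
  rewrite -[ltLHS]e.
  by apply: gt0_ltr_powR => //; rewrite ?nnegrE// ltr1n.
exists ((1 - x)^-1 *+ 2) => [|k]; first by rewrite pmulrn_lgt0// invr_gt0 subr_gt0.
have wtE (n : nat) (j : int) : (`|j - k| = n)%N -> wt d j k = x ^+ n.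
  move=> <-; rewrite /wt /x -powR_mulrn ?powR_ge0// -powRrM; congr (_ `^ (_ * _)).
  by rewrite -intrB -intr_norm natr_absz.
rewrite (@esumID _ _ [set j | k <= j])//; last by move=> *; rewrite lee_fin wt_ge0.
rewrite mulr2n EFinD; apply: leeD; rewrite setTI.
  rewrite (@reindex_esum _ _ _ [set: nat] _ (fun n : nat => k + n%:Z)).
    apply: le_trans (esum_geometric x0 x1); apply: le_esum => n _.
    by rewrite lee_fin (wtE n)// addrAC subrr add0r.
  split=> [n _ /=|n m _ _ /addrI[]//|j /= kj]; first by rewrite lerDl.
  by exists `|j - k|%N => //; rewrite gez0_abs ?subr_ge0// addrCA subrr addr0.
rewrite (@reindex_esum _ _ _ [set: nat] _ (fun n : nat => k - n.+1%:Z)).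
  apply: le_trans (esum_geometric x0 x1); apply: le_esum => n _.
  rewrite lee_fin (wtE n.+1); last by rewrite addrAC subrr add0r abszN.
  by rewrite exprS ler_piMl ?exprn_ge0// ltW.
split=> [n _ /=|n m _ _ /=|j /= kj].
- by apply/negP; rewrite -ltNge ltrBlDr ltrDl.
- by move=> e; lia.
- by exists (`|j - k|.-1)%N => //; lia.
Qed.

Local Open Scope ereal_scope.

(** For r >= 1 the weights, whose total mass is bounded independently of k, enter Jensen's
    inequality; for r < 1 the power is taken termwise, which lowers the rate of decay to d r. *)
Lemma wt_esum_poweR (d r : R) : (0 < d)%R -> (0 < r)%R ->
  exists2 C : R, (0 < C)%R & forall k (a : int -> \bar R),
    (forall j, 0 <= a j) ->
    (\esum_(j in [set: int]) ((wt d j k)%:E * a j)) `^ r <=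
    C%:E * \esum_(j in [set: int])
      ((wt (d * Num.min r 1) j k)%:E * a j `^ r).
Proof.
move=> d0 r0; have [M M0 HM] := wt_esum_fin d0.
have [r1|r1] := leP 1%R r.
  exists (2 `^ r * M `^ (r - 1))%R; first by rewrite mulr_gt0 ?powR_gt0.
  move=> k a a0; rewrite mulr1.
  under eq_esum do rewrite muleC.
  under [X in _ <= _ * X]eq_esum do rewrite muleC.
  by apply: esum_poweR_ge1 => // i; rewrite lee_fin wt_ge0.
exists 1%R => // k a a0; rewrite mul1e.
apply: (le_trans (@esum_poweR_le1 _ _ _ _ _ r0 (ltW r1) _)).
  by move=> i; rewrite mule_ge0// lee_fin wt_ge0.
apply: le_esum => j _; rewrite poweRM ?lee_fin ?wt_ge0// poweR_EFin.
by rewrite /wt -powRrM mulrAC mulNr.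
Qed.

(* Domination by a convolution with [2^(- d |j|)]: it bounds every sequence norm
   of [b], whatever the exponent. *)
Definition dom (C d : R) (b a : int -> \bar R) :=
  forall k, b k <= C%:E * \esum_(j in [set: int]) ((wt d j k)%:E * a j).

Lemma dom_trans (C1 d1 C2 d2 : R) : (0 < C1)%R -> (0 < d1)%R ->
  (0 < C2)%R -> (0 < d2)%R ->
  exists C d, [/\ (0 < C)%R, (0 < d)%R & forall a b c : int -> \bar R,
    (forall j, 0 <= a j) -> (forall j, 0 <= b j) ->
    dom C1 d1 b a -> dom C2 d2 c b -> dom C d c a].
Proof.
move=> C10 d10 C20 d20; pose e := Num.min d1 d2.
have e0 : (0 < e)%R by rewrite lt_min d10.
have [M M0 HM] := wt_esum_fin (divr_gt0 e0 (ltr0Sn _ 1)).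
exists (C2 * (C1 * M))%R, (e / 2)%R; split; rewrite ?mulr_gt0 ?divr_gt0//.
move=> a b c a0 b0 ba cb k; apply: le_trans (cb k) _.
rewrite !EFinM -!muleA; apply: lee_wpmul2l; first by rewrite lee_fin ltW.
have wa0 f j i : 0 <= (wt f i j)%:E * a i by rewrite mule_ge0// lee_fin wt_ge0.
apply: (@le_trans _ _ (\esum_(j in [set: int]) (C1%:E * \esum_(i in [set: int])
    ((wt (e / 2) i k)%:E * a i * (wt (e / 2) j k)%:E)))).
  apply: le_esum => j _; apply: (@le_trans _ _ ((wt e j k)%:E *
      (C1%:E * \esum_(i in [set: int]) ((wt e i j)%:E * a i)))).
    apply: lee_pmul; rewrite ?lee_fin ?wt_ge0//.
    - by rewrite le_wt// ge_min lexx orbT.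
    - apply: le_trans (ba j) _; apply: lee_wpmul2l; first by rewrite lee_fin ltW.
      apply: le_esum => i _; apply: lee_wpmul2r => //.
      by rewrite lee_fin le_wt// ge_min lexx.
  rewrite muleCA; apply: lee_wpmul2l; first by rewrite lee_fin ltW.
  rewrite -esumZl ?wt_ge0//; apply: le_esum => i _.
  rewrite muleA [leRHS]muleAC -!EFinM; apply: lee_wpmul2r => //.
  by rewrite lee_fin mulrC; apply: wtMM; exact: ltW.
rewrite esumZl ?(ltW C10)//; last first.
  by move=> j; apply: esum_ge0 => i _; rewrite mule_ge0// lee_fin wt_ge0.
apply: lee_wpmul2l; first by rewrite lee_fin ltW.
rewrite esum_exchange; last by move=> *; rewrite mule_ge0// lee_fin wt_ge0.
rewrite -esumZl ?(ltW M0)//; apply: le_esum => i _.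
apply: le_trans (esumZl_le _ _ _) _ => //; first by move=> *; rewrite lee_fin wt_ge0.
by rewrite muleC; apply: lee_wpmul2r.
Qed.

(** Convolution with a summable sequence, for every exponent r > 0. After [wt_esum_poweR] the kernel
    is symmetric with bounded row sums, so exchanging the sums is enough. *)
Lemma dom_esum_poweR (C d r : R) : (0 < C)%R -> (0 < d)%R -> (0 < r)%R ->
  exists2 D : R, (0 < D)%R & forall a b : int -> \bar R,
    (forall j, 0 <= a j) -> (forall j, 0 <= b j) -> dom C d b a ->
    \esum_(k in [set: int]) b k `^ r <= D%:E * \esum_(k in [set: int]) a k `^ r.
Proof.
move=> C0 d0 r0; have [D D0 HD] := wt_esum_poweR d0 r0.
have e0 : (0 < d * Num.min r 1)%R by rewrite mulr_gt0// lt_min r0 ltr01.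
have [M M0 HM] := wt_esum_fin e0.
exists (C `^ r * D * M)%R; first by rewrite !mulr_gt0 ?powR_gt0.
move=> a b a0 b0 ba.
have E0 k : 0 <= \esum_(j in [set: int]) ((wt d j k)%:E * a j).
  by apply: esum_ge0 => j _; rewrite mule_ge0// lee_fin wt_ge0.
apply: (@le_trans _ _ (\esum_(k in [set: int]) ((C `^ r * D)%:E *
    \esum_(j in [set: int]) ((wt (d * Num.min r 1) j k)%:E * a j `^ r)))).
  apply: le_esum => k _; rewrite EFinM -muleA.
  apply: (@le_trans _ _ ((C%:E * \esum_(j in [set: int]) ((wt d j k)%:E * a j)) `^ r)).
    apply: (gt0_ler_poweR (ltW r0)); rewrite ?in_itv/= ?leey ?andbT//.
    by rewrite mule_ge0// lee_fin ltW.
  rewrite poweRM ?lee_fin ?(ltW C0)// poweR_EFin.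
  by apply: lee_wpmul2l; [rewrite lee_fin powR_ge0|exact: HD].
have CD0 : (0 <= C `^ r * D)%R by rewrite mulr_ge0 ?powR_ge0 ?(ltW D0).
rewrite esumZl//; last first.
  by move=> k; apply: esum_ge0 => j _; rewrite mule_ge0 ?poweR_ge0// lee_fin wt_ge0.
rewrite [in leRHS]EFinM -muleA; apply: lee_wpmul2l; first by rewrite lee_fin.
rewrite esum_exchange; last by move=> *; rewrite mule_ge0 ?poweR_ge0// lee_fin wt_ge0.
rewrite -esumZl ?(ltW M0)//; last by move=> *; exact: poweR_ge0.
apply: le_esum => j _; rewrite [leRHS]muleC.
under eq_esum do rewrite muleC wtC.
apply: (le_trans (@esumZl_le _ _ _ _ _ _ _)); first exact: poweR_ge0.
  by move=> i; rewrite lee_fin wt_ge0.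
by apply: lee_wpmul2l; [exact: poweR_ge0|exact: HM].
Qed.

Lemma dom_sup (C d : R) : (0 < C)%R -> (0 < d)%R ->
  exists2 D : R, (0 < D)%R & forall (a b : int -> \bar R) M,
    (forall j, 0 <= a j) -> dom C d b a -> (forall j, a j <= M) ->
    forall k, b k <= D%:E * M.
Proof.
move=> C0 d0; have [M M0 HM] := wt_esum_fin d0.
exists (C * M)%R; first by rewrite mulr_gt0.
move=> a b N a0 ba aN k; apply: le_trans (ba k) _.
rewrite EFinM -muleA; apply: lee_wpmul2l; first by rewrite lee_fin ltW.
have N0 : 0 <= N by apply: le_trans (aN 0%R).
apply: (@le_trans _ _ (\esum_(j in [set: int]) (N * (wt d j k)%:E))).
  by apply: le_esum => j _; rewrite muleC lee_wpmul2r// lee_fin wt_ge0.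
apply: le_trans (esumZl_le _ _ _) _ => //; first by move=> *; rewrite lee_fin wt_ge0.
by rewrite muleC lee_wpmul2r.
Qed.

Definition lq (q : \bar R) (N : int -> \bar R) : \bar R :=
  match q with
  | r%:E => (\esum_(k in [set: int]) N k `^ r) `^ r^-1
  | _ => ereal_sup [set N k | k in [set: int]]
  end.

(** The hypothesis compares p-th powers, so the exponent r is reached by applying r/p to them; r/p
    may well be less than 1. *)
Lemma lq_dom (C d p : R) (q : \bar R) : (0 < C)%R -> (0 < d)%R -> (0 < p)%R ->
  0 < q ->
  exists2 D : R, (0 <= D)%R & forall N N' : int -> \bar R,
    (forall k, 0 <= N k) -> (forall k, 0 <= N' k) ->
    dom C d (fun k => N' k `^ p) (fun k => N k `^ p) ->
    lq q N' <= D%:E * lq q N.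
Proof.
move=> C0 d0 p0; case: q => [r r0|_|//]; last first.
  have [D D0 HD] := dom_sup C0 d0; exists (D `^ p^-1)%R; first exact: powR_ge0.
  move=> N N' N0 N'0 NN; rewrite /lq/=; set S := ereal_sup (range N).
  have NS k : N k <= S by apply: ereal_sup_ubound; exists k.
  have S0 : 0 <= S by apply: le_trans (NS 0%R).
  apply: ge_ereal_sup => _ [k _ <-].
  have := HD _ _ (S `^ p) (fun=> poweR_ge0 _ _) NN.
  have pS j : N j `^ p <= S `^ p.
    by apply: (gt0_ler_poweR (ltW p0)); rewrite ?in_itv/= ?leey ?andbT.
  move=> /(_ pS k) H.
  rewrite -[N' k]poweRe1// -(mulfV (lt0r_neq0 p0)) poweRrM.
  apply: le_trans (gt0_ler_poweR _ _ _ H) _; rewrite ?in_itv/= ?leey ?andbT ?poweR_ge0//.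
  - by rewrite invr_ge0 ltW.
  - by rewrite mule_ge0 ?poweR_ge0// lee_fin ltW.
  rewrite poweRM ?poweR_ge0 ?lee_fin ?(ltW D0)// poweR_EFin -poweRrM.
  by rewrite mulfV ?gt_eqF// poweRe1.
rewrite lte_fin in r0; have rp : (0 < r / p)%R by rewrite divr_gt0.
have [D D0 HD] := dom_esum_poweR C0 d0 rp.
exists (D `^ r^-1)%R; first exact: powR_ge0.
move=> N N' N0 N'0 NN; rewrite /lq/=.
have e (x : \bar R) : (x `^ p) `^ (r / p) = x `^ r.
  by rewrite -poweRrM mulrCA mulfV ?mulr1// gt_eqF.
have := HD _ _ (fun=> poweR_ge0 _ _) (fun=> poweR_ge0 _ _) NN.
under eq_esum do rewrite e; under [X in _ * X]eq_esum do rewrite e.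
move=> H; have E0 (M : int -> \bar R) : 0 <= \esum_(k in [set: int]) M k `^ r.
  by apply: esum_ge0 => *; exact: poweR_ge0.
apply: le_trans (gt0_ler_poweR _ _ _ H) _; rewrite ?in_itv/= ?leey ?andbT//.
- by rewrite invr_ge0 ltW.
- by rewrite mule_ge0// lee_fin ltW.
by rewrite poweRM ?lee_fin ?(ltW D0).
Qed.

Lemma lq_ge (q : \bar R) : 0 < q -> forall (N : int -> \bar R) k,
  (forall k, 0 <= N k) -> N k <= lq q N.
Proof.
case: q => [r|_ N k _|//]; last by apply: ereal_sup_ubound; exists k.
rewrite lte_fin => r0 N k N0; rewrite /lq/=.
rewrite -[leLHS]poweRe1// -(mulfV (lt0r_neq0 r0)) poweRrM.
apply: gt0_ler_poweR; rewrite ?in_itv/= ?leey ?andbT ?poweR_ge0//.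
- by rewrite invr_ge0 ltW.
- by apply: esum_ge0 => *; exact: poweR_ge0.
exact: (esum_ge_term (fun k => N k `^ r)).
Qed.

End weights.

(** * Dyadic radii and regular spaces *)

Section dyadic_radius.
Context {R : realType}.

Definition rad (k : int) : R := 2 `^ (- k%:~R).

Lemma rad_gt0 k : 0 < rad k. Proof. exact: powR_gt0. Qed.

Lemma rad_ge0 k : 0 <= rad k. Proof. exact: powR_ge0. Qed.

Lemma radE k : (2 : R) ^ (- k) = rad k.
Proof. by rewrite /rad -powR_intmul// intrN. Qed.

Lemma radD k l : rad (k + l) = rad k * rad l.
Proof. by rewrite /rad intrD opprD powRD// pnatr_eq0 implybT. Qed.

Lemma rad1 : rad 1 = 2^-1.
Proof. by rewrite /rad powR_inv1. Qed.

Lemma rad_half k : rad (k + 1) = rad k / 2.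
Proof. by rewrite radD rad1. Qed.

Lemma rad_netE k : (2 : R) ^ (- k - 1) = rad k / 2.
Proof. by rewrite -opprD radE rad_half. Qed.

Lemma le_rad k l : k <= l -> rad l <= rad k.
Proof. by move=> kl; rewrite ler_powR ?ler1n// lerN2 ler_int. Qed.

Lemma radB (k : int) (n : nat) : rad (k - n%:Z) = 2 ^+ n * rad k.
Proof.
rewrite radD mulrC; congr (_ * _).
by rewrite /rad intrN opprK powR_mulrn.
Qed.

Lemma rad_powR k Q : rad k `^ Q = 2 `^ (- (k%:~R * Q)).
Proof. by rewrite /rad -powRrM mulNr. Qed.

Lemma rad_approx (r : R) : 0 < r -> exists k, rad k <= r < 2 * rad k.
Proof.
move=> r0; pose x := ln r / ln 2.
have l2 : 0 < ln (2 : R) by rewrite ln_gt0// ltr1n.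
have rE : r = 2 `^ x by rewrite /powR pnatr_eq0/= /x divfK ?gt_eqF// lnK.
exists (- Num.floor x); rewrite /rad intrN opprK [in X in X && _]rE [in X in _ && X]rE; apply/andP; split.
  by rewrite ler_powR ?ler1n// floor_le.
have -> : 2 * 2 `^ (Num.floor x)%:~R = 2 `^ (Num.floor x + 1)%:~R :> R.
  by rewrite intrD powRD ?pnatr_eq0 ?implybT// powRr1// mulrC.
rewrite lt_neqAle ler_powR ?ler1n// ?(ltW (floorD1_gt x))// andbT.
apply/eqP => e; have := floorD1_gt x; rewrite ltNge => /negP; apply.
have : ln (2 `^ x) = ln (2 `^ (Num.floor x + 1)%:~R : R) by rewrite e.
by rewrite !ln_powR => /(mulIf (lt0r_neq0 l2)) <-.
Qed.

End dyadic_radius.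

Section regular_space.
Context {R : realType} {T : pmetricType R}.
Implicit Types (mu : {outer_measure set T -> \bar R}) (Q C r : R) (x y z : T).

Lemma ballP x r y : ball x r y <-> mdist x y < r.
Proof. by rewrite ballEmdist. Qed.

Lemma open_ball_metric x r : open (ball x r).
Proof.
rewrite openE => y /ballP xy; apply/nbhs_ballP.
exists (r - mdist x y); first by rewrite /= subr_gt0.
move=> z /ballP yz; apply/ballP.
by apply: le_lt_trans (metric_triangle x y z) _; rewrite addrC -ltrBrDr.
Qed.

(* Besides Borel regularity, only the two-sided bound on the measure of balls
   is needed; it holds for radii up to a fixed multiple of the diameter. *)
Definition regular mu Q C :=
  [/\ 1 <= C, borel_regular mu,
      (forall x r, 0 < r -> (mu (ball x r) <= (C * r `^ Q)%:E)%E) &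
      (forall x r, 0 < r -> (exists y z, r / 16 < mdist y z) ->
        ((C^-1 * r `^ Q)%:E <= mu (ball x r))%E)].

(** The upper bound extends to radii beyond the diameter at the cost of the total mass; the lower
    bound at r is inherited from r/16, a radius below the diameter. *)
Lemma ahlfors_regularP mu Q : 0 < Q -> (0 < diam [set: T])%E ->
  ahlfors_regular mu Q -> exists C, regular mu Q C.
Proof.
move=> Q0 dT [[br bpos] [C C0 HC]].
have [D D0 HD] : exists2 D : R, 0 < D &
    forall x r, 0 < r -> (mu (ball x r) <= (D * r `^ Q)%:E)%E.
  have [dy|] := eqVneq (diam [set: T]) +oo%E.
    exists C => // x r r0.
    have rd : (r%:E < diam [set: T])%E by rewrite dy ltry.
    by have /andP[] := HC x r r0 rd.
  case dTE : (diam [set: T]) dT => [d| |]//; rewrite lte_fin => d0 _.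
  (* In the bounded case the whole space is a ball, hence has finite measure m, and m <= (m / d^Q)
     r^Q for r >= d. *)
  have mT x : mu [set: T] = mu (ball x (2 * d)).
    congr (mu _); apply/seteqP; split => // y _; apply/ballP.
    apply: (@le_lt_trans _ _ d); last by rewrite mulr_natl mulr2n ltrDl.
    rewrite -lee_fin -dTE; apply: ereal_sup_ubound; right.
    by exists (x, y).
  have d20 : 0 < 2 * d by rewrite mulr_gt0.
  have := bpos point (2 * d) d20; rewrite -mT => /andP[m0 mfin].
  have mE : mu [set: T] = (fine (mu [set: T]))%:E.
    by rewrite fineK// ge0_fin_numE// ltW.
  set m := fine _ in mE.
  exists (C + m / d `^ Q).
    by rewrite ltr_wpDr// divr_ge0 ?powR_ge0// -lee_fin -mE ltW.
  move=> x r r0; have [rd|dr] := ltP r d.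
    have rdE : (r%:E < diam [set: T])%E by rewrite dTE lte_fin.
    have /andP[_ /le_trans->//] := HC x r r0 rdE.
    by rewrite lee_fin ler_wpM2r ?powR_ge0// lerDl divr_ge0 ?powR_ge0// -lee_fin -mE ltW.
  apply: (@le_trans _ _ m%:E); first by rewrite -mE; exact: le_outer_measure.
  rewrite lee_fin mulrDl -[leLHS]add0r lerD ?mulr_ge0 ?powR_ge0 ?(ltW C0)//.
  rewrite mulrAC -mulrA ler_peMr//; first by rewrite -lee_fin -mE ltW.
  rewrite ler_pdivlMr ?powR_gt0// mul1r ge0_ler_powR ?nnegrE ?(ltW Q0) ?(ltW d0)//.
  exact: ltW.
pose E := C * 16 `^ Q.
have E0 : 0 < E by rewrite mulr_gt0// powR_gt0.
exists (1 + D + E); split => //.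
- by rewrite -addrA lerDl addr_ge0 ?ltW.
- move=> x r r0; apply: (le_trans (HD x r r0)).
  by rewrite lee_fin ler_wpM2r ?powR_ge0//; lra.
- move=> x r r0 [y [z ryz]].
  have r'0 : 0 < r / 16 by rewrite divr_gt0.
  have rd : ((r / 16)%:E < diam [set: T])%E.
    apply: (@lt_le_trans _ _ (mdist y z)%:E); first by rewrite lte_fin.
    by apply: ereal_sup_ubound; right; exists (y, z).
  have /andP[h _] := HC x _ r'0 rd.
  apply: (le_trans _ (le_trans h _)); last first.
    apply: le_outer_measure; apply: le_ball.
    by rewrite ler_pdivrMr// ler_peMr ?(ltW r0)// ler1n.
  rewrite lee_fin powRM ?invr_ge0 ?(ltW r0)//.
  have -> : (16^-1 : R) `^ Q = (16 `^ Q)^-1.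
    by rewrite -[in LHS]powR_inv1// -powRrM mulN1r powRN.
  rewrite [leRHS](_ : _ = E^-1 * r `^ Q); last by rewrite /E invfM; ring.
  rewrite ler_wpM2r ?powR_ge0// lef_pV2 ?posrE//; last by lra.
  by rewrite lerDr; lra.
Qed.

Lemma measurable_ball mu x r : borel_regular mu ->
  measurable (ball x r : set (caratheodory_type mu)).
Proof. by move=> [mB _]; apply: mB; apply: sub_sigma_algebra; exact: open_ball_metric. Qed.

Lemma measurable_open mu (U : set T) : borel_regular mu -> open U ->
  measurable (U : set (caratheodory_type mu)).
Proof. by move=> [mB _] oU; apply: mB; exact: sub_sigma_algebra. Qed.

(** A packing condition on centres [c], not necessarily distinct, since edges are counted by their
    starting points. The count is an extended real sum of indicators, so the bound contains
    finiteness. Large values of [K] serve to count at coarser scales. *)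
Definition scattered (I : choiceType) (E : set I) (c : I -> T) r (D Q : R) :=
  forall z K, 1 <= K ->
  (\esum_(i in E) (\1_(ball z (K * r)) (c i) : R)%:E <= (D * K `^ Q)%:E)%E.

(** Packing by volume: the balls of radius r/2 about the points are disjoint and lie in a ball of
    radius 2 K r. The ratio of the volumes gives (4 K)^Q, and the regularity constant enters
    twice. *)
Lemma separated_scattered mu Q C : 0 < Q -> regular mu Q C ->
  forall r (A : set T), 0 < r -> Defs.separated r A ->
  scattered A id r (C ^+ 2 * 4 `^ Q) Q.
Proof.
move=> Q0 [C1 br ub lb] r A r0 sA z K K1; apply: esum_le_fsets => B fB BA.
set b := ball z (K * r).
pose B' := B `&` b.
have fB' : finite_set B' by exact: finite_setIl.
have -> : (\sum_(i \in B) (\1_b i : R)%:E = \sum_(i \in B') (1 : \bar R))%E.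
  rewrite /B' fsbig_mkcondr; apply: eq_fsbigr => i _; rewrite indicE.
  by case: (_ \in _).
have C0 : 0 < C by apply: lt_le_trans C1.
have K0 : 0 < K by apply: lt_le_trans K1.
(* Two points of [B'] are at distance at least r, which is what the lower bound on balls of radius
   r/2 requires; otherwise [B'] has at most one point. *)
have [[x [y [B'x B'y xy]]]|nB'] :=
    pselect (exists x y, [/\ B' x, B' y & x != y]).
  have rxy : r <= mdist x y by apply: sA => //; apply: BA; [case: B'x|case: B'y].
  pose c := C^-1 * (r / 2) `^ Q.
  have c0 : 0 < c by rewrite mulr_gt0 ?invr_gt0 ?powR_gt0 ?divr_gt0.
  suff H : (c%:E * \sum_(i \in B') (1 : \bar R) <= (C * (2 * K * r) `^ Q)%:E)%E.
    rewrite -(@lee_pmul2l _ c%:E) ?fin_numE// ?lte_fin//.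
    apply: (le_trans H); rewrite -EFinM lee_fin le_eqVlt; apply/orP; left.
    have -> : 2 * K * r = 4 * (K * (r / 2)) by field.
    have r20 : 0 <= r / 2 by rewrite divr_ge0// ltW.
    rewrite /c; move: (r / 2) r20 => h h0.
    rewrite !powRM ?mulr_ge0 ?(ltW K0)//; apply/eqP; field.
    by rewrite gt_eqF.
  rewrite ge0_mule_fsumr//; under eq_fsbigr do rewrite mule1.
  apply: (@le_trans _ _ (\sum_(i \in B') (cara mu) (ball i (r / 2)))%E).
    apply: lee_fsum => // i B'i; apply: lb; first by rewrite divr_gt0.
    exists x, y; apply: lt_le_trans rxy.
    by move: r0; clear; lra.
  rewrite -measure_fin_bigcup//; last first.
  - by move=> i _; exact: measurable_ball.
  - move=> i j B'i B'j [w [/ballP iw /ballP jw]]; apply/eqP/negPn/negP => ij.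
    have : r <= mdist i j by apply: sA => //; apply: BA; [case: B'i|case: B'j].
    rewrite leNgt => /negP; apply; apply: le_lt_trans (metric_triangle i w j) _.
    by rewrite (metric_sym w) [ltRHS](splitr r) ltrD.
  apply: (@le_trans _ _ (mu (ball z (2 * K * r)))); last first.
    by apply: ub; rewrite !mulr_gt0.
  apply: le_outer_measure => w [i B'i /ballP iw]; apply/ballP.
  have /ballP zi := B'i.2.
  apply: le_lt_trans (metric_triangle z i w) _.
  rewrite -mulrA mulr_natl mulr2n ltrD// (lt_le_trans iw)//.
  by rewrite ler_pdivrMr// mulrAC ler_peMl ?(ltW r0)//; lra.
apply: (@le_trans _ _ 1%E).
  have [->|/set0P[x B'x]] := eqVneq B' set0; first by rewrite fsbig_set0.
  suff -> : B' = [set x] by rewrite fsbig_set1.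
  apply/seteqP; split => [y B'y /=|_ ->//].
  apply/eqP/negPn/negP => yx; apply: nB'; by exists y, x.
have l1 (u : R) : 1 <= u -> 1 <= u `^ Q.
  by move=> u1; rewrite -[leLHS](powRr0 u) ler_powR// ltW.
rewrite lee_fin !mulr_ege1// ?exprn_ege1// l1// ler1n//.
Qed.

Lemma scattered_countable (I : choiceType) (E : set I) c r D Q :
  0 < r -> scattered E c r D Q -> countable E.
Proof.
move=> r0 sE.
have -> : E = \bigcup_n (E `&` [set i | ball point (n.+1%:R * r) (c i)]).
  apply/seteqP; split => [i Ei|i [n _ []]//].
  exists (Num.truncn (mdist point (c i) / r)) => //; split => //.
  by apply/ballP; rewrite -ltr_pdivrMr// truncnS_gt.
apply: bigcup_countable => // n _; apply: finite_set_countable.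
apply: contrapT => /infinite_set_fset infE.
have [B BE Bn] := infE (Num.truncn (D * n.+1%:R `^ Q)).+1.
have := sE point n.+1%:R; rewrite ler1n => /(_ isT).
apply/negP; rewrite -ltNge.
apply: (@lt_le_trans _ _ ((#|` B|)%fset%:R%:E)).
  rewrite lte_fin (lt_le_trans (truncnS_gt _))// ler_nat//.
apply: esum_ge; exists [set` B]; first by split => // i /BE[].
rewrite -fsbig_seq ?fset_uniq//.
rewrite (eq_big_seq (fun=> 1%:E)) => [|i iB].
  rewrite sumEFin lee_fin big_const_seq count_predT iter_addr_0//.
by rewrite indicE mem_set//; have [] := BE i iB.
Qed.

End regular_space.

(** * Hyperbolic fillings *)

Section filling.
Context {R : realType} {T : pmetricType R}.
Implicit Types (X : hyperbolic_filling T) (k n : int) (x y z w : T)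
  (e : vertex T * vertex T).

Lemma vballE (x : vertex T) : vball x = ball x.2 (rad x.1).
Proof. by rewrite /vball radE. Qed.

Lemma net_separated X n : Defs.separated (rad n / 2) (net X n).
Proof. by have [] := net_maximal X n; rewrite rad_netE. Qed.

Lemma net_near X n w : exists2 x, net X n x & mdist x w < rad n / 2.
Proof.
have [sN maxN] := net_maximal X n; rewrite rad_netE in sN maxN.
apply: contrapT => noN.
have far x : net X n x -> rad n / 2 <= mdist x w.
  by move=> Nx; rewrite leNgt; apply/negP => xw; apply: noN; exists x.
have Nw : net X n w.
  rewrite -(maxN (net X n `|` [set w])); [by right| |by left].
  move=> x y [Nx|->] [Ny|->] xy; [exact: sN|exact: far| |by rewrite eqxx in xy].
  by rewrite metric_sym; exact: far.
by have := far w Nw; rewrite mdistxx leNgt divr_gt0// rad_gt0.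
Qed.

Definition edges_at X k : set (vertex T * vertex T) :=
  [set e | edges X e /\ elevel e = k].

Lemma edges_atP X k e : edges_at X k e ->
  [/\ e.1.1 = k, net X k e.1.2, net X e.2.1 e.2.2,
      e.2.1 = k \/ e.2.1 = k + 1 & mdist e.1.2 e.2.2 < 2 * rad k].
Proof.
move=> [Ee lek].
have [] := edges_adjacent Ee; rewrite /is_vertex/= /level => N1 N2 _ d12.
have := edges_upward Ee; rewrite /level => le12.
have e1k : e.1.1 = k by rewrite -lek /elevel /level min_l.
have e2k : e.2.1 = k \/ e.2.1 = k + 1 by lia.
rewrite !vballE => -[w [/ballP w1 /ballP w2]]; split => //; first by rewrite -e1k.
apply: le_lt_trans (metric_triangle _ w _) _; rewrite (metric_sym w).
rewrite mulr_natl mulr2n ltrD//; first by rewrite -e1k.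
by apply: lt_le_trans w2 _; rewrite le_rad//; lia.
Qed.

Lemma eball_sub X k e : edges_at X k e -> eball e `<=` ball e.1.2 (3 * rad k).
Proof.
move=> /edges_atP[e1 _ _ e2 d12] z; rewrite /eball !vballE e1 => -[] /ballP ez.
  apply/ballP; apply: lt_le_trans ez _.
  by rewrite ler_peMl ?rad_ge0// ler1n.
apply/ballP; apply: le_lt_trans (metric_triangle _ e.2.2 _) _.
have -> : 3 * rad k = 2 * rad k + rad k :> R by ring.
by rewrite ltrD// (lt_le_trans ez)// le_rad//; lia.
Qed.

Lemma vball1_sub X k e : edges_at X k e -> ball e.1.2 (rad k) `<=` eball e.
Proof. by move=> /edges_atP[e1 _ _ _ _] z ez; left; rewrite vballE e1. Qed.

Section scattered.
Context (mu : {outer_measure set T -> \bar R}) (Q C : R).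
Hypotheses (Q0 : 0 < Q) (rmu : regular mu Q C).

Lemma net_scattered : exists2 D : R, 0 < D &
  forall X k, scattered (net X k) id (rad k) D Q.
Proof.
have C1 : 1 <= C by case: rmu.
have D0 : 0 < C ^+ 2 * 4 `^ Q.
  by rewrite mulr_gt0 ?powR_gt0// exprn_gt0// (lt_le_trans _ C1).
exists (C ^+ 2 * 4 `^ Q * 2 `^ Q); first by rewrite mulr_gt0 ?powR_gt0.
move=> X k z K K1.
have r0 : 0 < rad k / 2 :> R by rewrite divr_gt0// rad_gt0.
have K21 : 1 <= 2 * K by lra.
have := separated_scattered Q0 rmu r0 (@net_separated X k) z K21.
have -> : 2 * K * (rad k / 2) = K * rad k by field.
by rewrite powRM ?mulrA//; lra.
Qed.

(** Edges point upwards, so an edge of level k starts at level k and is determined by its starting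
    point and its end vertex; each starting point has at most [M] end vertices. *)
Lemma edges_scattered : exists2 D : R, 0 < D &
  forall X k, scattered (edges_at X k) (fun e => e.1.2) (rad k) D Q.
Proof.
have [D D0 HD] := net_scattered.
(* End vertices lie within [2 * rad k] of the starting point, at level k or at level k + 1; for the
   latter this distance is four radii. *)
pose M := D * 2 `^ Q + D * 4 `^ Q.
have M0 : 0 < M by rewrite addr_gt0// mulr_gt0// powR_gt0.
exists (M * D) => [|X k z K K1]; first by rewrite mulr_gt0.
set b := ball z (K * rad k).
pose J x := [set y : vertex T | [/\ net X y.1 y.2, y.1 = k \/ y.1 = k + 1 &
  ball x (2 * rad k) y.2]].
pose f e : T * vertex T := (e.1.2, e.2).
have finj : set_inj (edges_at X k) f.
  move=> [[a1 a2] a3] [[b1 b2] b3] /set_mem/edges_atP[/= -> _ _ _ _].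
  by move=> /set_mem/edges_atP[/= -> _ _ _ _] [-> ->].
rewrite -(@esum_image _ _ _ _ _ (fun y : T * vertex T => (\1_b y.1 : R)%:E) finj).
apply: (@le_trans _ _ (\esum_(y in net X k `*`` J) (\1_b y.1 : R)%:E)%E).
  apply: le_esum_set => _ [e /edges_atP[e1 N1 N2 e2 d12] <-].
  by split => //=; split => //; apply/ballP.
rewrite -(@esum_esum _ _ _ _ _ (fun x _ => (\1_b x : R)%:E))//.
have inj l : set_inj [set: T] (fun x => (l, x) : vertex T) by move=> ? ? _ _ [].
have card_le l x (S : set (vertex T)) :
    S `<=` [set (l, y) | y in net X l `&` ball x (2 * rad k)] ->
    (\esum_(y in S) 1 <= \esum_(y in net X l) (\1_(ball x (2 * rad k)) y : R)%:E)%E.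
  move=> SN; apply: le_trans (le_esum_set _ SN) _.
  rewrite (@esum_image _ _ _ _ _ (fun=> 1%E)); last by move=> ? ? _ _ [].
  rewrite esum_mkcondr; apply: le_esum => y _; rewrite indicE.
  by case: (_ \in _).
have Jx x : (\esum_(y in J x) 1 <= M%:E)%E.
  rewrite (@esumID _ _ [set y | y.1 = k])// EFinD; apply: leeD.
  - apply: le_trans (card_le k x _ _) _.
      by move=> [l y] [[/= N1 _ xy] /= lk]; subst l; exists y.
    by apply: HD; rewrite ler1n.
  - apply: le_trans (card_le (k + 1) x _ _) _.
      move=> [l y] [[/= N1 lk xy] /= lk'].
      by have {lk} lk : l = k + 1 by [case: lk]; subst l; exists y.
    have -> : 2 * rad k = 4 * rad (k + 1) :> R by rewrite rad_half; field.
    by apply: HD; rewrite ler1n.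
apply: (@le_trans _ _ (\esum_(x in net X k) (M%:E * (\1_b x : R)%:E))%E).
  apply: le_esum => x _; rewrite muleC.
  apply: (@le_trans _ _ (\esum_(y in J x) ((\1_b x : R)%:E * 1))%E).
    by apply: le_esum => y _; rewrite mule1.
  apply: le_trans (esumZl_le _ _ _) _; rewrite ?lee_fin//.
  by apply: lee_wpmul2l; rewrite ?lee_fin// ?Jx.
rewrite esumZl ?(ltW M0)// -mulrA EFinM; apply: lee_wpmul2l; last exact: HD.
by rewrite lee_fin ltW.
Qed.

Lemma edges_overlap : exists2 D : R, 0 < D & forall X k z,
  (\esum_(e in edges_at X k) (\1_(eball e) z : R)%:E <= D%:E)%E.
Proof.
have [D D0 HD] := edges_scattered; exists (D * 3 `^ Q) => [|X k z].
  by rewrite mulr_gt0 ?powR_gt0.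
apply: le_trans (HD X k z 3 _); last by rewrite ler1n.
apply: le_esum => e Ee; rewrite lee_fin !indicE.
have [/set_mem ez|_] := boolP (z \in eball e); last by case: (_ \in _).
by rewrite mem_set//; apply/ballP; rewrite metric_sym; apply/ballP; exact: eball_sub Ee _ ez.
Qed.

Lemma net_countable X k : countable (net X k).
Proof.
have [D D0 HD] := net_scattered.
exact: scattered_countable (rad_gt0 k) (HD X k).
Qed.

Lemma edges_countable X k : countable (edges_at X k).
Proof.
have [D D0 HD] := edges_scattered.
exact: scattered_countable (rad_gt0 k) (HD X k).
Qed.

Lemma net_enum X k : exists2 u : nat -> T, (forall i, net X k (u i)) &
  forall x, net X k x -> exists i, u i = x.
Proof.
have [x0 Nx0 _] := net_near X k point.
have /pfcard_geP[N0|[u]] := net_countable X k; first by rewrite N0 in Nx0.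
exists u => [i|x Nx]; first exact: funS.
by have [i _ <-] := 'surj_u Nx; exists i.
Qed.

End scattered.
End filling.

(** * Measurable selection of vertices *)

Section selector.
Context {R : realType} {T T' : pmetricType R}.
Context (nu : {outer_measure set T' -> \bar R}) (io : T' -> T).
Hypothesis io_isom : forall x y, mdist (io x) (io y) = mdist x y.

Lemma open_preimage_ball x r : open (io @^-1` ball x r).
Proof.
rewrite openE => y /ballP xy; apply/nbhs_ballP.
exists (r - mdist x (io y)); first by rewrite /= subr_gt0.
move=> z /ballP yz; apply/ballP.
apply: le_lt_trans (metric_triangle x (io y) (io z)) _.
by rewrite io_isom addrC -ltrBrDr.
Qed.

(* [g n w] is a vertex of level [n] whose ball contains [io w]; the functions
   [u \o g n] are simple enough to be measurable whatever [u] is. *)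
Definition selector (X : hyperbolic_filling T) (g : int -> T' -> T) :=
  forall n, [/\ forall w, net X n (g n w),
    forall w, mdist (g n w) (io w) < rad n / 2 &
    forall (u : T -> R) D, measurable D ->
      measurable_fun (D : set (caratheodory_type nu)) (u \o g n)].

(** Takes the first point, in an enumeration of the net, at distance less than [rad n / 2] from
    [io w]. Each value is taken on a difference of measurable sets built from open ones, and there
    are countably many values, so the preimage of any set is measurable. *)
Lemma selector_exists (mu : {outer_measure set T -> \bar R}) Q C X :
  0 < Q -> regular mu Q C -> borel_regular nu ->
  exists g, selector X g.
Proof.
move=> Q0 rmu br.
suff H n : exists gn : T' -> T, [/\ forall w, net X n (gn w),
    forall w, mdist (gn w) (io w) < rad n / 2 &
    forall (u : T -> R) D, measurable D ->
      measurable_fun (D : set (caratheodory_type nu)) (u \o gn)].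
  by have [g Hg] := choice H; exists g.
have [u uN uS] := net_enum Q0 rmu X n.
have ex w : exists i, `[< mdist (u i) (io w) < rad n / 2 >].
  by have [x /uS[i <-] xw] := net_near X n (io w); exists i; apply/asboolP.
pose i w := ex_minn (ex w).
have iP w : mdist (u (i w)) (io w) < rad n / 2.
  by rewrite /i; case: ex_minnP => m /asboolP.
exists (u \o i); split => [w|//|v D mD _ Y mY]; first exact: uN.
apply: measurableI => //.
pose L m : set (caratheodory_type nu) :=
  (io @^-1` ball (u m) (rad n / 2)) `\`
    \bigcup_(j in [set j | (j < m)%N]) (io @^-1` ball (u j) (rad n / 2)).
have LE : (v \o (u \o i)) @^-1` Y = \bigcup_(m in [set m | Y (v (u m))]) L m.
  apply/seteqP; split => [w Yw|w [m /= Ym [wm wj]]] /=.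
    exists (i w) => //; split; first by apply/ballP.
    move=> [j /= ji /ballP wj]; move: ji; rewrite /i; case: ex_minnP => m _ mj.
    by rewrite ltnNge mj//; apply/asboolP.
  suff -> : i w = m by [].
  apply/eqP; rewrite /i; case: ex_minnP => m' /asboolP m'w mj.
  have m'm : (m' <= m)%N by apply: mj; apply/asboolP; exact/ballP.
  rewrite eqn_leq m'm/= leqNgt.
  apply/negP => m'm'; apply: wj; exists m' => //; exact/ballP.
rewrite LE; apply: bigcup_measurable => m _; apply: measurableD.
  by apply: measurable_open => //; exact: open_preimage_ball.
apply: bigcup_measurable => j _.
by apply: measurable_open => //; exact: open_preimage_ball.
Qed.

End selector.

(** * Integrals of unconditional sums *)

Section esum_integral.
Context {R : realType}.
Local Open Scope ereal_scope.

(** A single reindexing for all families, so that integration and measurability of series over the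
    naturals apply to families of functions. The option type avoids the choice of a default
    index. *)
Lemma esum_countable_nneseries (I : choiceType) (E : set I) : countable E ->
  exists (B : set nat) (h : nat -> option I), forall a : I -> \bar R,
    (forall i, 0 <= a i) ->
    \esum_(i in E) a i = \sum_(n <oo) (if n \in B then oapp a 0 (h n) else 0).
Proof.
move=> /countable_bijP[B EB].
have [->|/set0P[i0 Ei0]] := eqVneq E set0.
  exists set0, (fun=> None) => a a0; rewrite esum_set0 eseries0// => n _ _.
  by rewrite in_set0.
have [f [ff fi fs]] : exists f : nat -> option I, set_bij B (Some @` E) f.
  apply/card_set_bijP; apply: card_esym; apply: card_eq_trans EB.
  exact: card_some.
exists B, f => a a0.
have -> : \esum_(i in E) a i = \esum_(i in Some @` E) oapp a 0 i.
  by rewrite esum_image// => x y _ _ [].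
have oa0 i : 0 <= oapp a 0 i by case: i => /=.
rewrite (@reindex_esum _ _ _ B _ f)// esum_mkcond nneseries_esumT//.
by move=> n; case: ifP.
Qed.

Context d {T : measurableType d} (m : {measure set T -> \bar R}).

Lemma ge0_integral_esum (I : choiceType) (E : set I) (D : set T)
    (f : I -> T -> \bar R) : countable E -> measurable D ->
  (forall i, measurable_fun D (f i)) -> (forall i x, 0 <= f i x) ->
  \int[m]_(x in D) (\esum_(i in E) f i x) =
  \esum_(i in E) \int[m]_(x in D) f i x.
Proof.
move=> cE mD mf f0; have [B [h H]] := esum_countable_nneseries cE.
rewrite H; last by move=> i; apply: integral_ge0.
under eq_integral do rewrite H//.
rewrite integral_nneseries//.
- apply: eq_eseriesr => n _; case: ifP => _; last exact: integral0.
  by case: (h n) => //=; exact: integral0.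
- by move=> n; case: (n \in B) => //; case: (h n).
- by move=> n x _; case: (n \in B) => //; case: (h n) => /=.
Qed.

Lemma measurable_fun_esum (I : choiceType) (E : set I) (D : set T)
    (f : I -> T -> \bar R) : countable E ->
  (forall i, measurable_fun D (f i)) -> (forall i x, 0 <= f i x) ->
  measurable_fun D (fun x => \esum_(i in E) f i x).
Proof.
move=> cE mf f0; have [B [h H]] := esum_countable_nneseries cE.
under eq_fun do rewrite H//.
apply: (@ge0_emeasurable_sum _ _ _ _ _ predT) => n.
- by move=> x _ _; case: (n \in B) => //; case: (h n) => /=.
- by move=> _; case: (n \in B) => //; case: (h n).
Qed.

(** No measurability is involved: the integral of a nonnegative function is a supremum over the
    simple functions below it. *)
Lemma le_integral_ge0 (D : set T) (f g : T -> \bar R) :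
  (forall x, D x -> 0 <= f x) -> (forall x, D x -> f x <= g x) ->
  \int[m]_(x in D) f x <= \int[m]_(x in D) g x.
Proof.
move=> f0 fg; rewrite integral_mkcond [leRHS]integral_mkcond.
have f0' x : 0 <= (f \_ D) x.
  by rewrite patchE; case: ifP => // /set_mem; exact: f0.
have fg' x : (f \_ D) x <= (g \_ D) x.
  by rewrite !patchE; case: ifP => // /set_mem; exact: fg.
rewrite !ge0_integralTE//; last by move=> x; apply: le_trans (fg' x).
apply: le_ereal_sup => _ [h hf <-]; exists h => // x.
exact: le_trans (hf x) (fg' x).
Qed.

Lemma integral_esum_indic (I : choiceType) (E : set I) (D : set T)
    (V : I -> set T) (a : I -> \bar R) : countable E -> measurable D ->
  (forall i, measurable (V i)) -> (forall i, 0 <= a i) ->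
  \int[m]_(x in D) (\esum_(i in E) (a i * (\1_(V i) x : R)%:E)) =
  \esum_(i in E) (a i * m (V i `&` D)).
Proof.
move=> cE mD mV a0.
have mI i : measurable_fun D (fun x => (\1_(V i) x : R)%:E).
  by apply/measurable_EFinP; exact: measurable_indic.
rewrite ge0_integral_esum//.
- by apply: eq_esum => i _; rewrite ge0_integralZl// integral_indic.
- by move=> i; exact: measurable_funeM.
- by move=> i x; rewrite mule_ge0.
Qed.

End esum_integral.

Lemma powR_inv (R : realType) (x p : R) : 0 < x -> x^-1 `^ p = (x `^ p)^-1.
Proof. by move=> x0; rewrite -[x^-1]powR_inv1 ?(ltW x0)// -powRrM mulN1r powRN. Qed.

Lemma powR_invB1 (R : realType) (x p : R) : 0 < x ->
  x^-1 `^ p * x `^ (p - 1) = x^-1.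
Proof.
move=> x0; rewrite powR_inv// powRB ?(gt_eqF x0) ?implybT// powRr1 ?(ltW x0)//.
by field; rewrite !gt_eqF// powR_gt0.
Qed.

Lemma rad_ratio_powR (R : realType) (j k : int) (Q r : R) :
  2 `^ (- ((j%:~R - k%:~R) * (Q * r))) =
  ((rad k `^ Q)^-1 `^ r) * (rad j `^ Q) `^ r.
Proof.
have rk0 : 0 < rad k `^ Q :> R by apply: powR_gt0; exact: rad_gt0.
rewrite (powR_inv _ rk0) -powRN (rad_powR k) (rad_powR j) -!powRrM.
rewrite -powRD; last by rewrite pnatr_eq0 implybT.
by congr (_ `^ _); ring.
Qed.

(** * Averages of step functions over coarser balls *)

Section step_functions.
Context {R : realType} {T : pmetricType R}.
Context (mu : {outer_measure set T -> \bar R}) (Q C : R).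
Hypotheses (Q0 : 0 < Q) (rmu : regular mu Q C).
Local Open Scope ereal_scope.

Let C0 : (0 < C)%R. Proof. by case: rmu => /(lt_le_trans ltr01). Qed.
Let br : borel_regular mu. Proof. by case: rmu. Qed.
Let ub x r : (0 < r)%R -> mu (ball x r) <= (C * r `^ Q)%:E.
Proof. by case: rmu => _ _ + _; apply. Qed.

(* The averages at scale [2^-k] of a step function at the finer scale [2^-j]:
   for [p >= 1] this is Jensen's inequality, for [p <= 1] the inclusion of
   [l^p] in [l^1], which costs the factor [2^((j - k) Q (1 - p))]. *)
Lemma step_bound (p A N D : R) (c : nat) :
  (0 < p)%R -> (1 <= A)%R -> (1 <= N)%R -> (0 < D)%R ->
  exists2 M : R, (0 < M)%R & forall (I J : choiceType) (E : set I) (F : set J)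
    (ce : I -> T) (W : I -> set T) (V : J -> set T) (a : J -> \bar R)
    (j k : int), countable F -> scattered E ce (rad k) D Q ->
    (forall i, measurable (W i : set (caratheodory_type mu))) ->
    (forall i, E i -> W i `<=` ball (ce i) (A * rad k)) ->
    (forall i, measurable (V i : set (caratheodory_type mu))) ->
    (forall i x y, F i -> V i x -> V i y -> mdist x y < A * rad j)%R ->
    (forall z, \esum_(i in F) (\1_(V i) z : R)%:E <= N%:E) ->
    (k - c%:Z <= j)%R -> (forall i, 0 <= a i) ->
    \esum_(e in E) (((rad k `^ Q)^-1)%:E * \int[cara mu]_(x in W e)
      \esum_(i in F) (a i * (\1_(V i) x : R)%:E)) `^ p <=
    (M * 2 `^ (- ((j%:~R - k%:~R) * (Q * Num.min p 1))))%:E *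
      \esum_(i in F) a i `^ p.
Proof.
move=> p0 A1 N1 D0.
have A0 : (0 < A)%R by exact: lt_le_trans A1.
have N0 : (0 < N)%R by exact: lt_le_trans N1.
have [B B0 BE] : exists2 B : R, (0 < B)%R & (C * A `^ Q = B)%R.
  by exists (C * A `^ Q)%R => //; rewrite mulr_gt0// powR_gt0.
have ArE l : (C * (A * rad l) `^ Q = B * rad l `^ Q)%R.
  by rewrite (powRM _ (ltW A0) (rad_ge0 l)) mulrA BE.
(* If [V i] meets [W e] then, as rad j <= 2^c rad k, the centre [ce e] is within [K * rad k] of
   every point of [V i]. So [V i] meets at most D K^Q of the sets [W e], which removes the sum over
   [e] at the end. *)
pose K := (A * (2 ^+ c + 1))%R.
have K1 : (1 <= K)%R.
  by rewrite mulr_ege1// lerDr exprn_ge0.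
have [M1 M10 M1E] : exists2 M1 : R, (0 < M1)%R &
    (M1 = if 1 <= p then 2 `^ p * (N * B) `^ (p - 1) * B else B `^ p)%R.
  exists (if 1 <= p then 2 `^ p * (N * B) `^ (p - 1) * B else B `^ p)%R => //.
  by case: ifP => _; rewrite ?mulr_gt0 ?powR_gt0// mulr_gt0.
exists (M1 * (D * K `^ Q))%R; first by rewrite !mulr_gt0// powR_gt0// (lt_le_trans _ K1).
move=> I J E F ce W V a j k cF sE mW WE mV dV oV kj a0.
pose G := (2 `^ (- ((j%:~R - k%:~R) * (Q * Num.min p 1))))%R : R.
have G0 : (0 < G)%R by rewrite powR_gt0.
pose chi i e : R := (`[< V i `&` W e !=set0 >]%:R)%R.
have chi0 i e : (0 <= chi i e)%R by rewrite /chi; case: asboolP.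
pose mm i e := (cara mu) (V i `&` W e).
have mm0 i e : 0 <= mm i e by exact: measure_ge0.
have mmB i e : F i -> mm i e <= (B * rad j `^ Q * chi i e)%:E.
  move=> Fi; rewrite /chi; case: asboolP => [[v [Vv Wv]]|]; last first.
    by move=> /set0P/negP/negPn/eqP e0; rewrite /mm e0 measure0 mulr0.
  rewrite mulr1 -ArE; apply: (@le_trans _ _ (mu (ball v (A * rad j)))).
    by apply: le_outer_measure => w [Vw _]; apply/ballP; exact: dV Fi Vv Vw.
  by apply: ub; rewrite mulr_gt0// rad_gt0.
have step1 e : E e -> (((rad k `^ Q)^-1)%:E * \esum_(i in F) (a i * mm i e)) `^ p <=
    (M1 * G)%:E * \esum_(i in F) (a i `^ p * (chi i e)%:E).
  move=> Ee.
  have S0 : 0 <= \esum_(i in F) (a i * mm i e).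
    by apply: esum_ge0 => i _; rewrite mule_ge0.
  have achi i : 0 <= a i `^ p * (chi i e)%:E.
    by rewrite mule_ge0 ?poweR_ge0// lee_fin.
  have rk0 : (0 < rad k `^ Q :> R)%R by rewrite powR_gt0// rad_gt0.
  rewrite poweRM// ?lee_fin ?invr_ge0 ?(ltW rk0)// poweR_EFin.
  have pk0 : (0 <= (rad k `^ Q)^-1 `^ p :> R)%R by exact: powR_ge0.
  have [p1|p1] := leP 1%R p.
    (* The sets [V i] overlap at most [N] times, so their traces on [W e] have total mass at most N
       times that of the ball containing [W e]. This is the mass in Jensen's inequality. *)
    have mmN : \esum_(i in F) mm i e <= (N * B * rad k `^ Q)%:E.
      have -> : \esum_(i in F) mm i e = \int[cara mu]_(x in W e)
          \esum_(i in F) (1 * (\1_(V i) x : R)%:E).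
        by rewrite integral_esum_indic//; apply: eq_esum => i _; rewrite mul1e.
      apply: (@le_trans _ _ (\int[cara mu]_(x in W e) N%:E)).
        apply: le_integral_ge0 => x _.
          by apply: esum_ge0 => i _; rewrite mul1e lee_fin.
        by under eq_esum do rewrite mul1e.
      rewrite integral_cst// -mulrA EFinM; apply: lee_wpmul2l.
        by rewrite lee_fin ltW.
      apply: (@le_trans _ _ (mu (ball (ce e) (A * rad k)))).
        by apply: le_outer_measure; exact: WE.
      by rewrite -ArE; apply: ub; rewrite mulr_gt0// rad_gt0.
    apply: (@le_trans _ _ ((((rad k `^ Q)^-1) `^ p)%:E *
        ((2 `^ p * (N * B * rad k `^ Q) `^ (p - 1))%:E *
        \esum_(i in F) (a i `^ p * mm i e)))).
      by apply: lee_wpmul2l => //; apply: esum_poweR_ge1 => //; apply: mulr_gt0 => //; apply: mulr_gt0.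
    apply: (@le_trans _ _ ((((rad k `^ Q)^-1) `^ p)%:E *
        ((2 `^ p * (N * B * rad k `^ Q) `^ (p - 1))%:E *
        ((B * rad j `^ Q)%:E * \esum_(i in F) (a i `^ p * (chi i e)%:E))))).
      apply: lee_wpmul2l => //; apply: lee_wpmul2l.
        by rewrite lee_fin mulr_ge0 ?powR_ge0.
      rewrite -esumZl//; last by apply: mulr_ge0 (ltW B0) (powR_ge0 _ _).
      apply: le_esum => i Fi; rewrite muleCA; apply: lee_wpmul2l; first exact: poweR_ge0.
      by rewrite -EFinM; exact: mmB.
    rewrite !muleA -!EFinM; apply: lee_wpmul2r; first exact: esum_ge0.
    rewrite lee_fin M1E p1 le_eqVlt; apply/orP; left; apply/eqP.
    have -> : G = ((rad k `^ Q)^-1 * rad j `^ Q)%R.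
      rewrite /G (min_r p1) rad_ratio_powR powRr1 ?powRr1 ?powR_ge0//.
      by rewrite invr_ge0 ltW.
    have NB0 : (0 <= N * B)%R by rewrite ltW// mulr_gt0.
    rewrite (powRM _ NB0 (ltW rk0)) -[in RHS](powR_invB1 p rk0).
    have ringE (a1 a2 a3 a4 a5 a6 : R) : (a1 * (a2 * (a3 * a4)) * (a5 * a6) =
      a2 * a3 * a5 * (a1 * a4 * a6))%R by ring.
    exact: ringE.
  have -> : M1 = (B `^ p)%R by rewrite M1E leNgt p1.
  apply: (@le_trans _ _ ((((rad k `^ Q)^-1) `^ p)%:E *
      ((B * rad j `^ Q) `^ p)%:E * \esum_(i in F) (a i `^ p * (chi i e)%:E))).
    rewrite -muleA; apply: lee_wpmul2l => //.
    apply: (le_trans (@esum_poweR_le1 _ _ _ _ _ p0 (ltW p1) _)).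
      by move=> i; rewrite mule_ge0.
    rewrite -esumZl ?powR_ge0//; apply: le_esum => i Fi.
    rewrite poweRM// muleCA; apply: lee_wpmul2l; first exact: poweR_ge0.
    apply: (@le_trans _ _ ((B * rad j `^ Q * chi i e)%:E `^ p)).
      apply: (gt0_ler_poweR (ltW p0)); rewrite ?in_itv/= ?leey ?andbT//.
        by rewrite lee_fin; apply: mulr_ge0 => //; apply: mulr_ge0 (ltW B0) (powR_ge0 _ _).
      exact: mmB.
    rewrite poweR_EFin (powRM _ (mulr_ge0 (ltW B0) (powR_ge0 _ _)) (chi0 i e)) EFinM.
    apply: lee_wpmul2l; first by rewrite lee_fin powR_ge0.
    rewrite /chi lee_fin; case: asboolP => _; first by rewrite powR1.
    by rewrite powR0// gt_eqF.
  rewrite -!EFinM; apply: lee_wpmul2r; first exact: esum_ge0.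
  rewrite lee_fin le_eqVlt; apply/orP; left; apply/eqP.
  have -> : G = ((rad k `^ Q)^-1 `^ p * (rad j `^ Q) `^ p)%R.
    by rewrite /G (min_l (ltW p1)) rad_ratio_powR.
  by rewrite (powRM _ (ltW B0) (powR_ge0 _ _)) mulrCA.
apply: (@le_trans _ _ (\esum_(e in E) ((M1 * G)%:E *
    \esum_(i in F) (a i `^ p * (chi i e)%:E)))).
  by apply: le_esum => e Ee; rewrite integral_esum_indic//; exact: step1.
have achi i e : 0 <= a i `^ p * (chi i e)%:E.
  by rewrite mule_ge0 ?poweR_ge0// lee_fin.
rewrite esumZl ?mulr_ge0 ?(ltW M10) ?(ltW G0)//; last first.
  by move=> e; apply: esum_ge0.
rewrite -/G mulrAC.
rewrite [in leRHS]EFinM -muleA; apply: lee_wpmul2l.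
  by rewrite lee_fin mulr_ge0 ?(ltW M10) ?(ltW G0).
rewrite esum_exchange// -esumZl ?mulr_ge0 ?powR_ge0 ?(ltW D0)//; last first.
  by move=> i; exact: poweR_ge0.
apply: le_esum => i Fi; apply: (le_trans (@esumZl_le _ _ _ _ _ _ _)).
- exact: poweR_ge0.
- by move=> e; rewrite lee_fin.
rewrite muleC; apply: lee_wpmul2r; first exact: poweR_ge0.
have [Vi0|/set0P[v Vv]] := eqVneq (V i) set0.
  rewrite esum1 ?lee_fin ?mulr_ge0 ?powR_ge0 ?(ltW D0)// => e _.
  by rewrite /chi Vi0 set0I; case: asboolP => // -[].
apply: le_trans (sE v K K1); apply: le_esum => e Ee.
rewrite /chi lee_fin; case: asboolP => [[w [Vw Ww]]|_]; last by rewrite indicE.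
rewrite indicE mem_set//; apply/ballP.
have /ballP ew := WE _ Ee _ Ww.
apply: le_lt_trans (metric_triangle v w _) _; rewrite (metric_sym w).
have jk : (rad j <= 2 ^+ c * rad k :> R)%R by rewrite -radB le_rad.
have -> : (K * rad k = A * (2 ^+ c * rad k) + A * rad k :> R)%R by rewrite /K; ring.
by rewrite ltrD// (lt_le_trans (dV _ _ _ Fi Vv Vw))// ler_wpM2l// ltW.
Qed.

End step_functions.

(** * Besov norms as sums over edges *)

Lemma overlap_poweR (R : realType) (p N : R) : 0 < p -> 0 < N ->
  exists2 M : R, 0 < M & forall (I : choiceType) (S : Type) (E : set I)
    (V : I -> set S) (a : I -> \bar R) (z : S), (forall i, 0 <= a i)%E ->
  (\esum_(i in E) (\1_(V i) z : R)%:E <= N%:E)%E ->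
  ((\esum_(i in E) (a i * (\1_(V i) z : R)%:E)) `^ p <=
   M%:E * \esum_(i in E) (a i `^ p * (\1_(V i) z : R)%:E))%E.
Proof.
move=> p0 N0; have [p1|p1] := leP 1%R p.
  exists (2 `^ p * N `^ (p - 1))%R; first by rewrite mulr_gt0 ?powR_gt0.
  by move=> I S E V a z a0 VN; apply: esum_poweR_ge1.
exists 1%R => // I S E V a z a0 VN; rewrite mul1e.
apply: (le_trans (@esum_poweR_le1 _ _ _ _ _ p0 (ltW p1) _)).
  by move=> i; rewrite mule_ge0.
apply: le_esum => e _; rewrite poweRM// poweR_EFin indicE.
by case: (_ \in _); rewrite ?powR1// powR0// gt_eqF.
Qed.

Section besov_levels.
Context {R : realType} {T : pmetricType R}.
Context (mu : {outer_measure set T -> \bar R}) (Q C : R).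
Hypotheses (Q0 : 0 < Q) (rmu : regular mu Q C).
Implicit Types (X : hyperbolic_filling T) (k : int) (a : vertex T * vertex T -> \bar R).
Local Open Scope ereal_scope.

Let C0 : (0 < C)%R. Proof. by case: rmu => /(lt_le_trans ltr01). Qed.
Let br : borel_regular mu. Proof. by case: rmu. Qed.
Let ub x r : (0 < r)%R -> mu (ball x r) <= (C * r `^ Q)%:E.
Proof. by case: rmu => _ _ + _; apply. Qed.

Definition edge_step X a k (z : T) : \bar R :=
  \esum_(e in edges_at X k) (a e * (\1_(eball e) z : R)%:E).

Lemma edge_step_ge0 X a k z : (forall e, 0 <= a e) -> 0 <= edge_step X a k z.
Proof. by move=> a0; apply: esum_ge0 => e _; rewrite mule_ge0. Qed.

Lemma measurable_eball (e : vertex T * vertex T) :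
  measurable (eball e : set (caratheodory_type mu)).
Proof.
by apply: measurableU; rewrite vballE; exact: measurable_ball.
Qed.

Lemma measurable_edge_step X a k (D : set (caratheodory_type mu)) :
  (forall e, 0 <= a e) -> measurable_fun D (edge_step X a k).
Proof.
move=> a0; apply: measurable_fun_esum.
- exact: edges_countable Q0 rmu X k.
- move=> e; apply: measurable_funeM; apply/measurable_EFinP.
  by apply: measurable_indic; exact: measurable_eball.
- by move=> e x; rewrite mule_ge0.
Qed.

Lemma edge_step_poweR (p : R) : (0 < p)%R -> exists2 M : R, (0 < M)%R &
  forall X a k z, (forall e, 0 <= a e) ->
  edge_step X a k z `^ p <= M%:E * edge_step X (fun e => a e `^ p) k z.
Proof.
move=> p0; have [N N0 HN] := edges_overlap Q0 rmu.
have [M M0 HM] := overlap_poweR p0 N0; exists M => // X a k z a0.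
by apply: (HM _ _ _ (fun e => eball e)).
Qed.

Lemma level_le (p : R) : (0 < p)%R -> exists2 M : R, (0 < M)%R &
  forall X a k, (forall e, 0 <= a e) ->
  \int[cara mu]_z (edge_step X a k z `^ p) <=
  (M * rad k `^ Q)%:E * \esum_(e in edges_at X k) a e `^ p.
Proof.
move=> p0; have [N N0 HN] := edge_step_poweR p0.
exists (N * (C * 3 `^ Q))%R; first by rewrite !mulr_gt0 ?powR_gt0.
move=> X a k a0.
have ap0 e : 0 <= a e `^ p by exact: poweR_ge0.
apply: (@le_trans _ _ (\int[cara mu]_z
    (N%:E * edge_step X (fun e => a e `^ p) k z))).
  by apply: le_integral_ge0 => z _; [exact: poweR_ge0|exact: HN].
rewrite ge0_integralZl//; last 3 first.
- exact: measurable_edge_step.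
- by move=> z _; exact: edge_step_ge0.
- by rewrite lee_fin ltW.
rewrite integral_esum_indic//; [|exact: edges_countable Q0 rmu X k|exact: measurable_eball].
rewrite -mulrA EFinM -muleA; apply: lee_wpmul2l; first by rewrite lee_fin ltW.
rewrite -esumZl//; last by rewrite !mulr_ge0 ?powR_ge0 ?(ltW C0).
apply: le_esum => e Ee; rewrite muleC setIT; apply: lee_wpmul2r => //.
apply: (@le_trans _ _ (mu (ball e.1.2 (3 * rad k)))).
  by apply: le_outer_measure; exact: eball_sub Ee.
apply: le_trans (ub _ _) _; first by rewrite mulr_gt0// rad_gt0.
by rewrite (powRM _ _ (rad_ge0 k))// mulrA lexx.
Qed.

(** On [eball e] the step function is at least [a e], and at most [N] of these sets meet at a point.
    The lower bound on the measure of [eball e] is available only below the diameter; beyond it, [a]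
    has to vanish. *)
Lemma level_ge (p : R) : (0 < p)%R -> exists2 M : R, (0 < M)%R &
  forall X a k, (forall e, 0 <= a e) ->
  (forall e, edges_at X k e -> a e != 0 -> exists y z : T, (rad k / 16 < mdist y z)%R) ->
  ((rad k `^ Q)%:E * (\esum_(e in edges_at X k) a e `^ p) <=
  M%:E * \int[cara mu]_z (edge_step X a k z `^ p))%E.
Proof.
move=> p0; have [N N0 HN] := edges_overlap Q0 rmu.
exists (C * N)%R; first by rewrite mulr_gt0.
move=> X a k a0 ad.
have ap0 e : 0 <= a e `^ p by exact: poweR_ge0.
apply: (@le_trans _ _ (C%:E * \esum_(e in edges_at X k)
    (a e `^ p * (cara mu) (eball e `&` setT)))).
  rewrite -!esumZl ?powR_ge0 ?(ltW C0)//; last first.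
    by move=> e; rewrite mule_ge0.
  apply: le_esum => e Ee; rewrite setIT.
  have [->|ae0] := eqVneq (a e) 0; first by rewrite poweR0r ?gt_eqF// mul0e !mule0.
  rewrite muleCA muleC; apply: lee_wpmul2l => //.
  rewrite muleC -lee_pdivrMr// muleC -EFinM.
  apply: (@le_trans _ _ (mu (ball e.1.2 (rad k)))).
    case: rmu => _ _ _; apply; first exact: rad_gt0.
    exact: ad Ee ae0.
  by apply: le_outer_measure; exact: vball1_sub Ee.
rewrite EFinM -muleA; apply: lee_wpmul2l; first by rewrite lee_fin ltW.
rewrite -integral_esum_indic//; [|exact: edges_countable Q0 rmu X k|exact: measurable_eball].
have mG : measurable_fun setT
    (fun z : caratheodory_type mu => edge_step X a k z `^ p).
  exact: (measurableT_comp (measurable_poweR _) (measurable_edge_step _ _ a0)).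
rewrite -ge0_integralZl ?lee_fin ?(ltW N0)//; last by move=> z _; exact: poweR_ge0.
apply: le_integral_ge0 => z _; first by apply: esum_ge0 => e _; rewrite mule_ge0.
rewrite muleC; apply: (@le_trans _ _ (\esum_(e in edges_at X k)
   (edge_step X a k z `^ p * (\1_(eball e) z : R)%:E))).
  apply: le_esum => e Ee; rewrite indicE.
  have [ez|] := boolP (z \in eball e); last by rewrite !mule0.
  rewrite !mule1; apply: (gt0_ler_poweR (ltW p0)); rewrite ?in_itv/= ?leey ?andbT//.
    exact: edge_step_ge0.
  have := @esum_ge_term _ _ (edges_at X k) (fun e => a e * (\1_(eball e) z : R)%:E) e Ee.
  by rewrite indicE ez mule1.
apply: (le_trans (@esumZl_le _ _ _ _ _ _ _)) => //; first exact: poweR_ge0.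
by apply: lee_wpmul2l; [exact: poweR_ge0|exact: HN].
Qed.

Definition grad (f : T -> R[i]) (e : vertex T * vertex T) : \bar R :=
  (Normc.normc (du (ball_mean mu f) e))%:E.

Lemma normc_ge0 (x : R[i]) : (0 <= Normc.normc x)%R.
Proof. by case: x => a b; exact: sqrtr_ge0. Qed.

Lemma grad_ge0 f e : 0 <= grad f e.
Proof. by rewrite lee_fin normc_ge0. Qed.

(** If all distances are at most [rad k / 16], both balls are the whole space. So an edge with two
    different balls certifies that the lower bound on measures holds at its scale. *)
Lemma vball_neq X k e : edges_at X k e ->
  vball e.1 <> vball e.2 -> exists y z : T, (rad k / 16 < mdist y z)%R.
Proof.
move=> /edges_atP[e1 _ _ e2 _] ne; apply: contrapT => small; apply: ne.
have sm (y z : T) : (mdist y z <= rad k / 16)%R.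
  by rewrite leNgt; apply/negP => yz; apply: small; exists y, z.
have full (v : vertex T) : v.1 = k \/ v.1 = (k + 1)%R -> vball v = setT.
  move=> vk; apply/seteqP; split => // z _; rewrite vballE; apply/ballP.
  apply: le_lt_trans (sm _ _) _.
  have := @rad_gt0 R k; case: vk => ->; rewrite ?rad_half; move: (rad k) => r; lra.
by rewrite !full//; left.
Qed.

Lemma grad_neq0 X k f e : edges_at X k e -> grad f e != 0 ->
  exists y z : T, (rad k / 16 < mdist y z)%R.
Proof.
move=> Ee g0; apply: (vball_neq Ee) => ee.
by move/eqP: g0; apply; rewrite /grad /du /ball_mean ee subrr Normc.normc0.
Qed.

(* [sg] stands for [s p - Q], which is the same number for the two spaces of
   the trace theorem. *)
Definition alpha (sg p : R) X a k : \bar R :=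
  (2 `^ (k%:~R * sg))%:E * \esum_(e in edges_at X k) a e `^ p.

Lemma alpha_ge0 sg p X a k : 0 <= alpha sg p X a k.
Proof. by rewrite mule_ge0 ?lee_fin ?powR_ge0// esum_ge0// => *; exact: poweR_ge0. Qed.

Definition besov_term X (s : R) (p : R) f k : \bar R :=
  (2 `^ (k%:~R * s))%:E * besov_level mu X p%:E f k.

Lemma besov_level_ge0 X (p : \bar R) f k : 0 <= besov_level mu X p f k.
Proof. exact: Lnorm_ge0. Qed.

Lemma besov_term_ge0 X s p f k : 0 <= besov_term X s p f k.
Proof. by rewrite mule_ge0 ?lee_fin ?powR_ge0// besov_level_ge0. Qed.

Lemma besov_normE X s p q f : 0 < q ->
  besov_norm mu X s p%:E q f = lq q (besov_term X s p f).
Proof.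
case: q => [r|_|//]; last by [].
rewrite lte_fin => r0; rewrite /besov_norm /lq; congr (_ `^ _).
apply: eq_esum => k _; rewrite /besov_term poweRM ?besov_level_ge0 ?lee_fin ?powR_ge0//.
by rewrite poweR_EFin -powRrM.
Qed.

Lemma besov_levelE X p f k : (0 < p)%R ->
  besov_level mu X p%:E f k `^ p =
  \int[cara mu]_z (edge_step X (grad f) k z `^ p).
Proof.
move=> p0; rewrite /besov_level unlock -poweRrM mulVf ?gt_eqF// poweRe1; last first.
  by apply: integral_ge0 => z _; exact: poweR_ge0.
apply: eq_integral => z _; congr (_ `^ _).
rewrite gee0_abs; last by apply: esum_ge0 => e _; rewrite lee_fin mulr_ge0// normc_ge0.
by apply: eq_esum => e _; rewrite EFinM.
Qed.

(** Origin of s p - Q: a ball of level k has measure about 2^(- k Q), against the weight 2^(k s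
    p). *)
Lemma rad_scale (k : int) (s p : R) :
  ((2 `^ (k%:~R * s)) `^ p * rad k `^ Q = 2 `^ (k%:~R * (s * p - Q)))%R.
Proof.
rewrite (rad_powR k) -powRrM -powRD; last by rewrite pnatr_eq0 implybT.
by congr (powR _ _); ring.
Qed.

Lemma besov_term_le (p : R) : (0 < p)%R -> exists2 M : R, (0 < M)%R &
  forall X s f k, besov_term X s p f k `^ p <=
    M%:E * alpha (s * p - Q) p X (grad f) k.
Proof.
move=> p0; have [M M0 HM] := level_le p0; exists M => // X s f k.
rewrite /besov_term poweRM ?besov_level_ge0 ?lee_fin ?powR_ge0// besov_levelE//.
rewrite poweR_EFin; apply: le_trans.
  by apply: lee_wpmul2l; [rewrite lee_fin powR_ge0|exact: HM (grad_ge0 f)].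
by rewrite /alpha -rad_scale !muleA -!EFinM mulrCA mulrA lexx.
Qed.

Lemma besov_term_ge (p : R) : (0 < p)%R -> exists2 M : R, (0 < M)%R &
  forall X s f k, alpha (s * p - Q) p X (grad f) k <=
    M%:E * besov_term X s p f k `^ p.
Proof.
move=> p0; have [M M0 HM] := level_ge p0; exists M => // X s f k.
rewrite /besov_term poweRM ?besov_level_ge0 ?lee_fin ?powR_ge0// besov_levelE//.
rewrite poweR_EFin muleCA /alpha -rad_scale EFinM -muleA.
apply: lee_wpmul2l; first by rewrite lee_fin powR_ge0.
by apply: HM; [exact: grad_ge0|move=> e; exact: grad_neq0].
Qed.

(** A bound without reference to [q]. It is all that is needed for the limits defining the operators
    to exist and to be locally integrable. *)
Lemma besov_alpha_bounded (p : R) q X s f : (0 < p)%R -> 0 < q ->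
  besov_norm mu X s p%:E q f < +oo ->
  exists2 S : R, (0 <= S)%R & forall k, alpha (s * p - Q) p X (grad f) k <= S%:E.
Proof.
move=> p0 q0; rewrite besov_normE// => nf.
have [M M0 HM] := besov_term_ge p0.
have l0 : 0 <= lq q (besov_term X s p f).
  by apply: le_trans (lq_ge q0 0 _) => *; exact: besov_term_ge0.
have /fineK lE : lq q (besov_term X s p f) \is a fin_num by rewrite ge0_fin_numE.
exists (M * fine (lq q (besov_term X s p f)) `^ p)%R.
  by rewrite mulr_ge0 ?powR_ge0// ltW.
move=> k; apply: le_trans (HM X s f k) _.
rewrite EFinM -poweR_EFin lE; apply: lee_wpmul2l; first by rewrite lee_fin ltW.
apply: (gt0_ler_poweR (ltW p0)); rewrite ?in_itv/= ?leey ?andbT ?besov_term_ge0//.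
by apply: lq_ge => // *; exact: besov_term_ge0.
Qed.

End besov_levels.

Section besov_comparison.
Context {R : realType} {T1 T2 : pmetricType R}.
Context (mu1 : {outer_measure set T1 -> \bar R}) (Q1 C1 : R).
Context (mu2 : {outer_measure set T2 -> \bar R}) (Q2 C2 : R).
Local Open Scope ereal_scope.

Lemma besov_norm_dom (X1 : hyperbolic_filling T1) (X2 : hyperbolic_filling T2)
    (s1 s2 p : R) q (D d : R) :
  (0 < Q1)%R -> regular mu1 Q1 C1 -> (0 < Q2)%R -> regular mu2 Q2 C2 ->
  (0 < p)%R -> 0 < q -> (0 < D)%R -> (0 < d)%R -> (s1 * p - Q1 = s2 * p - Q2)%R ->
  exists2 K : R, (0 <= K)%R & forall f1 f2,
    dom D d (alpha (s2 * p - Q2) p X2 (grad mu2 f2))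
            (alpha (s1 * p - Q1) p X1 (grad mu1 f1)) ->
    besov_norm mu2 X2 s2 p%:E q f2 <= K%:E * besov_norm mu1 X1 s1 p%:E q f1.
Proof.
move=> Q10 r1 Q20 r2 p0 q0 D0 d0 ss.
have [M1 M10 H1] := besov_term_ge Q10 r1 p0.
have [M2 M20 H2] := besov_term_le Q20 r2 p0.
have D'0 : (0 < M2 * (D * M1))%R by rewrite !mulr_gt0.
have [K K0 HK] := lq_dom D'0 d0 p0 q0.
exists K => // f1 f2 ff; rewrite !besov_normE//.
apply: HK => [k|k|k]; try exact: besov_term_ge0.
apply: le_trans (H2 X2 s2 f2 k) _.
rewrite EFinM -muleA; apply: lee_wpmul2l; first by rewrite lee_fin ltW.
apply: le_trans (ff k) _; rewrite EFinM -muleA.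
apply: lee_wpmul2l; first by rewrite lee_fin ltW.
rewrite -esumZl ?(ltW M10)//; last first.
  by move=> j; rewrite mule_ge0 ?poweR_ge0// lee_fin wt_ge0.
apply: le_esum => j _; rewrite [leRHS]muleCA; apply: lee_wpmul2l; last exact: H1.
by rewrite lee_fin wt_ge0.
Qed.

End besov_comparison.

(** * Limits along vertices and their oscillation *)

Section level_sums.
Context {R : realType}.
Local Open Scope ereal_scope.

(** The weight [wt (- t)] grows: an arbitrarily small exponential loss pays for taking the power
    termwise. The weight [wt (t / p)] and its inverse are inserted before [wt_esum_poweR]. *)
Lemma esum_poweR_wt (p t : R) : (0 < p)%R -> (0 < t)%R ->
  exists2 M : R, (0 < M)%R & forall i (b : int -> \bar R), (forall j, 0 <= b j) ->
  (\esum_(j in [set: int]) b j) `^ p <=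
  M%:E * \esum_(j in [set: int]) ((wt (- t) j i)%:E * b j `^ p).
Proof.
move=> p0 t0; have d0 : (0 < t / p)%R by rewrite divr_gt0.
have [M M0 HM] := wt_esum_poweR d0 p0; exists M => // i b b0.
pose b' j := ((wt (t / p) j i)^-1)%:E * b j.
have b'0 j : 0 <= b' j by rewrite mule_ge0// lee_fin invr_ge0 wt_ge0.
have -> : \esum_(j in [set: int]) b j =
    \esum_(j in [set: int]) ((wt (t / p) j i)%:E * b' j).
  apply: eq_esum => j _; rewrite /b' muleA -EFinM mulfV ?mul1e//.
  by rewrite gt_eqF// wt_gt0.
apply: le_trans (HM i b' b'0) _; apply: lee_wpmul2l; first by rewrite lee_fin ltW.
apply: le_esum => j _; rewrite /b' poweRM//; last by rewrite lee_fin invr_ge0 wt_ge0.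
rewrite poweR_EFin muleA -EFinM; apply: lee_wpmul2r; first exact: poweR_ge0.
rewrite lee_fin (powR_inv _ (wt_gt0 _ _ _)) -powRN.
have -> : (wt (t / p) j i `^ (- p) = wt (- t) j i :> R)%R.
  by rewrite /wt -powRrM; congr (powR _ _); field; rewrite gt_eqF.
rewrite ler_piMl ?wt_ge0// /wt -[leRHS](powRr0 2) ler_powR ?ler1n//.
rewrite mulNr oppr_le0; apply: mulr_ge0 => //; apply: mulr_ge0; first exact: ltW.
by rewrite le_min ler01 (ltW p0).
Qed.

(** The decay 2 t of the contribution of level j pays for the loss t in [esum_poweR_wt], and a decay
    t remains. *)
Lemma esum_levels (p t sg M1 : R) : (0 < p)%R -> (0 < t)%R -> (0 < M1)%R ->
  exists2 M : R, (0 < M)%R & forall (k : int) (I : choiceType) (E : set I)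
    (tt : int -> I -> \bar R) (S : int -> \bar R),
    (forall j e, 0 <= tt j e) -> (forall j, 0 <= S j) ->
    (forall j, \esum_(e in E) tt j e `^ p <=
      (M1 * wt (2 * t) j k * 2 `^ (j%:~R * sg) * 2 `^ (- (k%:~R * sg)))%:E * S j) ->
    (2 `^ (k%:~R * sg))%:E * (\esum_(e in E) (\esum_(j in [set: int]) tt j e) `^ p) <=
    M%:E * \esum_(j in [set: int]) ((wt t j k)%:E * ((2 `^ (j%:~R * sg))%:E * S j)).
Proof.
move=> p0 t0 M10; have [M2 M20 HM2] := esum_poweR_wt p0 t0.
exists (M2 * M1)%R; first by rewrite mulr_gt0.
move=> k I E tt S tt0 S0 ttE.
have ttp0 j y : 0 <= tt j y `^ p by exact: poweR_ge0.
apply: (@le_trans _ _ ((2 `^ (k%:~R * sg))%:E * (M2%:E * \esum_(j in [set: int])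
    ((wt (- t) j k)%:E * \esum_(e in E) tt j e `^ p)))).
  apply: lee_wpmul2l; first by rewrite lee_fin powR_ge0.
  apply: (@le_trans _ _ (\esum_(e in E) (M2%:E * \esum_(j in [set: int])
    ((wt (- t) j k)%:E * tt j e `^ p)))).
    by apply: le_esum => e _; exact: HM2.
  have wtt0 j e : 0 <= (wt (- t) j k)%:E * tt j e `^ p.
    by rewrite mule_ge0// lee_fin wt_ge0.
  rewrite esumZl ?(ltW M20)//; last by move=> e; exact: esum_ge0.
  apply: lee_wpmul2l; first by rewrite lee_fin ltW.
  rewrite esum_exchange//; apply: le_esum => j _.
  by rewrite esumZl ?wt_ge0.
have al0 j : 0 <= (2 `^ (j%:~R * sg))%:E * S j by rewrite mule_ge0// lee_fin powR_ge0.
rewrite muleCA [in leRHS]EFinM -[in leRHS]muleA; apply: lee_wpmul2l; first by rewrite lee_fin ltW.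
have E0 j : 0 <= \esum_(e in E) tt j e `^ p by exact: esum_ge0.
rewrite -!esumZl ?powR_ge0 ?(ltW M10)//; last 2 first.
- by move=> j; rewrite mule_ge0// lee_fin wt_ge0.
- by move=> j; rewrite mule_ge0// lee_fin wt_ge0.
apply: le_esum => j _.
apply: (@le_trans _ _ ((2 `^ (k%:~R * sg))%:E * ((wt (- t) j k)%:E * ((M1 *
    wt (2 * t) j k * 2 `^ (j%:~R * sg) * 2 `^ (- (k%:~R * sg)))%:E * S j)))).
  apply: lee_wpmul2l; first by rewrite lee_fin powR_ge0.
  by apply: lee_wpmul2l; [rewrite lee_fin wt_ge0|exact: ttE].
rewrite !muleA -!EFinM.
have -> : wt t j k = (wt (- t) j k * wt (2 * t) j k)%R.
  have tE2 : (- t + 2 * t = t)%R by ring.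
  by rewrite wtD tE2.
suff -> : (2 `^ (k%:~R * sg) * wt (- t) j k * (M1 * wt (2 * t) j k *
    2 `^ (j%:~R * sg) * 2 `^ (- (k%:~R * sg))) = M1 *
    (wt (- t) j k * wt (2 * t) j k) * 2 `^ (j%:~R * sg))%R by rewrite lexx.
have ringE (x1 x2 x4 y1 y2 m : R) : (x1 * x2 = 1 ->
    x1 * y1 * (m * y2 * x4 * x2) = m * (y1 * y2) * x4)%R.
  move=> x12; rewrite [LHS](_ : _ = x1 * x2 * (m * (y1 * y2) * x4))%R; last by ring.
  by rewrite x12 mul1r.
by apply: ringE; rewrite powRN mulfV// gt_eqF// powR_gt0.
Qed.

Context {T : pmetricType R} (mu : {outer_measure set T -> \bar R}) (Q C : R).
Hypotheses (Q0 : (0 < Q)%R) (rmu : regular mu Q C).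

(** [step_bound] treats each level j and [esum_levels] adds the levels. Relative to the weights 2^(j
    sg), level j enters level k with the factor 2^(- (j - k) (Q min(p, 1) + sg)); this is the decay
    2 t. *)
Lemma step_tail_dom (p sg A N D : R) (c : nat) :
  (0 < p)%R -> (0 < Q * Num.min p 1 + sg)%R -> (1 <= A)%R -> (1 <= N)%R -> (0 < D)%R ->
  exists M t : R, [/\ (0 < M)%R, (0 < t)%R &
    forall (k : int) (I J : choiceType) (E : set I) (ce : I -> T) (W : I -> set T)
      (F : int -> set J) (V : int -> J -> set T) (a : int -> J -> \bar R),
    scattered E ce (rad k) D Q ->
    (forall i, measurable (W i : set (caratheodory_type mu))) ->
    (forall i, E i -> W i `<=` ball (ce i) (A * rad k)) ->
    (forall j, countable (F j)) ->
    (forall j i, measurable (V j i : set (caratheodory_type mu))) ->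
    (forall j i x y, F j i -> V j i x -> V j i y -> mdist x y < A * rad j)%R ->
    (forall j z, \esum_(i in F j) (\1_(V j i) z : R)%:E <= N%:E) ->
    (forall j i, 0 <= a j i) ->
    (2 `^ (k%:~R * sg))%:E * (\esum_(e in E) (((rad k `^ Q)^-1)%:E *
      \int[cara mu]_(x in W e) \esum_(j in [set j : int | (k - c%:Z <= j)%R])
        \esum_(i in F j) (a j i * (\1_(V j i) x : R)%:E)) `^ p) <=
    M%:E * \esum_(j in [set: int]) ((wt t j k)%:E *
      ((2 `^ (j%:~R * sg))%:E * \esum_(i in F j) a j i `^ p))].
Proof.
move=> p0 ls0 A1 N1 D0; have [t t0 tdef] : exists2 t : R, (0 < t)%R & (2 * t = Q * Num.min p 1 + sg)%R.
  exists ((Q * Num.min p 1 + sg) / 2)%R; first by rewrite divr_gt0.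
  by rewrite mulrC divfK.
(* As j >= k - c, the distance |j - k| exceeds j - k by at most 2 c, which costs the factor 2^(4 t
   c). *)
have num (x i j : R) : (0 <= x -> i - x <= j -> - ((j - i) * (Q * Num.min p 1)) <=
    4 * (t * x) + (- (2 * t) * `|j - i| + (j * sg + - (i * sg))))%R.
  move=> x0 ij; have : (`|j - i| - (j - i) <= 2 * x)%R.
    have [d0|d0] := ger0P (j - i)%R; lra.
  move=> /(ler_wpM2l (ltW t0)).
  have : ((j - i) * (Q * Num.min p 1) + (j - i) * sg = 2 * (t * (j - i)))%R.
    by rewrite -mulrDr -tdef; ring.
  move: `|_|%R (Q * _)%R => d m; lra.
have [M1 M10 HM1] := step_bound rmu c p0 A1 N1 D0.
have M1c0 : (0 < M1 * 2 `^ (4 * t * c%:R))%R by rewrite mulr_gt0// powR_gt0.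
have [M M0 HM] := esum_levels sg p0 t0 M1c0.
exists M, t; split => // k I J E ce W F V a sE mW WE cF mV V2 VN a0.
pose G j (x : T) := \esum_(i in F j) (a j i * (\1_(V j i) x : R)%:E).
have G0 j x : 0 <= G j x by apply: esum_ge0 => i _; rewrite mule_ge0.
have mG j (B : set (caratheodory_type mu)) : measurable_fun B (G j : caratheodory_type mu -> \bar R).
  apply: measurable_fun_esum => // [i|i x]; last by rewrite mule_ge0.
  by apply: measurable_funeM; apply/measurable_EFinP; exact: measurable_indic.
pose tt (j : int) (e : I) := if (k - c%:Z <= j)%R then ((rad k `^ Q)^-1)%:E *
  \int[cara mu]_(x in W e) G j x else 0.
have tt0 j e : 0 <= tt j e.
  rewrite /tt; case: ifP => // _; rewrite mule_ge0 ?lee_fin ?invr_ge0 ?powR_ge0//.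
  by apply: integral_ge0 => w _; exact: G0.
have tE (e : I) : (((rad k `^ Q)^-1)%:E * \int[cara mu]_(x in W e)
    (\esum_(j in [set j : int | (k - c%:Z <= j)%R]) G j x) = \esum_(j in [set: int]) tt j e)%E.
  rewrite ge0_integral_esum//; last exact: countableP.
  rewrite -esumZl ?invr_ge0 ?powR_ge0//; last first.
    by move=> j; apply: integral_ge0 => w _; exact: G0.
  rewrite esum_mkcond; apply: eq_esum => j _; rewrite /tt.
  have -> // : (j \in [set j0 : int | (k - c%:Z <= j0)%R]) = (k - c%:Z <= j)%R.
  by apply/idP/idP; rewrite inE.
have -> : \esum_(e in E) (((rad k `^ Q)^-1)%:E * \int[cara mu]_(x in W e)
    \esum_(j in [set j : int | (k - c%:Z <= j)%R]) G j x) `^ p =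
    \esum_(e in E) (\esum_(j in [set: int]) tt j e) `^ p.
  by apply: eq_esum => e _; rewrite tE.
have A0 j : 0 <= \esum_(i in F j) a j i `^ p by apply: esum_ge0 => e _; exact: poweR_ge0.
apply: HM => // j.
have [kj|kj] := boolP (k - c%:Z <= j)%R; last first.
  rewrite esum1 => [|e _]; last by rewrite /tt (negbTE kj) poweR0r// gt_eqF.
  by rewrite mule_ge0// lee_fin !mulr_ge0 ?powR_ge0 ?wt_ge0// ltW.
have -> : \esum_(e in E) tt j e `^ p = \esum_(e in E) (((rad k `^ Q)^-1)%:E *
    \int[cara mu]_(x in W e) \esum_(i in F j) (a j i * (\1_(V j i) x : R)%:E)) `^ p.
  by apply: eq_esum => e _; rewrite /tt kj.
have := HM1 I J E (F j) ce W (V j) (a j) j k (cF j) sE mW WE (mV j) (V2 j) (VN j) kj (a0 j).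
move=> /le_trans; apply.
apply: lee_wpmul2r => //; rewrite lee_fin -!mulrA ler_wpM2l ?(ltW M10)//.
rewrite /wt -!powRD ?pnatr_eq0 ?implybT// ler_powR ?ler1n//.
have {}kj : (k%:~R - c%:R <= j%:~R :> R)%R by rewrite -(ler_int R) intrB in kj.
exact: num.
Qed.

End level_sums.

(** * Tails of edge sums along an isometric map *)

Section tails.
Context {R : realType} {T T' : pmetricType R}.
Context (mu : {outer_measure set T -> \bar R}) (Q C : R).
Context (nu : {outer_measure set T' -> \bar R}) (lam C' : R).
Context (io : T' -> T).
Hypotheses (Q0 : 0 < Q) (rmu : regular mu Q C).
Hypotheses (lam0 : 0 < lam) (rnu : regular nu lam C').
Hypothesis io_isom : forall x y, mdist (io x) (io y) = mdist x y.
Implicit Types (X : hyperbolic_filling T) (a : vertex T * vertex T -> \bar R).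
Local Open Scope ereal_scope.

Let brnu : borel_regular nu. Proof. by case: rnu. Qed.

Definition tail_step X a (m : int) (w : T') : \bar R :=
  \esum_(j in [set j : int | (m <= j)%R]) edge_step X a j (io w).

Lemma tail_step_ge0 X a m w : (forall e, 0 <= a e) -> 0 <= tail_step X a m w.
Proof. by move=> a0; apply: esum_ge0 => j _; exact: edge_step_ge0. Qed.

Lemma measurable_preimage_eball (e : vertex T * vertex T) :
  measurable (io @^-1` eball e : set (caratheodory_type nu)).
Proof.
rewrite /eball preimage_setU !vballE.
by apply: measurableU; apply: measurable_open => //; exact: open_preimage_ball.
Qed.

Lemma preimage_indic (A : set T) (w : T') :
  (\1_(io @^-1` A) w : R) = \1_A (io w).
Proof.
by rewrite !indicE; congr (_%:R); congr nat_of_bool; apply/idP/idP; rewrite !inE.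
Qed.

Lemma edge_step_preimage X a j w : edge_step X a j (io w) =
  \esum_(e in edges_at X j) (a e * (\1_(io @^-1` eball e) w : R)%:E).
Proof. by apply: eq_esum => e _; rewrite preimage_indic. Qed.

Lemma measurable_edge_step_comp X a j (D : set (caratheodory_type nu)) :
  (forall e, 0 <= a e) ->
  measurable_fun D (fun w : caratheodory_type nu => edge_step X a j (io w)).
Proof.
move=> a0; under eq_fun do rewrite edge_step_preimage.
apply: measurable_fun_esum.
- exact: edges_countable Q0 rmu X j.
- move=> e; apply: measurable_funeM; apply/measurable_EFinP.
  by apply: measurable_indic; exact: measurable_preimage_eball.
- by move=> e x; rewrite mule_ge0.
Qed.

Lemma measurable_tail_step X a m (D : set (caratheodory_type nu)) :
  (forall e, 0 <= a e) ->
  measurable_fun D (tail_step X a m : caratheodory_type nu -> \bar R).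
Proof.
move=> a0; apply: measurable_fun_esum.
- exact: countableP.
- by move=> j; exact: measurable_edge_step_comp.
- by move=> j x; exact: edge_step_ge0.
Qed.

Definition tail_mean X a (K : R) (c : nat) (i : int) (y : T') : \bar R :=
  ((rad i `^ lam)^-1)%:E *
  \int[cara nu]_(w in ball y (K * rad i)) tail_step X a (i - c%:Z) w.

Lemma tail_mean_ge0 X a K c i y : (forall e, 0 <= a e) ->
  0 <= tail_mean X a K c i y.
Proof.
move=> a0; rewrite mule_ge0 ?lee_fin ?invr_ge0 ?powR_ge0//.
by apply: integral_ge0 => w _; exact: tail_step_ge0.
Qed.

Lemma tail_mean_dom (p sg K D : R) (c : nat) :
  (0 < p)%R -> (0 < lam * Num.min p 1 + sg)%R -> (1 <= K)%R -> (0 < D)%R ->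
  exists M t : R, [/\ (0 < M)%R, (0 < t)%R &
    forall X a i (I : choiceType) (E : set I) (ce : I -> T'),
      (forall e, 0 <= a e) -> scattered E ce (rad i) D lam ->
      (2 `^ (i%:~R * sg))%:E * (\esum_(e in E) tail_mean X a K c i (ce e) `^ p)
      <= M%:E * \esum_(j in [set: int]) ((wt t j i)%:E * alpha sg p X a j)].
Proof.
move=> p0 ls0 K1 D0; have [N' N'0 HN'] := edges_overlap Q0 rmu.
pose N := (N' + 1)%R; have N1 : (1 <= N)%R by rewrite lerDr ltW.
(* Two points in the preimage of an edge ball of level j are at distance less than [6 * rad j], and
   the balls of integration have radius [K * rad i]; [A] covers both. *)
pose A := (K + 6)%R; have A1 : (1 <= A)%R by rewrite /A; lra.
have [M [t [M0 t0 HM]]] := step_tail_dom rnu c p0 ls0 A1 N1 D0.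
exists M, t; split => // X a i I E ce a0 sE.
have tE y : tail_mean X a K c i y = ((rad i `^ lam)^-1)%:E *
    \int[cara nu]_(w in ball y (K * rad i)) \esum_(j in [set j : int | (i - c%:Z <= j)%R])
      \esum_(e in edges_at X j) (a e * (\1_(io @^-1` eball e) w : R)%:E).
  have tsE w : tail_step X a (i - c%:Z) w = \esum_(j in [set j : int | (i - c%:Z <= j)%R])
      \esum_(e in edges_at X j) (a e * (\1_(io @^-1` eball e) w : R)%:E).
    by rewrite /tail_step; apply: eq_esum => j _; rewrite edge_step_preimage.
  by rewrite /tail_mean; under eq_integral do rewrite tsE.
have -> : \esum_(e in E) tail_mean X a K c i (ce e) `^ p = \esum_(e in E)
    (((rad i `^ lam)^-1)%:E * \int[cara nu]_(w in ball (ce e) (K * rad i))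
      \esum_(j in [set j : int | (i - c%:Z <= j)%R])
      \esum_(e in edges_at X j) (a e * (\1_(io @^-1` eball e) w : R)%:E)) `^ p.
  by apply: eq_esum => e _; rewrite tE.
apply: (HM i I _ E ce (fun e => ball (ce e) (K * rad i)) (fun j => edges_at X j)
  (fun _ e => io @^-1` eball e) (fun _ => a)) => //.
- by move=> e; exact: measurable_ball.
- by move=> e Ee; apply: le_ball; rewrite ler_wpM2r ?rad_ge0// /A; lra.
- by move=> j; exact: edges_countable Q0 rmu X j.
- by move=> _ e; exact: measurable_preimage_eball.
- move=> j e x y Ee /(eball_sub Ee)/ballP ex /(eball_sub Ee)/ballP ey.
  rewrite -io_isom; apply: le_lt_trans (metric_triangle _ e.1.2 _) _.
  rewrite (metric_sym _ e.1.2).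
  have r0 := @rad_gt0 R j; have : (0 < K * rad j)%R by rewrite mulr_gt0//; lra.
  by rewrite /A mulrDl; lra.
- move=> j z; under eq_esum do rewrite preimage_indic.
  by apply: le_trans (HN' _ _ _) _; rewrite lee_fin lerDl.
Qed.

End tails.

(** * Telescoping and limits of sequences *)

Section tail_limit.
Context {R : realType}.
Local Open Scope ereal_scope.

Definition itail (b : int -> \bar R) (m : int) :=
  \esum_(j in [set j : int | (m <= j)%R]) b j.

Lemma itail_ge0 b m : (forall j, 0 <= b j) -> 0 <= itail b m.
Proof. by move=> b0; apply: esum_ge0. Qed.

Lemma itailS b m : (forall j, 0 <= b j) -> itail b m = b m + itail b (m + 1).
Proof.
move=> b0; rewrite /itail (@esumID _ _ [set m])//; congr (_ + _).
  rewrite (_ : _ `&` _ = [set m]) ?esum_set1//.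
  by apply/seteqP; split => [j []//|j -> /=].
congr esum; apply/seteqP; split => j /=; first by move=> [mj /eqP jm]; lia.
by move=> mj; split; [lia|apply/eqP; lia].
Qed.

Lemma itail_le b m n : (m <= n)%R -> itail b n <= itail b m.
Proof. by move=> mn; apply: le_esum_set => j /=; exact: le_trans. Qed.

Lemma itail_cvg0 b m (e : R) : (forall j, 0 <= b j) -> itail b m < +oo ->
  (0 < e)%R -> exists2 n : int, (m <= n)%R & itail b n < e%:E.
Proof.
move=> b0 bm e0; pose f (k : nat) := b (m + k%:Z)%R.
have tE (N : nat) : itail b (m + N%:Z)%R = \sum_(N <= k <oo) f k.
  rewrite eseries_cond nneseries_esum; last by move=> *; exact: b0.
  rewrite /itail (@reindex_esum _ _ _ [set k : nat | (N <= k)%N] _ (fun k : nat => m + k%:Z)%R)//.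
  split=> [k /=|x y _ _ /=|j /= mj]; [lia|lia|].
  by exists `|j - m|%N => /=; lia.
have : \sum_(N <= k <oo) f k @[N --> \oo] --> 0.
  have f0 : \sum_(0 <= k <oo) f k < +oo by rewrite -tE addr0.
  exact: (@nneseries_tail_cvg R f xpredT f0 (fun k _ => b0 _)).
move=> /fine_cvgP[+ /cvgrPdist_lt/(_ e e0)].
move=> [N1 _ H1] [N2 _ H2]; pose N := maxn N1 N2.
exists (m + N%:Z)%R; first by lia.
have := H1 N (leq_maxl _ _); have := H2 N (leq_maxr _ _).
rewrite /= sub0r normrN tE => + fN; rewrite -lte_fin; apply: le_lt_trans.
by rewrite -[leLHS]fineK// lee_fin ler_norm.
Qed.

Variables (v : int -> R) (b : int -> \bar R).
Hypothesis b0 : forall j, 0 <= b j.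
Hypothesis vb : forall n, `|v (n + 1)%R - v n|%:E <= b n.

Lemma telescope_itail (m : int) (N : nat) :
  `|v (m + N%:Z)%R - v m|%:E <= itail b m.
Proof.
elim: N m => [|N IH] m; first by rewrite addr0 subrr normr0 itail_ge0.
rewrite itailS//.
have -> : (m + N.+1%:Z = (m + 1) + N%:Z)%R by lia.
rewrite -[X in `|X|%R%:E](subrKA (v (m + 1)%R)).
apply: le_trans (_ : _ <= `|v (m + 1 + N%:Z)%R - v (m + 1)%R|%:E + `|v (m + 1)%R - v m|%:E) _.
  by rewrite -EFinD lee_fin ler_normD.
by rewrite addeC; apply: leeD.
Qed.

Lemma telescope_le (m n : int) : (m <= n)%R -> `|v n - v m|%:E <= itail b m.
Proof.
move=> mn; have -> : n = (m + `|n - m|%N%:Z)%R by lia.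
exact: telescope_itail.
Qed.

(* A total limit operator, measurable in parameters; junk if [u] diverges. *)
Definition Lim (u : nat -> R) : R := fine (limn_esup (EFin \o u)).

Lemma cvg_Lim (u : nat -> R) (l : R) : u @ \oo --> l -> Lim u = l.
Proof.
move=> ul; have ul' : (EFin \o u) @ \oo --> l%:E.
  by apply: cvg_EFin => //; exact: nearW.
by rewrite /Lim is_cvg_limn_esupE; [rewrite (cvg_lim _ ul')|apply: cvgP ul'].
Qed.

Lemma is_cvg_Lim (u : nat -> R) : cvgn u -> u @ \oo --> Lim u.
Proof. by move=> /cvg_ex[l ul]; rewrite (cvg_Lim ul). Qed.

Lemma itail_is_cvg (m : int) : itail b m < +oo -> cvgn (fun n : nat => v n%:Z).
Proof.
move=> bm; apply/cauchy_cvgP; apply: cauchy_exP => e e0.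
have [n mn ne] := itail_cvg0 b0 bm e0; exists (v n).
exists `|n|%N => // k /= nk.
rewrite -ball_normE /= distrC -lte_fin; apply: le_lt_trans ne.
by apply: telescope_le; lia.
Qed.

(** Holds for divergent sequences as well, because their tails are infinite. Hence the bounds on the
    restriction below hold at every point. *)
Lemma Lim_itail (m : int) :
  `|Lim (fun n : nat => v n%:Z) - v m|%:E <= itail b m.
Proof.
have [->|bm] := eqVneq (itail b m) +oo; first by rewrite leey.
have {}bm : itail b m < +oo by rewrite ltey.
have cv := is_cvg_Lim (itail_is_cvg bm).
have /fineK bE : itail b m \is a fin_num by rewrite ge0_fin_numE ?itail_ge0.
rewrite -bE lee_fin.
have h : (fun n : nat => `|v n%:Z - v m|%R) @ \oo --> `|Lim (fun n : nat => v n%:Z) - v m|%R.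
  by apply: cvg_norm; apply: cvgB => //; exact: cvg_cst.
apply: (ler_cvg_to h (cvg_cst _)).
exists `|m|%N => // n /= mn.
by rewrite -lee_fin bE; apply: telescope_le; lia.
Qed.

End tail_limit.

Section almost_everywhere.
Context d {T : measurableType d} {R : realType} (m : {measure set T -> \bar R}).
Implicit Types P Q : T -> Prop.

Lemma ae_mono P Q : (forall x, P x -> Q x) ->
  {ae m, forall x, P x} -> {ae m, forall x, Q x}.
Proof. by move=> PQ; exact: (@filterS _ _ (ae_filter_ringOfSetsType m)). Qed.

Lemma ae_and P Q : {ae m, forall x, P x} -> {ae m, forall x, Q x} ->
  {ae m, forall x, P x /\ Q x}.
Proof. by move=> aP aQ; exact: (@filterI _ _ (ae_filter_ringOfSetsType m)). Qed.

End almost_everywhere.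

(** * Means over balls *)

Section means.
Context {R : realType} {T : pmetricType R}.
Context (mu : {outer_measure set T -> \bar R}).

Definition rmean (A : set T) (h : T -> R) : R :=
  (fine (mu A))^-1 * \int[cara mu]_(z in A) h z.

Definition loc (h : T -> R) :=
  measurable_fun [set: caratheodory_type mu] h /\
  forall (x : T) r, 0 < r -> (cara mu).-integrable (ball x r) (EFin \o h).

Lemma rmean_dist (A : set (caratheodory_type mu)) (h : T -> R) (c : R) :
  measurable A -> (0 < mu A < +oo)%E ->
  (cara mu).-integrable A (EFin \o h) ->
  (`|rmean A h - c|%:E <= (fine (mu A))^-1%:E * \int[cara mu]_(z in A) `|h z - c|%:E)%E.
Proof.
move=> mA /andP[A0 Aoo] ih.
have /fineK AE : mu A \is a fin_num by rewrite ge0_fin_numE// ltW.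
have a0 : 0 < fine (mu A) by rewrite -lte_fin AE.
have ic : (cara mu).-integrable A (EFin \o cst c : T -> \bar R).
  apply: measurable_bounded_integrable => //.
  by exists `|c|; split => // M /ltW cM x _.
have ihc : (cara mu).-integrable A (EFin \o (fun z => h z - c)).
  by have := integrableB mA ih ic; apply: eq_integrable.
have -> : rmean A h - c = (fine (mu A))^-1 * \int[cara mu]_(z in A) (h z - c).
  rewrite RintegralB// Rintegral_cst// mulrBr /rmean; congr (_ - _).
  by rewrite mulrCA mulVf ?mulr1// gt_eqF.
rewrite normrM ger0_norm ?invr_ge0 ?(ltW a0)// EFinM.
apply: lee_wpmul2l; first by rewrite lee_fin invr_ge0 ltW.
apply: (@le_trans _ _ (\int[cara mu]_(z in A) `|h z - c|)%:E).
  by rewrite lee_fin le_normr_Rintegral.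
rewrite /Rintegral fineK//; apply: integrable_fin_num => //.
exact: integrable_norm.
Qed.

Lemma rmeanD (A : set (caratheodory_type mu)) (h g : T -> R) (a : R) :
  measurable A -> (cara mu).-integrable A (EFin \o h) ->
  (cara mu).-integrable A (EFin \o g) ->
  rmean A (fun z => a * h z + g z) = a * rmean A h + rmean A g.
Proof.
move=> mA ih ig; rewrite /rmean RintegralD//; last first.
  by have := integrableZl mA a ih; apply: eq_integrable.
by rewrite RintegralZl// mulrDr mulrCA.
Qed.

Lemma rmean_cst (A : set (caratheodory_type mu)) (c : R) :
  measurable A -> (0 < mu A < +oo)%E -> rmean A (cst c) = c.
Proof.
move=> mA /andP[A0 Aoo]; rewrite /rmean Rintegral_cst// mulrCA mulVf ?mulr1//.
by rewrite gt_eqF// -lte_fin fineK// ge0_fin_numE// ltW.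
Qed.

Lemma eq_rmean (A : set (caratheodory_type mu)) (h g : T -> R) : measurable A ->
  (measurable_fun A h) -> measurable_fun A g ->
  {ae cara mu, forall z, h z = g z} -> rmean A h = rmean A g.
Proof.
move=> mA mh mg hg; rewrite /rmean; congr (_ * fine _).
apply: ae_eq_integral => //; [exact/measurable_EFinP|exact/measurable_EFinP|].
by apply: ae_mono hg => z -> _.
Qed.

Lemma ball_pos_fin (x : T) r : metric_measure_space mu -> 0 < r ->
  (0 < mu (ball x r) < +oo)%E.
Proof. by move=> [_]; apply. Qed.

End means.

(** * Limits along selected vertices *)

Section edges_of_points.
Context {R : realType} {T T' : pmetricType R}.
Context (X : hyperbolic_filling T) (io : T' -> T) (u : vertex T -> R)
  (a : vertex T * vertex T -> \bar R).
Hypothesis ua : forall e, edges X e -> (`|u e.2 - u e.1|%:E <= a e)%E.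
Hypothesis a0 : forall e, (0 <= a e)%E.

(** Either the vertices coincide, or they are joined by an edge of level [k] whose ball contains
    [z]. Between vertices of equal level its orientation is arbitrary, which the absolute value
    hides. *)
Lemma adjacent_edge (x y : vertex T) k z : is_vertex (net X) x -> is_vertex (net X) y ->
  x.1 = k -> y.1 = k \/ y.1 = k + 1 -> vball x z -> vball y z ->
  (`|u y - u x|%:E <= edge_step X a k z)%E.
Proof.
move=> Vx Vy xk yk xz yz.
have [->|xy] := pselect (x = y); first by rewrite subrr normr0 edge_step_ge0.
have xy_adj : Defs.adjacent (net X) x y.
  split => //; last by exists z.
  by rewrite /level xk; case: yk => ->; lia.
have step e : edges X e -> elevel e = k -> eball e z -> (a e <= edge_step X a k z)%E.
  move=> Ee ek ez; have /= := @esum_ge_term _ _ (edges_at X k)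
    (fun e => a e * (\1_(eball e) z : R)%:E)%E e (conj Ee ek).
  by rewrite indicE mem_set// mule1.
have [Exy|nExy] := pselect (edges X (x, y)).
  apply: le_trans (ua Exy) _; apply: step => //; last by left.
  by rewrite /elevel /level /= xk min_l//; case: yk => ->; lia.
have Eyx : edges X (y, x).
  apply: contrapT => nEyx; apply: nExy.
  by apply/(edges_oriented xy_adj).
have := edges_upward Eyx; rewrite /level /= xk => yk'.
have {}yk : y.1 = k by lia.
rewrite distrC; apply: le_trans (ua Eyx) _; apply: step => //; last by right.
by rewrite /elevel /level /= xk yk min_l.
Qed.

Variables (nu : {outer_measure set T' -> \bar R}) (g : int -> T' -> T).
Hypothesis sg : selector nu io X g.

Let v (n : int) (w : T') : vertex T := (n, g n w).

Lemma selector_ball n w : vball (v n w) (io w).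
Proof.
have [_ + _] := sg n => /(_ w) gw; rewrite vballE; apply/ballP.
by apply: lt_trans gw _; rewrite ltr_pdivrMr ?ltr_pMr ?rad_gt0// ltr1n.
Qed.

Lemma selector_next n w :
  (`|u (v (n + 1) w) - u (v n w)|%:E <= edge_step X a n (io w))%E.
Proof.
apply: adjacent_edge => //=; [| |by right|exact: selector_ball|exact: selector_ball].
- by have [+ _ _] := sg n; apply.
- by have [+ _ _] := sg (n + 1); apply.
Qed.

Hypothesis io_isom : forall x y, mdist (io x) (io y) = mdist x y.

(** The selected point is within [rad n / 2] of [io y], half of what its ball would allow. The other
    half is the distance from [y] to [w], so both balls contain [io w]. *)
Lemma selector_same n w y : mdist y w < rad n / 2 ->
  (`|u (v n w) - u (v n y)|%:E <= edge_step X a n (io w))%E.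
Proof.
move=> yw; apply: adjacent_edge => //=; [| |by left| |exact: selector_ball].
- by have [+ _ _] := sg n; apply.
- by have [+ _ _] := sg n; apply.
have [_ + _] := sg n => /(_ y) gy; rewrite vballE; apply/ballP.
apply: le_lt_trans (metric_triangle _ (io y) _) _; rewrite io_isom.
by rewrite [ltRHS](splitr (rad n)) ltrD.
Qed.

Definition ltrace (w : T') : R := Lim (fun n : nat => u (v n%:Z w)).

Lemma ltrace_dist m w :
  (`|ltrace w - u (v m w)|%:E <= tail_step io X a m w)%E.
Proof.
apply: (@Lim_itail _ (fun n => u (v n w)) (fun n => edge_step X a n (io w))).
  by move=> j; exact: edge_step_ge0.
by move=> n; exact: selector_next.
Qed.

Lemma ltrace_cvg m w : (tail_step io X a m w < +oo)%E ->
  u (v n%:Z w) @[n --> \oo] --> ltrace w.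
Proof.
move=> am; apply: is_cvg_Lim.
apply: (@itail_is_cvg _ (fun n => u (v n w)) (fun n => edge_step X a n (io w)) _ _ m am).
  by move=> j; exact: edge_step_ge0.
by move=> n; exact: selector_next.
Qed.

(** Two tails are needed: one bounds the distance to the value at the vertex of [w], and the passage
    from this vertex to that of [y] costs one term of the same tail. *)
Lemma tail_osc (G : T' -> R) n y w :
  (`|G w - u (v n w)|%:E <= tail_step io X a n w)%E -> mdist y w < rad n / 2 ->
  (`|G w - u (v n y)|%:E <= 2%:E * tail_step io X a n w)%E.
Proof.
move=> Gw yw; apply: (@le_trans _ _ (`|G w - u (v n w)|%:E + `|u (v n w) - u (v n y)|%:E)%E).
  by rewrite -EFinD lee_fin ler_distD.
have -> : (2%:E = 1 + 1 :> \bar R)%E by rewrite -EFinD.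
rewrite ge0_muleDl// mul1e; apply: leeD => //.
apply: le_trans (selector_same yw) _.
by apply: (@esum_ge_term _ _ [set j | n <= j] (fun j => edge_step X a j (io w))) => /=.
Qed.

Lemma measurable_Lim d (S : measurableType d) (D : set S) (f : nat -> S -> R) :
  (forall n, measurable_fun D (f n)) ->
  measurable_fun D (fun w => Lim (fun n => f n w)).
Proof.
move=> mf mD; apply: (measurableT_comp _ _) => //.
by apply: measurable_fun_limn_esup => // n; apply/measurable_EFinP; exact: mf.
Qed.

Lemma measurable_ltrace :
  measurable_fun [set: caratheodory_type nu] ltrace.
Proof.
apply: (@measurable_Lim _ (caratheodory_type nu)) => n.
have [_ _ /(_ (fun x => u (n%:Z, x)) setT)] := sg n; apply.
exact: measurableT.
Qed.

End edges_of_points.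

(** Applied to a one-point family, the estimates summed over centres become bounds at a single ball,
    and yield finiteness there. *)
Lemma scattered_point (R : realType) (T : pmetricType R) (y : T) (r Q : R) :
  0 <= Q -> scattered [set tt] (fun=> y) r 1 Q.
Proof.
move=> Q0 z L L1; rewrite esum_set1; last by rewrite lee_fin.
rewrite mul1r lee_fin; apply: (@le_trans _ _ (1 : R)).
  by rewrite indicE; case: (_ \in _).
by rewrite -[leLHS](powRr0 L) ler_powR.
Qed.

(** * Oscillation and differences of means along edges *)

Section edge_oscillation.
Context {R : realType} {T : pmetricType R}.
Context (mu : {outer_measure set T -> \bar R}) (Q C : R).
Hypotheses (Q0 : 0 < Q) (rmu : regular mu Q C) (mmu : metric_measure_space mu).
Local Open Scope ereal_scope.

Lemma vball_ge (v : vertex T) (k : int) : v.1 = k \/ v.1 = (k + 1)%R ->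
  (exists y z : T, rad k / 16 < mdist y z)%R ->
  ((C * 2 `^ Q * (rad k `^ Q)^-1)^-1)%:E <= mu (vball v).
Proof.
move=> vk [y [z yz]].
have r20 : (0 < rad k / 2 :> R)%R by rewrite divr_gt0// rad_gt0.
have vr : (rad k / 2 <= rad v.1 :> R)%R.
  by rewrite -rad_half; apply: le_rad; case: vk => ->; lia.
have -> : (C * 2 `^ Q * (rad k `^ Q)^-1 = (C^-1 * (rad k / 2) `^ Q)^-1)%R.
  rewrite powRM ?rad_ge0 ?invr_ge0//.
  have -> : (2^-1 `^ Q = (2 `^ Q)^-1 :> R)%R by rewrite powR_inv.
  by rewrite !invfM !invrK -mulrA; congr (_ * _)%R; rewrite mulrC.
rewrite invrK; apply: (@le_trans _ _ (mu (ball v.2 (rad k / 2)))).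
  case: rmu => _ _ _; apply => //; exists y, z; apply: le_lt_trans yz.
  by have := @rad_ge0 R k; lra.
by rewrite vballE; apply: le_outer_measure; exact: le_ball.
Qed.

Lemma rmean_ball_dist (v : vertex T) (A : set (caratheodory_type mu)) (h : T -> R) (c B : R) :
  (0 < B)%R -> loc mu h -> measurable A -> vball v `<=` A -> (B^-1)%:E <= mu (vball v) ->
  `|rmean mu (vball v) h - c|%:E <= B%:E * \int[cara mu]_(w in A) `|h w - c|%:E.
Proof.
move=> B0 lh mA vA Bv.
have mv : measurable (vball v : set (caratheodory_type mu)).
  by rewrite vballE; apply: measurable_ball; case: rmu.
have vpf : (0 < mu (vball v) < +oo)%E.
  by rewrite vballE; apply: ball_pos_fin => //; exact: rad_gt0.
have iv : (cara mu).-integrable (vball v) (EFin \o h).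
  by rewrite vballE; apply: lh.2; exact: rad_gt0.
apply: le_trans (rmean_dist _ mv vpf iv) _.
have [v0 voo] := andP vpf.
have /fineK vfin : mu (vball v) \is a fin_num by rewrite ge0_fin_numE// ltW.
apply: (@le_trans _ _ (B%:E * \int[cara mu]_(w in vball v) `|h w - c|%:E)).
  apply: lee_wpmul2r; first by apply: integral_ge0 => w _; rewrite lee_fin.
  rewrite lee_fin -[leRHS]invrK lef_pV2 ?posrE ?invr_gt0//.
    by rewrite -lee_fin vfin.
  by rewrite -lte_fin vfin.
apply: lee_wpmul2l; first by rewrite lee_fin ltW.
apply: ge0_subset_integral => //.
apply/measurable_EFinP; apply: measurableT_comp => //.
apply: measurable_funB; last exact: measurable_cst.
by apply: measurable_funTS; exact: lh.1.
Qed.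

(** Any constant [c] serves: each mean differs from it by at most a multiple of the average of |h -
    c| over a ball containing both vertex balls. Where the lower bound on measures may fail, the two
    balls coincide and the difference is 0. *)
Lemma rmean_edge (X : hyperbolic_filling T) k e (h : T -> R) (c : R) :
  loc mu h -> edges_at X k e ->
  `|rmean mu (vball e.2) h - rmean mu (vball e.1) h|%:E <=
  (2 * C * 2 `^ Q * (rad k `^ Q)^-1)%:E *
    \int[cara mu]_(w in ball e.1.2 (3 * rad k)) `|h w - c|%:E.
Proof.
move=> lh Ee; have C0 : (0 < C)%R by case: rmu => C1 _ _ _; rewrite (lt_le_trans _ C1).
set I := \int[cara mu]_(w in _) _.
have I0 : 0 <= I by apply: integral_ge0 => w _; rewrite lee_fin.
have rl0 : (0 < rad k `^ Q :> R)%R by rewrite powR_gt0// rad_gt0.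
have [ee|ne] := pselect (vball e.1 = vball e.2).
  by rewrite ee subrr normr0 mule_ge0// lee_fin !mulr_ge0 ?invr_ge0 ?powR_ge0// ltW.
have big := vball_neq Ee ne.
pose B := (C * 2 `^ Q * (rad k `^ Q)^-1)%R.
have B0 : (0 < B)%R by rewrite !mulr_gt0 ?powR_gt0 ?invr_gt0.
have mA : measurable (ball e.1.2 (3 * rad k) : set (caratheodory_type mu)).
  by apply: measurable_ball; case: rmu.
have vE v : v = e.1 \/ v = e.2 -> `|rmean mu (vball v) h - c|%:E <= B%:E * I.
  move=> ve; apply: rmean_ball_dist => //.
    apply: subset_trans (eball_sub Ee); case: ve => ->; [exact: subsetUl|exact: subsetUr].
  apply: vball_ge => //.
  by have [e1 _ _ e2 _] := edges_atP Ee; case: ve => ->; [left|].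
have := vE e.2 (or_intror erefl); have := vE e.1 (or_introl erefl).
move=> H1 H2; apply: le_trans (_ : _ <= `|rmean mu (vball e.1) h - c|%:E +
    `|rmean mu (vball e.2) h - c|%:E) _.
  rewrite -EFinD lee_fin [leRHS]addrC; move: (rmean _ _ _) (rmean _ _ _) => x1 x2.
  have -> : (x2 - x1 = (x2 - c) - (x1 - c))%R by ring.
  exact: ler_normB.
apply: le_trans (leeD H1 H2) _; rewrite -ge0_muleDl ?lee_fin ?(ltW B0)//.
apply: lee_wpmul2r => //; rewrite -EFinD lee_fin le_eqVlt; apply/orP; left.
by apply/eqP; rewrite /B; move: (2 `^ Q)%R (_^-1)%R => x1 x2; ring.
Qed.

Lemma loc_osc (G : T -> R) : measurable_fun [set: caratheodory_type mu] G ->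
  (forall x (k : int), exists c : R,
    \int[cara mu]_(w in ball x (rad k)) `|G w - c|%:E < +oo) -> loc mu G.
Proof.
move=> mG fin; split => // x r r0.
have br : borel_regular mu by case: rmu.
have [k /andP[_ rk]] := rad_approx r0.
pose i := (k - 1)%R; have ri : (r <= rad i)%R.
  by rewrite ltW// (lt_le_trans rk)// /i (radB k 1) expr1.
have [c I1] := fin x i.
have mGB : measurable_fun (ball x (rad i) : set (caratheodory_type mu)) G.
  exact: measurable_funTS.
have iGc : (cara mu).-integrable (ball x (rad i)) (EFin \o (fun w => G w - c)%R).
  apply/integrableP; split; last by under eq_integral do rewrite /=.
  by apply/measurable_EFinP; apply: measurable_funB => //; exact: measurable_cst.
have ic : (cara mu).-integrable (ball x (rad i)) (EFin \o cst c : T -> \bar R).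
  apply: measurable_bounded_integrable => //; first exact: measurable_ball.
    by have /andP[] := ball_pos_fin x mmu (rad_gt0 i).
  by exists `|c|%R; split => // M /ltW cM w _.
have iG : (cara mu).-integrable (ball x (rad i)) (EFin \o G).
  have := integrableD (measurable_ball x (rad i) br) iGc ic.
  by apply: eq_integrable => [|w _ /=]; [exact: measurable_ball|rewrite -EFinD subrK].
apply: integrableS iG; [exact: measurable_ball|exact: measurable_ball|exact: le_ball].
Qed.

End edge_oscillation.

Section trace_bounds.
Context {R : realType} {T T' : pmetricType R}.
Context (mu : {outer_measure set T -> \bar R}) (Q C : R).
Context (nu : {outer_measure set T' -> \bar R}) (lam C' : R).
Context (io : T' -> T).
Hypotheses (Q0 : 0 < Q) (rmu : regular mu Q C).
Hypotheses (lam0 : 0 < lam) (rnu : regular nu lam C').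
Hypothesis mnu : metric_measure_space nu.
Hypothesis io_isom : forall x y, mdist (io x) (io y) = mdist x y.
Context (X : hyperbolic_filling T) (g : int -> T' -> T).
Hypothesis sg : selector nu io X g.
Local Open Scope ereal_scope.

Let brnu : borel_regular nu. Proof. by case: rnu. Qed.

(** [tail_mean_dom] for a one-point family: a bounded sequence [alpha] has a finite sum against the
    summable weights. *)
Lemma tail_mean_fin (p s K S : R) (c : nat) (a : vertex T * vertex T -> \bar R) :
  (0 < p)%R -> (0 < lam * Num.min p 1 + s)%R -> (1 <= K)%R ->
  (forall e, 0 <= a e) -> (forall k, alpha s p X a k <= S%:E) ->
  forall i y, tail_mean nu lam io X a K c i y < +oo.
Proof.
move=> p0 ps K1 a0 aS i y.
have [M [t [M0 t0 HM]]] := tail_mean_dom Q0 rmu rnu io_isom c p0 ps K1 ltr01.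
have := HM X a i _ _ _ a0 (scattered_point y (rad i) (ltW lam0)).
rewrite esum_set1 ?poweR_ge0//.
have [G G0 HG] := wt_esum_fin t0.
have S0 : 0 <= S%:E by apply: le_trans (aS 0%R); exact: alpha_ge0.
have fin : M%:E * (\esum_(j in [set: int]) ((wt t j i)%:E * alpha s p X a j)) <= (M * (S * G))%:E.
  rewrite EFinM; apply: lee_wpmul2l; first by rewrite lee_fin ltW.
  apply: (@le_trans _ _ (\esum_(j in [set: int]) (S%:E * (wt t j i)%:E))).
    by apply: le_esum => j _; rewrite muleC; apply: lee_wpmul2r; rewrite ?lee_fin ?wt_ge0.
  rewrite esumZl//; last by move=> j; rewrite lee_fin wt_ge0.
  by rewrite EFinM; apply: lee_wpmul2l.
move=> /le_trans/(_ fin) H.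
rewrite ltey; apply/eqP => ty; move: H; rewrite ty poweRyr ?gt_eqF//.
by rewrite gt0_muley ?lte_fin ?powR_gt0// leye_eq.
Qed.

Context (u : vertex T -> R) (a : vertex T * vertex T -> \bar R).
Hypothesis ua : forall e, edges X e -> (`|u e.2 - u e.1|%:E <= a e)%E.
Hypothesis a0 : forall e, (0 <= a e)%E.
Context (G : T' -> R).
Hypothesis mG : measurable_fun [set: caratheodory_type nu] G.
Hypothesis Ga : forall n, {ae cara nu, forall w,
  `|G w - u (n, g n w)|%:E <= tail_step io X a n w}.

(** The hypothesis on [G] is an almost everywhere one in order to cover two cases: the restriction,
    where it holds everywhere, and a given function on F, where it comes from Lebesgue
    differentiation. *)
Lemma trace_integral (n : int) (y : T') (r : R) : (r <= rad n / 2)%R ->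
  \int[cara nu]_(w in ball y r) `|G w - u (n, g n y)|%:E <=
  2%:E * \int[cara nu]_(w in ball y r) tail_step io X a n w.
Proof.
move=> rn; rewrite -ge0_integralZl//; last 3 first.
- exact: measurable_ball.
- exact: measurable_tail_step Q0 rmu rnu io_isom _ _ _ _ a0.
- by move=> w _; exact: tail_step_ge0.
apply: ae_ge0_le_integral => //.
- exact: measurable_ball.
- apply/measurable_EFinP; apply: measurableT_comp => //.
  apply: measurable_funB; last exact: measurable_cst.
  by apply: measurable_funTS.
- by move=> w _; rewrite mule_ge0//; exact: tail_step_ge0.
- apply: measurable_funeM.
  exact: measurable_tail_step Q0 rmu rnu io_isom _ _ _ _ a0.
apply: ae_mono (Ga n) => w Gw /ballP yw.
by apply: (tail_osc ua a0 sg io_isom Gw); exact: lt_le_trans rn.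
Qed.

Lemma trace_loc : (forall i y, tail_mean nu lam io X a 1 1 i y < +oo) -> loc nu G.
Proof.
move=> fin; apply: (loc_osc rnu mnu mG) => x i; exists (u (i - 1, g (i - 1)%R x)%R).
have riE : (rad i <= rad (i - 1) / 2 :> R)%R by rewrite -rad_half subrK.
apply: le_lt_trans (trace_integral x riE) _; rewrite lte_mul_pinfty//.
have := fin i x; rewrite /tail_mean mul1r => /(lte_mul_pinfty _ _).
have rl0 : (0 < rad i `^ lam :> R)%R by rewrite powR_gt0// rad_gt0.
move=> /(_ (rad i `^ lam)%:E); rewrite muleA -EFinM mulfV ?gt_eqF// mul1e.
by apply; rewrite ?lee_fin ?ltW.
Qed.

Lemma trace_grad (Y : hyperbolic_filling T') k e : loc nu G -> edges_at Y k e ->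
  `|rmean nu (vball e.2) G - rmean nu (vball e.1) G|%:E <=
  (4 * C' * 2 `^ lam)%:E * tail_mean nu lam io X a 3 3 k e.1.2.
Proof.
move=> lG Ee; have C'0 : (0 < C')%R by case: rnu => C1 _ _ _; rewrite (lt_le_trans _ C1).
apply: le_trans (rmean_edge lam0 rnu mnu (u (k - 3, g (k - 3)%R e.1.2)%R) lG Ee) _.
have H : \int[cara nu]_(w in ball e.1.2 (3 * rad k))
    `|G w - u (k - 3, g (k - 3)%R e.1.2)%R|%:E <=
    2%:E * \int[cara nu]_(w in ball e.1.2 (3 * rad k)) tail_step io X a (k - 3%:Z) w.
  apply: trace_integral.
  (* The shift 3 is the least that puts radius [3 * rad k] below half of the coarser radius. *)
  have -> : (rad (k - 3) = 8 * rad k :> R)%R by rewrite (radB k 3); congr (_ * _)%R; ring.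
  by have := @rad_ge0 R k; lra.
have B0 : 0 <= (2 * C' * 2 `^ lam * (rad k `^ lam)^-1)%:E.
  by rewrite lee_fin !mulr_ge0 ?powR_ge0 ?invr_ge0 ?powR_ge0// ltW.
apply: le_trans (lee_wpmul2l B0 H) _; rewrite /tail_mean !muleA -!EFinM.
apply: lee_wpmul2r; first by apply: integral_ge0 => w _; exact: tail_step_ge0.
rewrite lee_fin le_eqVlt; apply/orP; left.
by apply/eqP; move: (2 `^ lam)%R (_^-1)%R => x1 x2; ring.
Qed.

End trace_bounds.

(** * Lebesgue differentiation along vertices *)

Section distance_to_set.
Context {R : realType} {T : pmetricType R}.
Implicit Types (A : set T) (x y z : T).

Definition setdist A x : R := inf [set mdist x y | y in A].

Lemma setdist_has_inf A x : A !=set0 -> has_inf [set mdist x y | y in A].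
Proof.
move=> [a Aa]; split; first by exists (mdist x a); exists a.
by exists 0 => _ [y _ <-]; exact: mdist_ge0.
Qed.

Lemma setdist_ge0 A x : A !=set0 -> 0 <= setdist A x.
Proof.
move=> A0; apply: lb_le_inf; first by have [] := setdist_has_inf x A0.
by move=> _ [y _ <-]; exact: mdist_ge0.
Qed.

Lemma setdist_le A x y : A y -> setdist A x <= mdist x y.
Proof.
move=> Ay; apply: ge_inf; last by exists y.
by have [] := @setdist_has_inf A x (ex_intro _ _ Ay).
Qed.

Lemma setdist_lt A x r : A !=set0 -> setdist A x < r ->
  exists2 y, A y & mdist x y < r.
Proof.
move=> A0 Ar; have e0 : 0 < r - setdist A x by rewrite subr_gt0.
have [_ [y Ay <-]] := inf_adherent e0 (setdist_has_inf x A0).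
by rewrite addrC subrK => xy; exists y.
Qed.

Lemma setdist_lip A x y : A !=set0 -> setdist A x <= setdist A y + mdist x y.
Proof.
move=> A0; rewrite -lerBlDr; apply: lb_le_inf; first by have [] := setdist_has_inf y A0.
move=> _ [z Az <-]; rewrite lerBlDr; apply: le_trans (setdist_le x Az) _.
by rewrite addrC; exact: metric_triangle.
Qed.

Lemma setdist_dist A x y : A !=set0 -> `|setdist A x - setdist A y| <= mdist x y.
Proof.
move=> A0; rewrite ler_norml; have := setdist_lip x y A0; have := setdist_lip y x A0.
by rewrite (metric_sym y x); lra.
Qed.

End distance_to_set.

(** * Density of Lipschitz functions in L^1 *)

Section lipschitz_density.
Context {R : realType} {T : pmetricType R}.
Context (mu : {outer_measure set T -> \bar R}).
Hypothesis br : borel_regular mu.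
Implicit Types (f g phi : T -> R) (A : set T).

Definition lip phi := exists2 M, 0 <= M &
  forall x y : T, `|phi x - phi y| <= M * mdist x y.

Lemma open_measurable_fun f : (forall c, open [set z | c < f z]) ->
  measurable_fun [set: caratheodory_type mu] f.
Proof.
move=> of_; apply: (measurability _ (RGenOInfty.measurableE R)).
move=> _ [_ [c ->] <-]; rewrite setTI.
apply: measurable_open => //; have := of_ c; congr open.
by apply/seteqP; split => z /=; rewrite in_itv/= andbT.
Qed.

Lemma lip_open phi c : lip phi -> open [set z | c < phi z].
Proof.
move=> [M M0 lp]; rewrite openE => z /= cz; apply/nbhs_ballP.
exists ((phi z - c) / (M + 1)); first by rewrite /= divr_gt0 ?subr_gt0// ltr_wpDl.
move=> y /ballP zy /=; have := lp z y; rewrite ler_norml => /andP[_].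
have : M * mdist z y <= (M + 1) * mdist z y by rewrite ler_wpM2r ?mdist_ge0// lerDl.
have : mdist z y * (M + 1) < phi z - c by rewrite -ltr_pdivlMr// ltr_wpDl.
by rewrite (mulrC (mdist _ _)); lra.
Qed.

Lemma lip_measurable phi : lip phi -> measurable_fun [set: caratheodory_type mu] phi.
Proof. by move=> lp; apply: open_measurable_fun => c; exact: lip_open. Qed.

Context (D : set (caratheodory_type mu)).
Hypotheses (mD : measurable D) (Doo : (mu D < +oo)%E).

(** Lipschitz functions are the test class because their averages over balls of radius [rad n] are
    within a multiple of [rad n] of their values, uniformly and without compactness. *)
Definition approx f := forall e, 0 < e -> exists2 phi, lip phi &
  (\int[cara mu]_(z in D) (`|f z - phi z|)%:E < e%:E)%E.

Let mT f := measurable_fun [set: caratheodory_type mu] f.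

Lemma measurable_dist f g : mT f -> mT g ->
  measurable_fun D (fun z : caratheodory_type mu => (`|f z - g z|)%:E).
Proof.
move=> mf mg; apply/measurable_EFinP; apply: measurableT_comp => //.
by apply: measurable_funB; exact: measurable_funTS.
Qed.

Lemma integral_dist_triangle f g phi : mT f -> mT g -> mT phi ->
  (\int[cara mu]_(z in D) (`|f z - phi z|)%:E <=
   \int[cara mu]_(z in D) (`|f z - g z|)%:E +
   \int[cara mu]_(z in D) (`|g z - phi z|)%:E)%E.
Proof.
move=> mf mg mp; rewrite -ge0_integralD//; [|exact: measurable_dist|exact: measurable_dist].
apply: le_integral_ge0 => z _; first by rewrite lee_fin.
by rewrite -EFinD lee_fin ler_distD.
Qed.

Lemma approx_near f : mT f ->
  (forall e, 0 < e -> exists g, [/\ mT g, approx g &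
    (\int[cara mu]_(z in D) (`|f z - g z|)%:E < e%:E)%E]) -> approx f.
Proof.
move=> mf H e e0; have e20 : 0 < e / 2 by rewrite divr_gt0.
have [g [mg ag fg]] := H _ e20; have [phi lp gp] := ag _ e20.
exists phi => //; apply: le_lt_trans (integral_dist_triangle mf mg (lip_measurable lp)) _.
by rewrite [e](splitr e) EFinD; exact: lteD.
Qed.

Lemma approxD f g : mT f -> mT g -> approx f -> approx g ->
  approx (fun z => f z + g z).
Proof.
move=> mf mg af ag e e0; have e20 : 0 < e / 2 by rewrite divr_gt0.
have [phi lp fp] := af _ e20; have [psi ls gs] := ag _ e20.
exists (fun z => phi z + psi z).
  have [[M M0 lM] [N N0 lN]] := (lp, ls); exists (M + N); first exact: addr_ge0.
  move=> x y; have := lM x y; have := lN x y; rewrite mulrDl => h1 h2.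
  rewrite opprD addrACA; apply: le_trans (ler_normD _ _) _; exact: lerD.
have mp := lip_measurable lp; have ms := lip_measurable ls.
apply: (@le_lt_trans _ _ (\int[cara mu]_(z in D) (`|f z - phi z|)%:E +
   \int[cara mu]_(z in D) (`|g z - psi z|)%:E)%E).
  rewrite -ge0_integralD//; [|exact: measurable_dist|exact: measurable_dist].
  apply: le_integral_ge0 => z _; first by rewrite lee_fin.
  by rewrite -EFinD lee_fin opprD addrACA ler_normD.
by rewrite [e](splitr e) EFinD; exact: lteD.
Qed.

Lemma approxZ f c : mT f -> approx f -> approx (fun z => c * f z).
Proof.
move=> mf af e e0; have c0 : 0 < `|c| + 1 by rewrite ltr_wpDl.
have [phi [M M0 lM] fp] := af _ (divr_gt0 e0 c0).
exists (fun z => c * phi z).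
  exists (`|c| * M); first exact: mulr_ge0.
  by move=> x y; rewrite -mulrBr normrM -mulrA ler_wpM2l.
have mp : mT phi by apply: lip_measurable; exists M.
apply: (@le_lt_trans _ _ (`|c|%:E * \int[cara mu]_(z in D) (`|f z - phi z|)%:E)%E).
  rewrite -ge0_integralZl//; last exact: measurable_dist.
  apply: le_integral_ge0 => z _; first by rewrite lee_fin.
  by rewrite -mulrBr normrM EFinM.
have I0 : (0 <= \int[cara mu]_(z in D) (`|f z - phi z|)%:E)%E.
  by apply: integral_ge0 => z _; rewrite lee_fin.
move: fp I0; case: integral => [r| |]//; rewrite !lee_fin lte_fin -EFinM lte_fin.
by rewrite ltr_pdivlMr// => rc r0; apply: le_lt_trans rc; rewrite mulrC ler_wpM2l// lerDl.
Qed.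

Lemma approx_lip phi : lip phi -> approx phi.
Proof.
move=> lp e e0; exists phi => //.
under eq_integral do rewrite subrr normr0.
by rewrite integral0 lte_fin.
Qed.

Lemma lip_cst c : lip (cst c).
Proof. by exists 0 => // x y; rewrite subrr normr0 mul0r. Qed.

Lemma nd_small (A : (set (caratheodory_type mu))^nat) : (forall n, measurable (A n)) ->
  nondecreasing_seq A -> forall e, 0 < e -> exists n,
  (cara mu ((\bigcup_n A n `\` A n) `&` D) < e%:E)%E.
Proof.
move=> mA ndA e e0.
have mU : measurable (\bigcup_n A n) by exact: bigcup_measurable.
pose B n := A n `&` D; have mB n : measurable (B n) by exact: measurableI.
have ndB : nondecreasing_seq B.
  by move=> i j ij; apply/subsetPset; apply: setSI; apply/subsetPset; exact: ndA.
have UB : \bigcup_n B n = \bigcup_n A n `&` D by rewrite setI_bigcupl.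
have cvB := @nondecreasing_cvg_mu _ _ _ (cara mu) B mB; rewrite UB in cvB.
have mUD : measurable (\bigcup_n A n `&` D) by exact: measurableI.
have fin (S : set (caratheodory_type mu)) : S `<=` D -> (cara mu S < +oo)%E.
  by move=> SD; apply: le_lt_trans Doo; exact: le_outer_measure.
have f1 : cara mu (\bigcup_n A n `&` D) \is a fin_num.
  by rewrite ge0_fin_numE// fin//; exact: subIsetr.
have := cvB mUD ndB; rewrite -(fineK f1).
move=> /fine_cvgP[_ /cvgrPdist_lt/(_ e e0)[n _ Hn]].
exists n; have := Hn n (leqnn n) => /=.
have -> : (\bigcup_n A n `\` A n) `&` D = (\bigcup_n A n `&` D) `\` B n.
  by apply/seteqP; split => z; rewrite /B /=; tauto.
have BU : B n `<=` \bigcup_n A n `&` D by apply: setSI; exact: bigcup_sup.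
have f2 : cara mu (B n) \is a fin_num by rewrite ge0_fin_numE// fin//; exact: subIsetr.
rewrite measureD//; last by rewrite -ge0_fin_numE.
rewrite (setIidr BU) => Hlt.
suff : (cara mu (\bigcup_n A n `&` D) - cara mu (B n) < e%:E)%E by [].
rewrite -(fineK f1) -(fineK f2) -EFinB lte_fin; apply: le_lt_trans Hlt.
exact: ler_norm.
Qed.

Lemma mT_indic A : measurable (A : set (caratheodory_type mu)) -> mT (\1_A).
Proof. by move=> mA; exact: measurable_indic. Qed.

Lemma indic_dist_le (C : set (caratheodory_type mu)) (phi : T -> R) :
  measurable C -> (forall z, D z -> `|phi z| <= \1_C z) ->
  (\int[cara mu]_(z in D) (`|phi z|)%:E <= cara mu (C `&` D))%E.
Proof.
move=> mC pC; rewrite -integral_indic//.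
apply: le_integral_ge0 => z Dz; rewrite lee_fin//; exact: pC.
Qed.

Lemma setdist_lipschitz A : A !=set0 -> lip (setdist A).
Proof. by move=> A0; exists 1 => // x y; rewrite mul1r setdist_dist. Qed.

(** The truncated distance to the complement, min(1, (n + 1) dist), equals 1 on the points at
    distance more than 1/(n + 1) from it; these sets increase to [U]. An empty complement is set
    aside, as the distance to it is meaningless. *)
Lemma approx_open (U : set T) : open U -> approx (\1_U).
Proof.
move=> oU; have [UT|] := pselect (~` U = set0).
  rewrite -(setCK U) UT setC0 indicT.
  exact: approx_lip (lip_cst 1).
move/eqP/set0P => A0 e e0.
pose V n : set (caratheodory_type mu) := [set z | n.+1%:R^-1 < setdist (~` U) z].
have mV n : measurable (V n).
  by apply: measurable_open => //; apply: lip_open; exact: setdist_lipschitz.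
have ndV : nondecreasing_seq V.
  move=> i j ij; apply/subsetPset => z; rewrite /V/=; apply: le_lt_trans.
  by rewrite lef_pV2 ?posrE// ler_nat.
have VU : \bigcup_n V n = U.
  apply/seteqP; split => [z [n _]|z Uz].
    rewrite /V/= => nz; apply: contrapT => nUz.
    by have := @setdist_le R T (~` U) z z nUz; rewrite mdistxx leNgt (lt_trans _ nz).
  have /nbhs_ballP[r /= r0 rU] := open_nbhs_nbhs (conj oU Uz).
  have rz : r <= setdist (~` U) z.
    rewrite leNgt; apply/negP => /(setdist_lt A0)[y nUy zy].
    by apply: nUy; apply: rU; apply/ballP.
  have [n _ Hn] := near_infty_natSinv_lt (PosNum r0).
  by exists n => //; rewrite /V/=; apply: lt_le_trans rz; exact: (Hn n (leqnn n)).
have [n Hn] := nd_small mV ndV e0; rewrite VU in Hn.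
exists (fun z => Num.min 1 (n.+1%:R * setdist (~` U) z)).
  exists n.+1%:R => // x y.
  have : `|n.+1%:R * setdist (~` U) x - n.+1%:R * setdist (~` U) y| <=
     n.+1%:R * mdist x y by rewrite -mulrBr normrM ger0_norm// ler_wpM2l// setdist_dist.
  apply: le_trans; rewrite /Num.min; set a := _ * _; set b := _ * _.
  case: ifPn => [|/negP/negP]; case: ifPn => [|/negP/negP];
    rewrite -?leNgt ?subrr ?normr0// => h1 h2.
  - by rewrite ler_norml; have := ler_norm (a - b); have := normr_ge0 (a - b); lra.
  - by rewrite ler_norml; have := ler_norm (b - a); rewrite distrC;
      have := normr_ge0 (a - b); have := ler_norm (a - b); lra.
apply: le_lt_trans Hn; apply: indic_dist_le.
  by apply: measurableD => //; exact: measurable_open.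
move=> z _; have d0 : 0 <= n.+1%:R * setdist (~` U) z by rewrite mulr_ge0// setdist_ge0.
have [Vz|nVz] := pselect (V n z).
  have Uz : U z by rewrite -VU; exists n.
  have nd : 1 <= n.+1%:R * setdist (~` U) z by rewrite -ler_pdivrMl// mulr1 ltW.
  by rewrite min_l// indicE mem_set// subrr normr0 ler0n.
have [Uz|nUz] := pselect (U z); rewrite !indicE.
  rewrite (mem_set Uz) mem_set//= mulr1n ler_norml /Num.min; case: ifPn => _; first lra.
  have : n.+1%:R * setdist (~` U) z <= 1.
    by rewrite -ler_pdivlMl// mulr1 leNgt; exact/negP.
  by lra.
rewrite memNset// [X in `|_ - X|]min_r.
  have := @setdist_le R T (~` U) z z nUz; have := setdist_ge0 z A0; rewrite mdistxx => h1 h2.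
  have -> : setdist (~` U) z = 0 by apply/eqP; rewrite eq_le h1 h2.
  by rewrite mulr0 subrr normr0.
have := @setdist_le R T (~` U) z z nUz; have := setdist_ge0 z A0; rewrite mdistxx => h1 h2.
have -> : setdist (~` U) z = 0 by apply/eqP; rewrite eq_le h1 h2.
by rewrite mulr0.
Qed.

(** Dynkin's argument: open sets are stable under intersection, and the measurable sets with
    approximable indicator form a lambda-system, closed under increasing unions because [D] has
    finite measure. *)
Lemma approx_borel (B : set T) : <<s [set U : set T | open U] >> B ->
  measurable (B : set (caratheodory_type mu)) /\ approx (\1_B).
Proof.
pose H : set (set T) := [set B | measurable (B : set (caratheodory_type mu)) /\
  approx (\1_B)].
suff LH : lambda_system setT H.
  have IG : setI_closed [set U : set T | open U] by move=> A C; exact: openI.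
  have := lambda_system_subset IG LH; apply => U oU; split.
    exact: measurable_open.
  exact: approx_open.
split => //.
- by split=> //; apply: approx_open; exact: openT.
- move=> A C CA [mA aA] [mC aC]; split; first exact: measurableD.
  have -> : (\1_(A `\` C) : T -> R) = (fun z => \1_A z + (-1) * \1_C z).
    apply/funext => z; rewrite !indicE in_setD.
    have [Cz|nCz] := pselect (C z); first by rewrite (mem_set Cz) (mem_set (CA _ Cz))/=; ring.
    by rewrite (memNset nCz)/= andbT; ring.
  apply: approxD => //; first exact: mT_indic.
    by apply: measurable_funM => //; exact: mT_indic.
  by apply: approxZ => //; exact: mT_indic.
- move=> A ndA HA; have mA n : measurable (A n : set (caratheodory_type mu)).
    by have [] := HA n.
  have mU : measurable (\bigcup_n A n : set (caratheodory_type mu)).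
    exact: bigcup_measurable.
  split => //; apply: approx_near; first exact: mT_indic.
  move=> e e0; have [n Hn] := nd_small mA ndA e0.
  exists (\1_(A n)); split; first exact: mT_indic; first by have [] := HA n.
  apply: le_lt_trans Hn; apply: indic_dist_le; first exact: measurableD.
  move=> z _; rewrite !indicE in_setD.
  have [Az|nAz] := pselect (A n z).
    by rewrite (mem_set Az) mem_set ?subrr ?normr0//; exists n.
  by rewrite (memNset nAz) subr0 andbT ger0_norm.
Qed.

(** Borel regularity provides a Borel set containing the intersection with [D] and of the same
    finite measure, so the two indicators agree on [D] up to a null set. *)
Lemma approx_indic (A : set (caratheodory_type mu)) : measurable A -> approx (\1_A).
Proof.
move=> mA; have [B [bB AB BA]] := br.2 (A `&` D).
have [mB aB] := approx_borel bB.
apply: approx_near; first exact: mT_indic.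
move=> e e0; exists (\1_B); split=> //; first exact: mT_indic.
have mAD : measurable (A `&` D) by exact: measurableI.
apply: (@le_lt_trans _ _ (cara mu ((B `\` (A `&` D)) `&` D))).
  apply: indic_dist_le; first exact: measurableD.
  move=> z Dz; rewrite !indicE in_setD.
  have [Az|nAz] := pselect (A z).
    by rewrite (mem_set Az) (mem_set (AB _ (conj Az Dz))) subrr normr0.
  rewrite (memNset nAz) [z \in A `&` D]memNset; last by case.
  by rewrite sub0r normrN andbT ger0_norm.
apply: (@le_lt_trans _ _ (cara mu (B `\` (A `&` D)))).
  by apply: le_measure; rewrite ?inE; [apply: measurableI => //; exact: measurableD|
    exact: measurableD|exact: subIsetl].
have fAD : (mu (A `&` D) < +oo)%E.
  by apply: le_lt_trans Doo; apply: le_outer_measure; exact: subIsetr.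
rewrite measureD//; last by rewrite /= BA.
rewrite (setIidr AB) /cara/= BA subee ?lte_fin//.
by rewrite ge0_fin_numE// outer_measure_ge0.
Qed.

Lemma approx_fsum (I : choiceType) (s : seq I) (c : I -> R)
    (A : I -> set (caratheodory_type mu)) : (forall i, measurable (A i)) ->
  mT (fun z => \sum_(i <- s) c i * \1_(A i) z) /\
  approx (fun z => \sum_(i <- s) c i * \1_(A i) z).
Proof.
move=> mA; elim: s => [|i s [mIH aIH]].
  have -> : (fun z : T => \sum_(i <- [::]) c i * \1_(A i) z) = cst 0.
    by apply/funext => z; rewrite big_nil.
  by split; [exact: measurable_cst|exact: approx_lip (lip_cst 0)].
have -> : (fun z => \sum_(j <- (i :: s)) c j * \1_(A j) z) =
  (fun z => c i * \1_(A i) z + \sum_(j <- s) c j * \1_(A j) z).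
  by apply/funext => z; rewrite big_cons.
have mc : mT (fun z => c i * \1_(A i) z) by apply: measurable_funM => //; exact: mT_indic.
split; first exact: measurable_funD.
apply: approxD => //; apply: approxZ; [exact: mT_indic|exact: approx_indic].
Qed.

Import HBSimple.

Lemma lip_dense h : mT h -> (cara mu).-integrable D (EFin \o h) -> approx h.
Proof.
move=> mh ih; have [g [ig _ gh]] := approximation_sfun_integrable mD ih.
apply: approx_near => // e e0.
move: gh => /fine_cvgP[[m _ Hm] /cvgrPdist_lt/(_ e e0)[n _ Hn]].
pose k := maxn m n; pose gk : caratheodory_type mu -> R := HBSimple.SimpleFun.sort (g k); exists gk.
have mg (y : R) : measurable (gk @^-1` [set y] : set (caratheodory_type mu)).
  have H := @measurable_funPTI _ _ _ _ (g k) [set y] (measurable_set1 y); exact: H.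
have fr : finite_set (range (HBSimple.SimpleFun.sort (g k))) by exact: fimfunP.
have gE : gk = (fun z => \sum_(y <- fset_set (range (HBSimple.SimpleFun.sort (g k)))) y * \1_(gk @^-1` [set y]) z).
  by apply/funext => z; rewrite {1}/gk fimfunE fsbig_finite.
have [mgk agk] := approx_fsum (fset_set (range (HBSimple.SimpleFun.sort (g k)))) id mg.
split; [by rewrite gE|by rewrite gE|].
have := Hn k (leq_maxr _ _); rewrite /= sub0r normrN => hn.
have := Hm k (leq_maxl _ _) => /= hm.
by rewrite -(fineK hm) lte_fin; apply: le_lt_trans hn; exact: ler_norm.
Qed.

End lipschitz_density.

(** * Differentiation along selected vertices *)

Section lebesgue_differentiation.
Context {R : realType} {T : pmetricType R}.
Context (mu : {outer_measure set T -> \bar R}) (Q C : R).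
Hypotheses (Q0 : 0 < Q) (rmu : regular mu Q C).
Hypothesis mmu : metric_measure_space mu.
Context (X : hyperbolic_filling T) (g : int -> T -> T).
Hypothesis sg : selector mu id X g.

Let br : borel_regular mu. Proof. by case: rmu. Qed.

Lemma esum_integral_net : exists2 N : R, 0 < N & forall n (D : set (caratheodory_type mu))
    (psi : T -> \bar R), measurable D ->
  measurable_fun D (psi : caratheodory_type mu -> \bar R) -> (forall z, 0 <= psi z)%E ->
  (\esum_(x in [set x | net X n x /\ ball x (rad n) `<=` D])
     \int[cara mu]_(z in ball x (rad n)) psi z <=
   N%:E * \int[cara mu]_(z in D) psi z)%E.
Proof.
have [N N0 HN] := net_scattered Q0 rmu; exists N => // n D psi mD mpsi psi0.
set E := [set x | _].
have cE : countable E by apply: sub_countable (net_countable Q0 rmu X n); apply: subset_card_le => x [].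
have mb x : measurable (ball x (rad n) : set (caratheodory_type mu)) by exact: measurable_ball.
have mI (x : T) : measurable_fun D (fun z : caratheodory_type mu => (\1_(ball x (rad n)) z : R)%:E).
  by apply/measurable_EFinP; exact: measurable_indic.
have -> : (\esum_(x in E) \int[cara mu]_(z in ball x (rad n)) psi z =
    \esum_(x in E) \int[cara mu]_(z in D) (psi z * (\1_(ball x (rad n)) z : R)%:E))%E.
  apply: eq_esum => x [_ xD]; rewrite -[in LHS](setIidr xD).
  rewrite integral_mkcondr; apply: eq_integral => z _.
  by rewrite epatch_indic.
rewrite -ge0_integral_esum//; last 2 first.
- by move=> x; exact: emeasurable_funM.
- by move=> x z; rewrite mule_ge0.
rewrite -ge0_integralZl//; last by rewrite lee_fin ltW.
apply: le_integral_ge0 => z _.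
  by apply: esum_ge0 => x _; rewrite mule_ge0.
apply: le_trans (esumZl_le _ _ _) _ => //.
rewrite muleC; apply: lee_wpmul2r => //.
have := HN X n z 1 (lexx 1); rewrite powR1 mulr1; apply: le_trans.
apply: (@le_trans _ _ (\esum_(x in net X n) (\1_(ball x (rad n)) z : R)%:E)%E).
  by apply: le_esum_set => x [].
apply: le_esum => x _; rewrite mul1r !indicE lee_fin.
have [/ballP xz|nxz] := pselect (ball x (rad n) z).
  rewrite mem_set; last exact/ballP.
  by rewrite mem_set//; apply/ballP; rewrite metric_sym.
by rewrite memNset.
Qed.

Context (h : T -> R).
Hypothesis lh : loc mu h.
Let u (v : vertex T) := rmean mu (vball v) h.
Let F n w := `|u (n%:Z, g n%:Z w) - h w|%:E.

Let mF n (D : set (caratheodory_type mu)) : measurable D -> measurable_fun D (F n : caratheodory_type mu -> \bar R).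
Proof.
move=> mD; apply/measurable_EFinP; apply: measurableT_comp => //.
apply: measurable_funB; last by apply: measurable_funTS; exact: lh.1.
have [_ _ /(_ (fun x => u (n%:Z, x)) D)] := sg n; exact.
Qed.

(** This replaces a maximal inequality. Averaging h - phi over the balls of one net is bounded in
    L^1 because these balls have bounded overlap, and for the Lipschitz function phi the error is at
    most 2 M rad n. *)
Lemma discrete_L1_bound : exists2 N : R, 0 < N & forall x0 r phi M (n : nat), 0 < r -> 0 <= M ->
  (forall x y : T, `|phi x - phi y| <= M * mdist x y) -> (0 < n)%N ->
  (\int[cara mu]_(w in ball x0 r) F n w <=
    N%:E * \int[cara mu]_(z in ball x0 (r + 1)%R) `|h z - phi z|%:E +
    (2 * M * rad n%:Z)%:E * mu (ball x0 r))%E.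
Proof.
have [N N0 HN] := esum_integral_net; exists (N + 1); first by rewrite addr_gt0.
move=> x0 r phi M n r0 M0 lphi n0.
have mB : measurable (ball x0 r : set (caratheodory_type mu)) by exact: measurable_ball.
have mB' : measurable (ball x0 (r + 1) : set (caratheodory_type mu)) by exact: measurable_ball.
pose psi (z : T) := (`|h z - phi z|)%:E.
have psi0 z : (0 <= psi z)%E by rewrite lee_fin.
have mphi : measurable_fun [set: caratheodory_type mu] phi.
  by apply: lip_measurable => //; exists M.
have mpsi (D : set (caratheodory_type mu)) : measurable D ->
    measurable_fun D (psi : caratheodory_type mu -> \bar R).
  move=> mD; apply/measurable_EFinP; apply: measurableT_comp => //.
  by apply: measurable_funB; apply: measurable_funTS => //; exact: lh.1.
set E := [set x | net X n%:Z x /\ ball x (rad n%:Z) `<=` ball x0 (r + 1)].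
have mb x : measurable (ball x (rad n%:Z) : set (caratheodory_type mu)) by exact: measurable_ball.
pose c x := ((fine (mu (ball x (rad n%:Z))))^-1%:E *
  \int[cara mu]_(z in ball x (rad n%:Z)) psi z)%E.
have bpf (x : T) : (0 < mu (ball x (rad n%:Z)) < +oo)%E by apply: ball_pos_fin => //; exact: rad_gt0.
have I0 (D : set T) : (0 <= \int[cara mu]_(z in D) psi z)%E by exact: integral_ge0.
have c0 x : (0 <= c x)%E by rewrite mule_ge0// lee_fin invr_ge0 fine_ge0.
(* For n > 0, the ball of the vertex selected at a point of [ball x0 r] stays inside
   [ball x0 (r + 1)]. *)
have rn : rad n%:Z <= 1 / 2 :> R.
  have -> : 1 / 2 = rad 1 :> R by rewrite rad1 div1r.
  by apply: le_rad; lia.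
pose S w := (\esum_(x in E) (c x * (\1_(ball x (rad n%:Z)) w : R)%:E))%E.
have FS w : ball x0 r w -> (F n w <= S w + (2 * M * rad n%:Z)%:E + psi w)%E.
  move=> /ballP xw; pose x := g n%:Z w.
  have [/(_ w) Nx /(_ w) xw' _] := sg n%:Z; rewrite -/x in Nx xw'.
  have r0' := @rad_ge0 R n%:Z.
  have Ex : E x.
    split => // z /ballP xz; apply/ballP.
    have := metric_triangle x0 w z; have := metric_triangle w x z.
    by rewrite (metric_sym w x); rewrite /= in xw'; lra.
  have xwb : ball x (rad n%:Z) w by apply/ballP; rewrite /= in xw'; lra.
  have cS : (c x <= S w)%E.
    have := @esum_ge_term _ _ E (fun x => c x * (\1_(ball x (rad n%:Z)) w : R)%:E)%E x Ex.
    by rewrite indicE mem_set// mule1.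
  have ih : (cara mu).-integrable (ball x (rad n%:Z)) (EFin \o h) by apply: lh.2; exact: rad_gt0.
  have := rmean_dist (phi w) (mb x) (bpf x) ih => H1.
  have H2 : (`|u (n%:Z, x) - phi w|%:E <= c x + (2 * M * rad n%:Z)%:E)%E.
    rewrite /u vballE; apply: le_trans H1 _.
    have /fineK bE : mu (ball x (rad n%:Z)) \is a fin_num.
      by have /andP[b0 boo] := bpf x; rewrite ge0_fin_numE// ltW.
    have b0 : 0 < fine (mu (ball x (rad n%:Z))) by rewrite -lte_fin bE; have /andP[] := bpf x.
    apply: (@le_trans _ _ ((fine (mu (ball x (rad n%:Z))))^-1%:E *
      \int[cara mu]_(z in ball x (rad n%:Z)) (psi z + (2 * M * rad n%:Z)%:E))%E).
      apply: lee_wpmul2l; first by rewrite lee_fin invr_ge0 ltW.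
      apply: le_integral_ge0 => z; first by rewrite lee_fin.
      move=> /ballP xz; rewrite /psi -EFinD lee_fin.
      apply: le_trans (ler_distD (phi z) _ _) _; rewrite lerD2l.
      apply: le_trans (lphi z w) _; rewrite (mulrC 2) -mulrA ler_wpM2l//.
      have := metric_triangle z x w; rewrite (metric_sym z x); rewrite /= in xw'; lra.
    have M20 : 0 <= 2 * M * rad n%:Z by rewrite !mulr_ge0.
    rewrite ge0_integralD//; last exact: mpsi.
    rewrite integral_cst// ge0_muleDr//; last by rewrite mule_ge0// lee_fin.
    rewrite /c; apply: leeD => //.
    rewrite /cara/= -bE -!EFinM lee_fin mulrCA mulVf ?mulr1// gt_eqF//.
  apply: (@le_trans _ _ (`|u (n%:Z, x) - phi w|%:E + psi w)%E).
    by rewrite /F -/x /psi -EFinD lee_fin (distrC (h w)) ler_distD.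
  apply: leeD => //; apply: le_trans H2 _; exact: leeD.
have mS : measurable_fun (ball x0 r : set (caratheodory_type mu)) (S : caratheodory_type mu -> \bar R).
  apply: measurable_fun_esum.
  - by apply: sub_countable (net_countable Q0 rmu X n%:Z); apply: subset_card_le => x [].
  - move=> x; apply: measurable_funeM; apply/measurable_EFinP; exact: measurable_indic.
  - by move=> x z; rewrite mule_ge0.
have S0 w : (0 <= S w)%E by apply: esum_ge0 => x _; rewrite mule_ge0.
have M20 : 0 <= 2 * M * rad n%:Z by rewrite !mulr_ge0// rad_ge0.
apply: (@le_trans _ _ (\int[cara mu]_(w in ball x0 r) (S w + (2 * M * rad n%:Z)%:E + psi w))%E).
  by apply: le_integral_ge0 => w; [rewrite lee_fin|exact: FS].
rewrite ge0_integralD//; last 3 first.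
- by move=> w _; rewrite adde_ge0// lee_fin.
- by apply: emeasurable_funD => //; exact: measurable_cst.
- exact: mpsi.
rewrite ge0_integralD//.
rewrite integral_cst//= addeAC; apply: leeD => //.
rewrite EFinD ge0_muleDl ?lee_fin ?(ltW N0)// mul1e; apply: leeD; last first.
  apply: ge0_subset_integral => //; first exact: mpsi.
  by apply: le_ball; rewrite lerDl.
apply: le_trans (HN n%:Z _ psi mB' (mpsi _ mB') psi0).
rewrite /S integral_esum_indic//; last first.
  by apply: sub_countable (net_countable Q0 rmu X n%:Z); apply: subset_card_le => x [].
apply: le_esum => x _; rewrite /c.
have /fineK bE : mu (ball x (rad n%:Z)) \is a fin_num.
  by have /andP[b0 boo] := bpf x; rewrite ge0_fin_numE// ltW.
have b0 : 0 < fine (mu (ball x (rad n%:Z))) by rewrite -lte_fin bE; have /andP[] := bpf x.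
rewrite muleAC -[leRHS]mul1e; apply: lee_wpmul2r => //.
apply: (@le_trans _ _ ((fine (mu (ball x (rad n%:Z))))^-1%:E * mu (ball x (rad n%:Z)))%E).
  apply: lee_wpmul2l; first by rewrite lee_fin invr_ge0 ltW.
  by apply: le_outer_measure; exact: subIsetl.
by rewrite -bE -EFinM lee_fin mulVf ?gt_eqF.
Qed.

Lemma limn_einf_le_near (v : nat -> \bar R) (e : \bar R) :
  (\forall n \near \oo, v n <= e)%E -> (limn_einf v <= e)%E.
Proof.
move=> ve; rewrite limn_einf_lim; apply: lime_le; first exact: is_cvg_einfs.
apply: filterS ve => n; apply: le_trans; apply: ereal_inf_lbound.
by exists n => /=.
Qed.

Lemma large_nat (l : int) (n : nat) : (`|l|%N + 1 <= n)%N -> (0 < n)%N /\ l <= n%:Z.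
Proof. by move=> ln; split; lia. Qed.

(** The averages tend to h in L^1 on balls, so by Fatou's lemma the lower limit of their distance to
    h is 0 almost everywhere. At a point where they converge, this determines the limit; convergence
    itself is left to the tails. *)
Lemma lebesgue_ltrace : {ae cara mu, forall w,
  cvgn (fun n : nat => u (n%:Z, g n%:Z w)) -> ltrace u g w = h w}.
Proof.
suff H (k : nat) : {ae cara mu, forall w, ball point k.+1%:R w ->
    cvgn (fun n : nat => u (n%:Z, g n%:Z w)) -> ltrace u g w = h w}.
  have := ae_foralln H; apply: ae_mono => w Hw; apply: (Hw (Num.truncn (mdist point w))).
  by apply/ballP; exact: truncnS_gt.
set r : R := k.+1%:R; have r0 : 0 < r by rewrite ltr0n.
have mB : measurable (ball point r : set (caratheodory_type mu)) by exact: measurable_ball.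
have [N N0 HN] := discrete_L1_bound.
have lim0 : (limn_einf (fun n => \int[cara mu]_(w in ball point r) F n w) <= 0)%E.
  apply/lee_addgt0Pr => e e0; rewrite add0e; apply: limn_einf_le_near.
  have r10 : 0 < r + 1 by rewrite addr_gt0.
  have mB' : measurable (ball point (r + 1) : set (caratheodory_type mu)) by exact: measurable_ball.
  have /andP[_ Boo'] := ball_pos_fin point mmu r10.
  have eN : 0 < e / 2 / N by rewrite !divr_gt0.
  have [phi [M M0 lphi] Hphi] := lip_dense br mB' Boo' lh.1 (lh.2 point _ r10) eN.
  have /andP[B0 Boo] := ball_pos_fin point mmu r0.
  have /fineK BE : mu (ball point r) \is a fin_num by rewrite ge0_fin_numE// ltW.
  have V0 : 0 < fine (mu (ball point r)) by rewrite -lte_fin BE.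
  have MV0 : 0 < 2 * M * fine (mu (ball point r)) + 1 by rewrite ltr_wpDl// !mulr_ge0// ltW.
  have d0 : 0 < e / 2 / (2 * M * fine (mu (ball point r)) + 1) by rewrite !divr_gt0.
  have [l /andP[Hl _]] := rad_approx d0.
  exists (`|l|%N + 1)%N => // n /= ln.
  have [n0 lnz] := large_nat ln.
  apply: le_trans (HN point r phi M n r0 M0 lphi n0) _.
  rewrite [e](splitr e) EFinD; apply: leeD.
    apply: (@le_trans _ _ (N%:E * (e / 2 / N)%:E)%E).
      apply: lee_wpmul2l; [by rewrite lee_fin ltW|exact: (ltW Hphi)].
    by rewrite -EFinM lee_fin mulrC divfK// gt_eqF.
  rewrite -BE -EFinM lee_fin.
  have rn : rad n%:Z <= e / 2 / (2 * M * fine (mu (ball point r)) + 1).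
    by apply: le_trans Hl; exact: le_rad.
  apply: (@le_trans _ _ ((2 * M * fine (mu (ball point r)) + 1) * rad n%:Z)).
    by rewrite [leLHS]mulrAC; apply: ler_wpM2r; rewrite ?rad_ge0// lerDl.
  by rewrite mulrC -ler_pdivlMr.
have mFB n : measurable_fun (ball point r : set (caratheodory_type mu)) (F n : caratheodory_type mu -> \bar R).
  exact: mF.
have F0 n (w : caratheodory_type mu) : ball point r w -> (0 <= F n w)%E by rewrite lee_fin.
have := le_trans (fatou (cara mu) mB mFB F0) lim0.
have L0 w : (0 <= limn_einf (F ^~ w))%E.
  rewrite limn_einf_lim; apply: lime_ge; first exact: is_cvg_einfs.
  by apply: nearW => n; apply: le_ereal_inf_tmp => _ [m _ <-]; rewrite lee_fin.
move=> I0; have {I0} : (\int[cara mu]_(w in ball point r) `|limn_einf (F ^~ w)| = 0)%E.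
  under eq_integral do rewrite gee0_abs//.
  by apply/eqP; rewrite eq_le I0 integral_ge0.
have mL : measurable_fun (ball point r : set (caratheodory_type mu)) (fun w => limn_einf (F ^~ w)).
  rewrite /limn_einf; apply: measurableT_comp => //.
  apply: measurable_fun_limn_esup => n.
  by apply: measurableT_comp => //; exact: mFB.
move=> /(ae_eq_integral_abs (cara mu) mB mL).1; apply: ae_mono => w H Bw cu.
have := H Bw; rewrite /cst /=.
have ul := is_cvg_Lim cu.
have FL : F ^~ w @ \oo --> (`|ltrace u g w - h w|)%:E.
  apply: cvg_EFin; first exact: nearW.
  exact: (cvg_norm (cvgB ul (cvg_cst (h w)))).
rewrite is_cvg_limn_einfE; last exact: cvgP FL.
rewrite (cvg_lim _ FL)// => -[] /normr0_eq0/eqP; rewrite subr_eq0 => /eqP.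
exact.
Qed.

Variable a : vertex T * vertex T -> \bar R.
Hypothesis ua : forall e, edges X e -> (`|u e.2 - u e.1|%:E <= a e)%E.
Hypothesis a0 : forall e, (0 <= a e)%E.

(** An infinite tail makes the bound trivial; a finite one gives the convergence that
    [lebesgue_ltrace] asks for. *)
Lemma mean_osc n : {ae cara mu, forall w,
  (`|h w - u (n, g n w)|%:E <= tail_step id X a n w)%E}.
Proof.
apply: ae_mono lebesgue_ltrace => w Hw.
have [->|fin] := eqVneq (tail_step id X a n w) +oo%E; first by rewrite leey.
rewrite -Hw; first exact: ltrace_dist ua a0 _ _ sg _ _.
by apply: cvgP; apply: (ltrace_cvg ua a0 sg (m := n)); rewrite ltey.
Qed.

End lebesgue_differentiation.

(** * Reduction to operators on real functions *)

Section real_functions.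
Context {R : realType} {T : pmetricType R}.
Context (mu : {outer_measure set T -> \bar R}) (X : hyperbolic_filling T).
Hypothesis mmu : metric_measure_space mu.
Implicit Types (h : T -> R) (a b : vertex T * vertex T -> \bar R) (sg p c : R).

Let br : borel_regular mu. Proof. by case: mmu. Qed.

Definition rgrad h (e : vertex T * vertex T) : \bar R :=
  `|rmean mu (vball e.2) h - rmean mu (vball e.1) h|%:E.

Lemma rgrad_ge0 h e : (0 <= rgrad h e)%E. Proof. by rewrite lee_fin. Qed.

Lemma alpha_le sg p a b k : 0 < p -> (forall e, 0 <= a e)%E ->
  (forall e, a e <= b e)%E -> (alpha sg p X a k <= alpha sg p X b k)%E.
Proof.
move=> p0 a0 ab; apply: lee_wpmul2l; first by rewrite lee_fin powR_ge0.
apply: le_esum => e _; apply: gt0_ler_poweR; rewrite ?in_itv/= ?leey ?andbT//.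
- exact: ltW.
- exact: le_trans (ab e).
Qed.

Lemma poweRD_le p (x y : \bar R) : 0 < p -> (0 <= x)%E -> (0 <= y)%E ->
  ((x + y) `^ p <= (2 `^ p)%:E * (x `^ p + y `^ p))%E.
Proof.
move=> p0 x0 y0; wlog xy : x y x0 y0 / (x <= y)%E => [H|].
  have [/H|/ltW/H] := leP x y; first exact.
  by rewrite addeC [X in (_ * X)%E]addeC; apply.
apply: (@le_trans _ _ ((2%:E * y) `^ p)%E).
  have xy2 : (x + y <= 2%:E * y)%E.
    have -> : (2%:E = 1 + 1 :> \bar R)%E by rewrite -EFinD.
    by rewrite ge0_muleDl// mul1e leeD.
  apply: gt0_ler_poweR => //; rewrite ?in_itv/= ?leey ?andbT//.
  - exact: ltW.
  - exact: adde_ge0.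
  - by rewrite mule_ge0.
rewrite poweRM// poweR_EFin; apply: lee_wpmul2l; first by rewrite lee_fin powR_ge0.
by rewrite leeDr// poweR_ge0.
Qed.

Lemma alphaD sg p a b k : 0 < p -> (forall e, 0 <= a e)%E ->
  (forall e, 0 <= b e)%E -> (alpha sg p X (fun e => a e + b e) k <=
    (2 `^ p)%:E * (alpha sg p X a k + alpha sg p X b k))%E.
Proof.
move=> p0 a0 b0; rewrite /alpha -ge0_muleDr; last 2 first.
- by apply: esum_ge0 => *; exact: poweR_ge0.
- by apply: esum_ge0 => *; exact: poweR_ge0.
rewrite muleCA; apply: lee_wpmul2l; first by rewrite lee_fin powR_ge0.
rewrite -esumD; last 2 first.
- by move=> *; exact: poweR_ge0.
- by move=> *; exact: poweR_ge0.
rewrite -esumZl ?powR_ge0//; last by move=> *; rewrite adde_ge0 ?poweR_ge0.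
by apply: le_esum => e _; exact: poweRD_le.
Qed.

Lemma alphaZ sg p c a k : 0 <= c -> (forall e, 0 <= a e)%E ->
  (alpha sg p X (fun e => c%:E * a e) k = (c `^ p)%:E * alpha sg p X a k)%E.
Proof.
move=> c0 a0; rewrite /alpha muleCA; congr (_ * _)%E.
rewrite -esumZl ?powR_ge0//; last by move=> *; exact: poweR_ge0.
by apply: eq_esum => e _; rewrite poweRM// poweR_EFin.
Qed.

Lemma loc_integrable h (v : vertex T) : loc mu h ->
  (cara mu).-integrable (vball v) (EFin \o h).
Proof. by move=> [_ lh]; rewrite vballE; apply: lh; exact: rad_gt0. Qed.

Lemma measurable_vball (v : vertex T) :
  measurable (vball v : set (caratheodory_type mu)).
Proof. by rewrite vballE; exact: measurable_ball. Qed.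

Lemma vball_pos_fin (v : vertex T) : (0 < mu (vball v) < +oo)%E.
Proof. by rewrite vballE; apply: ball_pos_fin => //; exact: rad_gt0. Qed.

Lemma loc_lin c h1 h2 : loc mu h1 -> loc mu h2 ->
  loc mu (fun z => c * h1 z + h2 z).
Proof.
move=> [m1 i1] [m2 i2]; split.
  by apply: measurable_funD => //; apply: measurable_funM => //; exact: measurable_cst.
move=> x r r0; have mb : measurable (ball x r : set (caratheodory_type mu)) by exact: measurable_ball.
have := integrableD mb (integrableZl mb c (i1 x r r0)) (i2 x r r0).
by apply: eq_integrable.
Qed.

Lemma loc_cst c : loc mu (cst c).
Proof.
split; first exact: measurable_cst.
move=> x r r0; apply: measurable_bounded_integrable => //.
- exact: measurable_ball.
- by have /andP[] := ball_pos_fin x mmu r0.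
- by exists `|c|; split => // M /ltW cM y _.
Qed.

(* The real and imaginary parts of a function of a Besov space satisfy this
   condition, which does not involve the second exponent [q]. *)
Definition admissible sg p h :=
  loc mu h /\ exists S : R, forall k, (alpha sg p X (rgrad h) k <= S%:E)%E.

Lemma rgrad_lin c h1 h2 e : loc mu h1 -> loc mu h2 ->
  (rgrad (fun z => (c * h1 z + h2 z)%R) e <= `|c|%:E * rgrad h1 e + rgrad h2 e)%E.
Proof.
move=> l1 l2; rewrite /rgrad !rmeanD; try exact: measurable_vball; try exact: loc_integrable.
rewrite -EFinM -EFinD lee_fin -normrM opprD addrACA -mulrBr.
exact: ler_normD.
Qed.

Lemma admissible_lin sg p c h1 h2 : 0 < p -> admissible sg p h1 ->
  admissible sg p h2 -> admissible sg p (fun z => c * h1 z + h2 z).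
Proof.
move=> p0 [l1 [S1 H1]] [l2 [S2 H2]]; split; first exact: loc_lin.
exists (2 `^ p * (`|c| `^ p * S1 + S2)) => k.
apply: le_trans (alpha_le _ _ p0 (rgrad_ge0 _) (fun e => rgrad_lin c e l1 l2)) _.
apply: le_trans (alphaD _ _ p0 _ _) _ => [e|e|]; rewrite ?mule_ge0 ?rgrad_ge0//.
rewrite EFinM; apply: lee_wpmul2l; first by rewrite lee_fin powR_ge0.
rewrite alphaZ//; last exact: rgrad_ge0.
rewrite EFinD EFinM; apply: leeD => //; apply: lee_wpmul2l => //.
Qed.

Lemma rgrad_cst c e : rgrad (cst c) e = 0%E.
Proof.
rewrite /rgrad !rmean_cst ?subrr ?normr0//;
  solve [exact: measurable_vball|exact: vball_pos_fin].
Qed.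

Lemma admissible_cst sg p c : 0 < p -> admissible sg p (cst c).
Proof.
move=> p0; split; first exact: loc_cst.
exists 0 => k; rewrite /alpha esum1 ?mule0// => e _.
by rewrite rgrad_cst poweR0r// gt_eqF.
Qed.

Lemma L1loc_parts (f : T -> R[i]) : L1loc mu f <->
  loc mu (fun z => complex.Re (f z)) /\ loc mu (fun z => complex.Im (f z)).
Proof.
split=> [[mr mi fI]|[[mr lr] [mi li]]].
  by split; split=> // x r r0; have [] := fI x r r0.
by split=> // x r r0; split; [exact: lr|exact: li].
Qed.

Lemma Re_le_normc (z : R[i]) : `|complex.Re z| <= Normc.normc z.
Proof.
case: z => x y /=; rewrite -[ `|x| ]sqrtr_sqr ler_wsqrtr// lerDl; exact: sqr_ge0.
Qed.

Lemma Im_le_normc (z : R[i]) : `|complex.Im z| <= Normc.normc z.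
Proof.
case: z => x y /=; rewrite -[ `|y| ]sqrtr_sqr ler_wsqrtr// lerDr; exact: sqr_ge0.
Qed.

Lemma normc_le (z : R[i]) :
  Normc.normc z <= `|complex.Re z| + `|complex.Im z|.
Proof.
case: z => x y /=; have n0 : 0 <= `|x| + `|y| by rewrite addr_ge0.
rewrite -[leRHS](ger0_norm n0) -[leRHS]sqrtr_sqr ler_wsqrtr//.
rewrite sqrrD !real_normK ?num_real// addrAC lerDl mulrn_wge0// mulr_ge0.
Qed.

Lemma Re_rgrad (f : T -> R[i]) e :
  (rgrad (fun z => complex.Re (f z)) e <= grad mu f e)%E.
Proof.
rewrite lee_fin; have := Re_le_normc (du (ball_mean mu f) e).
done.
Qed.

Lemma Im_rgrad (f : T -> R[i]) e :
  (rgrad (fun z => complex.Im (f z)) e <= grad mu f e)%E.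
Proof.
rewrite lee_fin; have := Im_le_normc (du (ball_mean mu f) e).
done.
Qed.

Lemma grad_le (f : T -> R[i]) e : (grad mu f e <=
  rgrad (fun z => complex.Re (f z)) e + rgrad (fun z => complex.Im (f z)) e)%E.
Proof.
rewrite -EFinD lee_fin; have := normc_le (du (ball_mean mu f) e).
done.
Qed.

End real_functions.

Section componentwise_operators.
Context {R : realType} {T1 T2 : pmetricType R}.
Context (mu1 : {outer_measure set T1 -> \bar R}) (Q1 C1 : R).
Context (mu2 : {outer_measure set T2 -> \bar R}) (Q2 C2 : R).
Hypotheses (Q10 : 0 < Q1) (r1 : regular mu1 Q1 C1) (m1 : metric_measure_space mu1).
Hypotheses (Q20 : 0 < Q2) (r2 : regular mu2 Q2 C2).
Context (X1 : hyperbolic_filling T1) (X2 : hyperbolic_filling T2).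
Context (s1 s2 p : R) (q : \bar R).
Hypotheses (p0 : 0 < p) (q0 : (0 < q)%E).
Context (sg : R).
Hypotheses (sg1 : s1 * p - Q1 = sg) (sg2 : s2 * p - Q2 = sg).

Let adm h := admissible mu1 X1 sg p h.

Lemma besov_admissible f : besov mu1 X1 s1 p%:E q f ->
  adm (fun z => complex.Re (f z)) /\ adm (fun z => complex.Im (f z)).
Proof.
move=> [/L1loc_parts[lr li] nf].
have [S S0 HS] := besov_alpha_bounded Q10 r1 p0 q0 nf.
rewrite sg1 in HS; split; (split; first by []); exists S => k; apply: le_trans (HS k).
  by apply: alpha_le p0 _ _ => e; [exact: rgrad_ge0|exact: Re_rgrad].
by apply: alpha_le p0 _ _ => e; [exact: rgrad_ge0|exact: Im_rgrad].
Qed.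

Definition componentwise (A : (T1 -> R) -> (T2 -> R)) (f : T1 -> R[i]) (y : T2) : R[i] :=
  Complex (A (fun z => complex.Re (f z)) y) (A (fun z => complex.Im (f z)) y).

Context (A : (T1 -> R) -> (T2 -> R)).
Hypothesis Aloc : forall h, adm h -> loc mu2 (A h).
Hypothesis Aae : forall h1 h2, adm h1 -> adm h2 ->
  {ae cara mu1, forall z, h1 z = h2 z} -> {ae cara mu2, forall y, A h1 y = A h2 y}.
Hypothesis Acst : forall c, {ae cara mu2, forall y, A (cst c) y = c}.
Hypothesis Alin : forall c h1 h2, adm h1 -> adm h2 ->
  {ae cara mu2, forall y, A (fun z => c * h1 z + h2 z) y = c * A h1 y + A h2 y}.
Hypothesis Adom : exists D d : R, [/\ 0 < D, 0 < d & forall h, adm h ->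
  dom D d (alpha sg p X2 (rgrad mu2 (A h))) (alpha sg p X1 (rgrad mu1 h))].

Lemma componentwise_dom : exists D d : R, [/\ 0 < D, 0 < d & forall f,
  besov mu1 X1 s1 p%:E q f ->
  dom D d (alpha sg p X2 (grad mu2 (componentwise A f))) (alpha sg p X1 (grad mu1 f))].
Proof.
have [D [d [D0 d0 H]]] := Adom.
exists (2 `^ p * (D + D)), d; split => //; first by rewrite mulr_gt0 ?powR_gt0// addr_gt0.
move=> f Bf k; have [ar ai] := besov_admissible Bf.
apply: le_trans (alpha_le X2 sg k p0 (grad_ge0 mu2 _) (grad_le mu2 _)) _.
apply: le_trans (alphaD X2 sg k p0 (rgrad_ge0 mu2 _) (rgrad_ge0 mu2 _)) _.
rewrite EFinM -muleA; apply: lee_wpmul2l; first by rewrite lee_fin powR_ge0.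
have S0 : (0 <= \esum_(j in [set: int]) ((wt d j k)%:E * alpha sg p X1 (grad mu1 f) j))%E.
  by apply: esum_ge0 => j _; rewrite mule_ge0 ?lee_fin ?wt_ge0// alpha_ge0.
rewrite EFinD ge0_muleDl ?lee_fin ?(ltW D0)//.
have mono h : adm h -> (forall e, rgrad mu1 h e <= grad mu1 f e)%E ->
    (alpha sg p X2 (rgrad mu2 (A h)) k <=
     D%:E * \esum_(j in [set: int]) ((wt d j k)%:E * alpha sg p X1 (grad mu1 f) j))%E.
  move=> ah hf; apply: le_trans (H h ah k) _.
  apply: lee_wpmul2l; first by rewrite lee_fin ltW.
  apply: le_esum => j _; apply: lee_wpmul2l; first by rewrite lee_fin wt_ge0.
  apply: alpha_le => //; exact: rgrad_ge0.
apply: leeD; apply: mono => // e; [exact: Re_rgrad|exact: Im_rgrad].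
Qed.

Lemma Re_lin (a x y : R[i]) : complex.Re (a * x + y) =
  complex.Re a * complex.Re x + (- complex.Im a * complex.Im x + complex.Re y).
Proof. by case: a x y => [? ?] [? ?] [? ?] /=; rewrite addrA mulNr. Qed.

Lemma Im_lin (a x y : R[i]) : complex.Im (a * x + y) =
  complex.Re a * complex.Im x + (complex.Im a * complex.Re x + complex.Im y).
Proof. by case: a x y => [? ?] [? ?] [? ?] /=; rewrite addrA. Qed.

Lemma componentwise_lin (a : R[i]) f g : besov mu1 X1 s1 p%:E q f ->
  besov mu1 X1 s1 p%:E q g ->
  {ae cara mu2, forall y, componentwise A (fun x => a * f x + g x) y =
     a * componentwise A f y + componentwise A g y}.
Proof.
move=> /besov_admissible[fr fi] /besov_admissible[gr gi].
(* A complex factor mixes the two parts, so each part of the combination needs two real ones; the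
   inner one is again admissible. *)
have r' := Alin (- complex.Im a) fi gr; have i' := Alin (complex.Im a) fr gi.
have r'' := Alin (complex.Re a) fr (admissible_lin m1 (- complex.Im a) p0 fi gr).
have i'' := Alin (complex.Re a) fi (admissible_lin m1 (complex.Im a) p0 fr gi).
have := ae_and (ae_and r' r'') (ae_and i' i''); apply: ae_mono => y [[e1 e2] [e3 e4]].
have -> : componentwise A (fun x => a * f x + g x) y = Complex
   (complex.Re a * A (fun z => complex.Re (f z)) y +
      (- complex.Im a * A (fun z => complex.Im (f z)) y + A (fun z => complex.Re (g z)) y))
   (complex.Re a * A (fun z => complex.Im (f z)) y +
      (complex.Im a * A (fun z => complex.Re (f z)) y + A (fun z => complex.Im (g z)) y)).
  rewrite -e1 -e2 -e3 -e4 /componentwise; congr Complex; congr (A _ y).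
    by apply/funext => z; rewrite Re_lin.
  by apply/funext => z; rewrite Im_lin.
apply/eqP; rewrite eq_complex Re_lin Im_lin /=.
by rewrite !eqxx.
Qed.

Lemma componentwise_ae f g : besov mu1 X1 s1 p%:E q f -> besov mu1 X1 s1 p%:E q g ->
  {ae cara mu1, forall z, f z = g z} ->
  {ae cara mu2, forall y, componentwise A f y = componentwise A g y}.
Proof.
move=> /besov_admissible[fr fi] /besov_admissible[gr gi] fg.
have er := Aae fr gr (ae_mono (fun z e => congr1 (@complex.Re R) e) fg).
have ei := Aae fi gi (ae_mono (fun z e => congr1 (@complex.Im R) e) fg).
by apply: ae_mono (ae_and er ei) => y [e1 e2]; rewrite /componentwise e1 e2.
Qed.

(** [A] fixes constants, hence commutes with adding one up to null sets. This lets the operator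
    descend to classes modulo constants. *)
Lemma componentwise_shift (h1 h2 : T1 -> R) c : adm h1 -> adm h2 ->
  {ae cara mu1, forall z, h1 z - h2 z = c} ->
  {ae cara mu2, forall y, A h1 y - A h2 y = c}.
Proof.
move=> a1 a2 h12; have ac := admissible_cst X1 m1 sg c p0.
have e1 : {ae cara mu2, forall y, A h1 y = A (fun z => 1 * cst c z + h2 z) y}.
  apply: (Aae a1 (admissible_lin m1 1 p0 ac a2)).
  by apply: ae_mono h12 => z /= <-; rewrite mul1r subrK.
have := ae_and e1 (ae_and (Alin 1 ac a2) (Acst c)).
by apply: ae_mono => y [-> [-> ->]]; rewrite mul1r addrK.
Qed.

Lemma componentwise_const f g : besov mu1 X1 s1 p%:E q f ->
  besov mu1 X1 s1 p%:E q g -> ae_const mu1 (f \- g) ->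
  ae_const mu2 (componentwise A f \- componentwise A g).
Proof.
move=> /besov_admissible[fr fi] /besov_admissible[gr gi] [c fg].
have er : {ae cara mu1, forall z, complex.Re (f z) - complex.Re (g z) = complex.Re c}.
  by apply: ae_mono fg => z /(_ Logic.I) /= <-; case: (f z) (g z) => ? ? [].
have ei : {ae cara mu1, forall z, complex.Im (f z) - complex.Im (g z) = complex.Im c}.
  by apply: ae_mono fg => z /(_ Logic.I) /= <-; case: (f z) (g z) => ? ? [].
exists c; have := ae_and (componentwise_shift fr gr er) (componentwise_shift fi gi ei).
apply: ae_mono => y [e1 e2] _ /=; apply/eqP; rewrite eq_complex /=.
by rewrite -e1 -e2 !eqxx.
Qed.

Lemma componentwise_bounded_linear :
  bounded_linear_besov mu1 X1 s1 mu2 X2 s2 p%:E q (componentwise A).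
Proof.
have [D [d [D0 d0 HD]]] := componentwise_dom.
have [K K0 HK] := besov_norm_dom X1 X2 Q10 r1 Q20 r2 p0 q0 D0 d0 (etrans sg1 (esym sg2)).
have HB f : besov mu1 X1 s1 p%:E q f ->
    (besov_norm mu2 X2 s2 p%:E q (componentwise A f) <=
     K%:E * besov_norm mu1 X1 s1 p%:E q f)%E.
  by move=> Bf; apply: HK; rewrite sg1 sg2; exact: HD.
split.
- move=> f Bf; have [fr fi] := besov_admissible Bf; split.
    by apply/L1loc_parts; split; exact: Aloc.
  apply: le_lt_trans (HB f Bf) _; rewrite lte_mul_pinfty//.
  by case: Bf.
- move=> f g Bf Bg fg; have := componentwise_ae Bf Bg (ae_mono (fun z h => h Logic.I) fg).
  by apply: ae_mono => y e _.
- exact: componentwise_const.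
- by move=> a f g Bf Bg; apply: ae_mono (componentwise_lin a Bf Bg) => y e _.
- by exists K.
Qed.

End componentwise_operators.

(** * The restriction operator *)

Section trace_operator.
Context {R : realType} {T T' : pmetricType R}.
Context (mu : {outer_measure set T -> \bar R}) (Q C : R).
Context (nu : {outer_measure set T' -> \bar R}) (lam C' : R).
Context (io : T' -> T).
Hypotheses (Q0 : 0 < Q) (rmu : regular mu Q C) (mmu : metric_measure_space mu).
Hypotheses (lam0 : 0 < lam) (rnu : regular nu lam C') (mnu : metric_measure_space nu).
Hypothesis io_isom : forall x y, mdist (io x) (io y) = mdist x y.
Context (X : hyperbolic_filling T) (Y : hyperbolic_filling T').
Context (g : int -> T' -> T) (sel : selector nu io X g).
Context (p sg : R).
Hypotheses (p0 : 0 < p) (psg : 0 < lam * Num.min p 1 + sg).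
Implicit Types h : T -> R.

Let adm h := admissible mu X sg p h.

Definition rtrace h : T' -> R := ltrace (fun v => rmean mu (vball v) h) g.

Lemma admissible_tail_fin h K c : adm h -> 1 <= K -> forall i y,
  (tail_mean nu lam io X (rgrad mu h) K c i y < +oo)%E.
Proof.
move=> [_ [S HS]] K1; exact: (tail_mean_fin Q0 rmu lam0 rnu io_isom c p0 psg K1 (rgrad_ge0 mu h) HS).
Qed.

(** The tail from level -k on is integrable over a ball of radius 2^k, so finite almost everywhere
    there. Countably many such balls exhaust F; the starting level depends on the ball, which
    convergence does not see. *)
Lemma tail_step_fin_ae h : adm h -> {ae cara nu, forall w,
  exists m : int, (tail_step io X (rgrad mu h) m w < +oo)%E}.
Proof.
move=> ah; suff H (k : nat) : {ae cara nu, forall w, ball point (rad (- k%:Z)) w ->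
    (tail_step io X (rgrad mu h) (- k%:Z)%R w < +oo)%E}.
  have := ae_foralln H; apply: ae_mono => w Hw.
  have d0 : 0 < mdist point w + 1 by rewrite ltr_wpDl// mdist_ge0.
  have [k /andP[_ wk]] := rad_approx d0.
  exists (- (`|k - 1|%N)%:Z); apply: Hw; apply/ballP.
  apply: (@lt_le_trans _ _ (mdist point w + 1)); first by rewrite ltrDl.
  apply: (le_trans (ltW wk)).
  have -> : 2 * rad k = rad (k - 1) :> R by rewrite (radB k 1) expr1.
  by apply: le_rad; lia.
have ge0 := rgrad_ge0 mu h.
have mt : measurable_fun (ball point (rad (- k%:Z)) : set (caratheodory_type nu))
    (tail_step io X (rgrad mu h) (- k%:Z)%R : caratheodory_type nu -> \bar R).
  exact: measurable_tail_step Q0 rmu rnu io_isom _ _ _ _ ge0.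
have it : (cara nu).-integrable (ball point (rad (- k%:Z)))
    (tail_step io X (rgrad mu h) (- k%:Z)%R).
  apply/integrableP; split => //.
  under eq_integral do rewrite gee0_abs ?tail_step_ge0//.
  have rl0 : 0 < rad (- k%:Z) `^ lam :> R by rewrite powR_gt0// rad_gt0.
  have := admissible_tail_fin 0 ah (lexx 1) (- k%:Z) point.
  rewrite /tail_mean mul1r subr0 => /(lte_mul_pinfty _ _).
  move=> /(_ (rad (- k%:Z) `^ lam)%:E); rewrite muleA -EFinM mulfV ?gt_eqF// mul1e.
  by apply; rewrite ?lee_fin ?(ltW rl0).
have mb : measurable (ball point (rad (- k%:Z)) : set (caratheodory_type nu)).
  by apply: measurable_ball; case: rnu.
apply: ae_mono (integrable_ae mb it) => w H /H; rewrite ge0_fin_numE//.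
exact: tail_step_ge0.
Qed.

Lemma rtrace_cvg h : adm h -> {ae cara nu, forall w,
  rmean mu (vball (n%:Z, g n%:Z w)) h @[n --> \oo] --> rtrace h w}.
Proof.
move=> ah; apply: ae_mono (tail_step_fin_ae ah) => w [m mw].
by apply: (ltrace_cvg (a := rgrad mu h) _ _ sel mw) => e; rewrite ?rgrad_ge0.
Qed.

Lemma rtrace_dist h n w :
  (`|rtrace h w - rmean mu (vball (n, g n w)) h|%:E <=
   tail_step io X (rgrad mu h) n w)%E.
Proof.
by apply: (ltrace_dist (u := fun v => rmean mu (vball v) h) (a := rgrad mu h) _ _ sel) => e;
  rewrite ?rgrad_ge0.
Qed.

Lemma measurable_rtrace h : measurable_fun [set: caratheodory_type nu] (rtrace h).
Proof. exact: measurable_ltrace sel. Qed.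

Lemma rtrace_loc h : adm h -> loc nu (rtrace h).
Proof.
move=> ah; apply: (trace_loc Q0 rmu rnu mnu io_isom sel (u := fun v => rmean mu (vball v) h)
  (a := rgrad mu h)) => //.
- by move=> e; exact: rgrad_ge0.
- exact: measurable_rtrace.
- by move=> n; apply: aeW => w; exact: rtrace_dist.
- exact: admissible_tail_fin.
Qed.

Lemma eq_rtrace h1 h2 : adm h1 -> adm h2 -> {ae cara mu, forall z, h1 z = h2 z} ->
  rtrace h1 = rtrace h2.
Proof.
move=> [[mh1 _] _] [[mh2 _] _] h12; rewrite /rtrace.
suff -> : (fun v => rmean mu (vball v) h1) = (fun v => rmean mu (vball v) h2) by [].
apply/funext => v; apply: eq_rmean => //.
- exact: measurable_vball.
- exact: measurable_funTS.
- exact: measurable_funTS.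
Qed.

Lemma rtrace_cst c y : rtrace (cst c) y = c.
Proof.
apply: cvg_Lim; rewrite (_ : (fun n => _) = cst c); first exact: cvg_cst.
by apply/funext => n; rewrite rmean_cst//; [exact: measurable_vball|exact: vball_pos_fin].
Qed.

Lemma rtrace_lin c h1 h2 : adm h1 -> adm h2 -> {ae cara nu, forall y,
  rtrace (fun z => c * h1 z + h2 z) y = c * rtrace h1 y + rtrace h2 y}.
Proof.
move=> a1 a2; apply: ae_mono (ae_and (rtrace_cvg a1) (rtrace_cvg a2)) => y [e1 e2].
apply: cvg_Lim.
rewrite (_ : (fun n => _) = (fun n : nat => c * rmean mu (vball (n%:Z, g n%:Z y)) h1 +
   rmean mu (vball (n%:Z, g n%:Z y)) h2)); first exact: (cvgD (cvgM (cvg_cst c) e1) e2).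
apply/funext => n; rewrite rmeanD//; first exact: measurable_vball.
- exact: loc_integrable a1.1.
- exact: loc_integrable a2.1.
Qed.

Lemma rtrace_dom : exists D d : R, [/\ 0 < D, 0 < d & forall h, adm h ->
  dom D d (alpha sg p Y (rgrad nu (rtrace h))) (alpha sg p X (rgrad mu h))].
Proof.
have [D D0 HD] := edges_scattered lam0 rnu.
have K1 : 1 <= 3 :> R by rewrite ler1n.
have [M [t [M0 t0 HM]]] := tail_mean_dom Q0 rmu rnu io_isom 3 p0 psg K1 D0.
pose B := 4 * C' * 2 `^ lam; have B0 : 0 < B.
  by rewrite !mulr_gt0 ?powR_gt0//; case: rnu => /(lt_le_trans ltr01).
exists (B `^ p * M), t; split => //; first by rewrite mulr_gt0// powR_gt0.
move=> h ah k; have ge0 := rgrad_ge0 mu h.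
have step : (alpha sg p Y (rgrad nu (rtrace h)) k <= (B `^ p)%:E *
    ((2 `^ (k%:~R * sg))%:E * \esum_(e in edges_at Y k)
      tail_mean nu lam io X (rgrad mu h) 3 3 k e.1.2 `^ p))%E.
  rewrite /alpha muleCA; apply: lee_wpmul2l; first by rewrite lee_fin powR_ge0.
  rewrite -esumZl ?powR_ge0//; last by move=> *; exact: poweR_ge0.
  apply: le_esum => e Ee; rewrite -poweR_EFin -poweRM ?tail_mean_ge0 ?lee_fin ?(ltW B0)//.
  apply: gt0_ler_poweR; rewrite ?in_itv/= ?leey ?andbT ?(ltW p0) ?rgrad_ge0//.
    by rewrite mule_ge0 ?tail_mean_ge0 ?lee_fin ?(ltW B0).
  apply: (trace_grad Q0 rmu lam0 rnu mnu io_isom sel (u := fun v => rmean mu (vball v) h) _ _ _ _ _ Ee) => //.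
  - exact: measurable_rtrace.
  - by move=> n; apply: aeW => w; exact: rtrace_dist.
  - exact: rtrace_loc.
apply: (le_trans step); rewrite EFinM -muleA; apply: lee_wpmul2l.
  by rewrite lee_fin powR_ge0.
exact: HM ge0 (HD Y k).
Qed.

Lemma rmean_cvg_continuous h w : loc mu h -> {for io w, continuous h} ->
  rmean mu (vball (n%:Z, g n%:Z w)) h @[n --> \oo] --> h (io w).
Proof.
move=> lh ch; apply/cvgrPdist_le => e e0.
have [d /= d0 Hd] : exists2 d : R, 0 < d & forall z, mdist (io w) z < d ->
    `|h (io w) - h z| <= e.
  move/cvgrPdist_le : ch => /(_ e e0)/nbhs_ballP[d /= d0 Hd].
  by exists d => // z wz; apply: Hd; apply/ballP.
have d20 : 0 < d / 2 by rewrite divr_gt0.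
have [l /andP[Hl _]] := rad_approx d20.
exists `|l|%N => // n /= ln.
have rn : rad n%:Z <= d / 2 by apply: le_trans Hl; apply: le_rad; lia.
set v := (n%:Z, g n%:Z w) : vertex T.
have mv := measurable_vball mmu v; have vpf := vball_pos_fin mmu v.
have /fineK vE : mu (vball v) \is a fin_num.
  by have /andP[v0 voo] := vpf; rewrite ge0_fin_numE// ltW.
have v0 : 0 < fine (mu (vball v)) by rewrite -lte_fin vE; have /andP[] := vpf.
rewrite distrC -lee_fin.
apply: (le_trans (rmean_dist (h (io w)) mv vpf (loc_integrable v lh))).
apply: (@le_trans _ _ ((fine (mu (vball v)))^-1%:E * \int[cara mu]_(z in vball v) e%:E)%E).
  apply: lee_wpmul2l; first by rewrite lee_fin invr_ge0 ltW.
  apply: le_integral_ge0 => z; first by rewrite lee_fin.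
  rewrite vballE => /ballP vz; rewrite lee_fin distrC; apply: Hd.
  have [_ /(_ w) gw _] := sel n%:Z.
  have := metric_triangle (io w) (g n%:Z w) z; rewrite (metric_sym (io w) (g n%:Z w)).
  by move: vz; rewrite /= => vz; have := @rad_gt0 R n%:Z; lra.
by rewrite integral_cst// /cara/= -vE -!EFinM lee_fin mulrCA mulVf ?mulr1//= gt_eqF.
Qed.

Lemma rtrace_continuous h w : loc mu h -> {for io w, continuous h} ->
  rtrace h w = h (io w).
Proof. by move=> lh ch; apply: cvg_Lim; exact: rmean_cvg_continuous. Qed.

End trace_operator.

(** * The extension operator *)

Section weighted_means.
Context d {S : measurableType d} {R : realType} (m : {measure set S -> \bar R}).
Context (B : set S).
Hypotheses (mB : measurable B) (Boo : (m B < +oo)%E).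
Implicit Types (k h : S -> R) (rho a : R).

Definition wmean k h : R := (\int[m]_(w in B) k w)^-1 * \int[m]_(w in B) (k w * h w).

Let inte h := m.-integrable B (EFin \o h).

Lemma bounded_mul_integrable k h rho : measurable_fun B k ->
  (forall w, B w -> `|k w| <= rho) -> inte h -> inte (fun w => k w * h w).
Proof.
move=> mk krho ih.
have mh : measurable_fun B h by apply/measurable_EFinP; exact: measurable_int ih.
have := integrableZl mB rho ih.
apply: le_integrable => //; first by apply/measurable_EFinP; exact: measurable_funM.
move=> w Bw /=; rewrite lee_fin !normrM ler_wpM2r//.
by apply: le_trans (krho w Bw) _; exact: ler_norm.
Qed.

Lemma cst_integrable a : inte (cst a).
Proof.
apply: measurable_bounded_integrable => //.
by exists `|a|; split => // M /ltW aM w _.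
Qed.

Lemma bounded_integrable k rho : measurable_fun B k ->
  (forall w, B w -> `|k w| <= rho) -> inte k.
Proof.
move=> mk krho; have := bounded_mul_integrable mk krho (cst_integrable 1).
by apply: eq_integrable => // w _; rewrite /= mulr1.
Qed.

Lemma shift_integrable h a : inte h -> inte (fun w => h w - a).
Proof.
by move=> ih; have := integrableB mB ih (cst_integrable a); apply: eq_integrable.
Qed.

Lemma norm_bound_Rintegral k h rho : measurable_fun B k -> inte h ->
  (forall w, B w -> `|k w| <= rho) ->
  `|\int[m]_(w in B) (k w * h w)| <= rho * \int[m]_(w in B) `|h w|.
Proof.
move=> mk ih krho; have ikh := bounded_mul_integrable mk krho ih.
apply: le_trans (le_normr_Rintegral mB ikh) _.
have inh : inte (fun w => `|h w|) by exact: integrable_norm.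
rewrite -RintegralZl//; apply: le_Rintegral => //.
- exact: integrable_norm.
- by have := integrableZl mB rho inh; apply: eq_integrable.
- by move=> w Bw; rewrite normrM ler_wpM2r// krho.
Qed.

Lemma wmean_shift k h rho a : measurable_fun B k -> inte h ->
  (forall w, B w -> `|k w| <= rho) -> 0 < \int[m]_(w in B) k w ->
  wmean k h - a = (\int[m]_(w in B) k w)^-1 * \int[m]_(w in B) (k w * (h w - a)).
Proof.
move=> mk ih krho m0; have ik := bounded_integrable mk krho.
have -> : \int[m]_(w in B) (k w * (h w - a)) =
    \int[m]_(w in B) (k w * h w) - a * \int[m]_(w in B) k w.
  rewrite -RintegralZl// -RintegralB//.
  - by apply: eq_Rintegral => w _; rewrite mulrBr (mulrC a).
  - exact: bounded_mul_integrable krho ih.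
  - by have := integrableZl mB a ik; apply: eq_integrable.
by rewrite mulrBr mulrCA mulVf ?mulr1// gt_eqF.
Qed.

Lemma wmean_lin k h1 h2 rho c : measurable_fun B k -> inte h1 -> inte h2 ->
  (forall w, B w -> `|k w| <= rho) ->
  wmean k (fun w => c * h1 w + h2 w) = c * wmean k h1 + wmean k h2.
Proof.
move=> mk i1 i2 krho.
have ik1 := bounded_mul_integrable mk krho i1.
have ik2 := bounded_mul_integrable mk krho i2.
rewrite /wmean (_ : \int[m]_(w in B) (k w * (c * h1 w + h2 w)) =
  c * \int[m]_(w in B) (k w * h1 w) + \int[m]_(w in B) (k w * h2 w)).
  by rewrite mulrDr mulrCA.
rewrite -RintegralZl// -RintegralD//.
- by apply: eq_Rintegral => w _; rewrite mulrDr mulrCA.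
- by have := integrableZl mB c ik1; apply: eq_integrable.
Qed.

Lemma wmean_cst h rho : inte h -> rho != 0 ->
  wmean (cst rho) h = (fine (m B))^-1 * \int[m]_(w in B) h w.
Proof.
move=> ih r0; rewrite /wmean Rintegral_cst// RintegralZl// invfM mulrCA.
by rewrite -!mulrA mulVKf// mulrC.
Qed.

Lemma wmean_dist k h rho a : measurable_fun B k -> inte h ->
  (forall w, B w -> `|k w| <= rho) -> 0 < \int[m]_(w in B) k w ->
  `|wmean k h - a| <= (\int[m]_(w in B) k w)^-1 * rho * \int[m]_(w in B) `|h w - a|.
Proof.
move=> mk ih krho m0; rewrite (wmean_shift _ mk ih krho m0) normrM.
rewrite ger0_norm ?invr_ge0 ?(ltW m0)// -mulrA ler_wpM2l ?invr_ge0 ?(ltW m0)//.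
apply: norm_bound_Rintegral => //; exact: shift_integrable.
Qed.

(** Subtracting [a] turns both numerators into integrals of h - a. One error comes from the change
    of the numerator, the other from the change of the total weight; both are controlled by the sup
    bound [L] on the change of the kernel. *)
Lemma wmean_diff k k' h rho rho' L a : measurable_fun B k -> measurable_fun B k' ->
  inte h -> (forall w, B w -> `|k w| <= rho) -> (forall w, B w -> `|k' w| <= rho') ->
  (forall w, B w -> `|k w - k' w| <= L) ->
  0 < \int[m]_(w in B) k w -> 0 < \int[m]_(w in B) k' w ->
  `|wmean k h - wmean k' h| <= (\int[m]_(w in B) k w)^-1 * L *
    (1 + (\int[m]_(w in B) k' w)^-1 * rho' * fine (m B)) * \int[m]_(w in B) `|h w - a|.
Proof.
move=> mk mk' ih krho krho' kL m0 m0'.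
have iha := shift_integrable a ih.
have ik := bounded_integrable mk krho; have ik' := bounded_integrable mk' krho'.
have := wmean_shift a mk ih krho m0; have := wmean_shift a mk' ih krho' m0'.
have mkk : measurable_fun B (fun w => k w - k' w) by exact: measurable_funB.
have HN := norm_bound_Rintegral mkk iha kL.
have HN' := norm_bound_Rintegral mk' iha krho'.
have HM : `|\int[m]_(w in B) k w - \int[m]_(w in B) k' w| <= L * fine (m B).
  rewrite -RintegralB//; apply: le_trans (le_normr_Rintegral mB _) _.
    by have := integrableB mB ik ik'; apply: eq_integrable.
  rewrite -Rintegral_cst//; apply: le_Rintegral => //.
  - apply: integrable_norm; by have := integrableB mB ik ik'; apply: eq_integrable.
  - exact: cst_integrable.
have EN : \int[m]_(w in B) ((k w - k' w) * (h w - a)) =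
    \int[m]_(w in B) (k w * (h w - a)) - \int[m]_(w in B) (k' w * (h w - a)).
  rewrite -RintegralB//.
  - by apply: eq_Rintegral => w _; rewrite mulrBl.
  - exact: bounded_mul_integrable krho iha.
  - exact: bounded_mul_integrable krho' iha.
rewrite EN in HN; have I0 : 0 <= \int[m]_(w in B) `|h w - a| by exact: Rintegral_ge0.
move: m0 m0' HN HN' HM I0.
move: (\int[m]_(w in B) (k w * (h w - a))) (\int[m]_(w in B) (k' w * (h w - a))).
move: (\int[m]_(w in B) k w) (\int[m]_(w in B) k' w) (\int[m]_(w in B) `|h w - a|).
move: (wmean k h) (wmean k' h) (fine (m B)) => x x' V M M' I N N' M0 M0' HN HN' HM I0 e' e.
(* N/M - N'/M' is rewritten so that each term contains one of the differences N - N' and M - M'. *)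
have -> : x - x' = M^-1 * (N - N') - (M^-1 * (M'^-1 * N')) * (M - M').
  have -> : x - x' = (x - a) - (x' - a) by ring.
  by rewrite e e'; field; rewrite !gt_eqF.
apply: (le_trans (ler_normB _ _)).
rewrite !normrM !normfV (gtr0_norm M0) (gtr0_norm M0').
have -> : M^-1 * L * (1 + M'^-1 * rho' * V) * I =
  M^-1 * (L * I) + (M^-1 * (M'^-1 * (rho' * I))) * (L * V) by ring.
have iM : 0 <= M^-1 by rewrite invr_ge0 ltW.
have iM' : 0 <= M'^-1 by rewrite invr_ge0 ltW.
apply: lerD; first exact: ler_wpM2l.
apply: ler_pM => //; first by rewrite !mulr_ge0.
by apply: ler_wpM2l => //; apply: ler_wpM2l.
Qed.

End weighted_means.

(** * Averages against tents *)

Section extension_kernel.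
Context {R : realType} {T T' : pmetricType R}.
Context (nu : {outer_measure set T' -> \bar R}) (lam C' : R).
Context (io : T' -> T).
Hypotheses (lam0 : 0 < lam) (rnu : regular nu lam C') (mnu : metric_measure_space nu).
Hypothesis io_isom : forall x y, mdist (io x) (io y) = mdist x y.
Implicit Types (z : T) (rho : R) (w y : T') (h : T' -> R).

Let brnu : borel_regular nu. Proof. by case: rnu. Qed.
Let io0 : range io !=set0. Proof. by exists (io point); exists point. Qed.

Definition idist z : R := setdist (range io) z.

Lemma idist_ge0 z : 0 <= idist z. Proof. exact: setdist_ge0. Qed.

Lemma idist_le z w : idist z <= mdist z (io w).
Proof. by apply: setdist_le; exists w. Qed.

Lemma idist_lt z rho : idist z < rho -> exists w, mdist z (io w) < rho.
Proof. by move=> /(setdist_lt io0)[_ [w _ <-] zw]; exists w. Qed.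

Lemma idist_dist z z' : `|idist z - idist z'| <= mdist z z'.
Proof. exact: setdist_dist. Qed.

(* Equal to [rho] at distance at most [2 rho] from [z], and to [0] at distance
   at least [3 rho]. *)
Definition tent z rho w : R := Num.min rho (Num.max 0 (3 * rho - mdist z (io w))).

Lemma tent_ge0 z rho w : 0 <= rho -> 0 <= tent z rho w.
Proof. by move=> r0; rewrite /tent le_min r0 le_max lexx. Qed.

Lemma tent_le z rho w : tent z rho w <= rho.
Proof. by rewrite /tent ge_min lexx. Qed.

Lemma tent_norm z rho w : 0 <= rho -> `|tent z rho w| <= rho.
Proof. by move=> r0; rewrite ger0_norm ?tent_ge0// tent_le. Qed.

Lemma tent_full z rho w : mdist z (io w) <= 2 * rho -> tent z rho w = rho.
Proof.
move=> zw; rewrite /tent min_l// le_max; apply/orP; right; lra.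
Qed.

Lemma tent_out z rho w : 0 <= rho -> 3 * rho <= mdist z (io w) -> tent z rho w = 0.
Proof. by move=> r0 zw; rewrite /tent max_l ?min_r//; lra. Qed.

Lemma minmax_lip (a b x y L : R) : `|a - b| <= L -> `|x - y| <= L ->
  `|Num.min a (Num.max 0 x) - Num.min b (Num.max 0 y)| <= L.
Proof.
rewrite !ler_norml /Num.min /Num.max => /andP[a1 a2] /andP[x1 x2].
by case: (ltP 0 x) => c1; case: (ltP 0 y) => c2; case: ltP => c3; case: ltP => c4; lra.
Qed.

(** The reason for tents: the weights have size about rho, so a displacement of the centre or the
    radius changes them by a relative amount of the displacement over rho. *)
Lemma tent_lip z z' rho rho' w :
  `|tent z rho w - tent z' rho' w| <= 3 * (mdist z z' + `|rho - rho'|).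
Proof.
have d0 := mdist_ge0 z z'; have a0 := normr_ge0 (rho - rho').
apply: minmax_lip; first by lra.
have := metric_triangle z z' (io w); have := metric_triangle z' z (io w).
rewrite (metric_sym z' z) => h1 h2.
have := ler_norm (rho - rho'); have := ler_norm (- (rho - rho')); rewrite normrN => h3 h4.
by rewrite ler_norml; lra.
Qed.

Lemma measurable_tent z rho : measurable_fun [set: caratheodory_type nu] (tent z rho).
Proof.
apply: (lip_measurable brnu); exists 1 => // x y; rewrite mul1r.
apply: minmax_lip; first by rewrite subrr normr0 mdist_ge0.
have := metric_triangle z (io x) (io y); have := metric_triangle z (io y) (io x).
rewrite !io_isom (metric_sym y x) ler_norml; lra.
Qed.

Definition tent_mean h z rho : R :=
  (\int[cara nu]_w tent z rho w)^-1 * \int[cara nu]_w (tent z rho w * h w).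

Lemma tent_meanE (B : set T') h z rho : 0 <= rho ->
  (forall w, mdist z (io w) < 3 * rho -> B w) ->
  tent_mean h z rho = wmean (cara nu) B (tent z rho) h.
Proof.
move=> r0 zB; have out w : ~ B w -> tent z rho w = 0.
  move=> nB; apply: tent_out => //; rewrite leNgt; apply/negP => /zB; exact: nB.
have restr (f : T' -> R) : (forall w, ~ B w -> f w = 0) ->
    \int[cara nu]_w f w = \int[cara nu]_(w in B) f w.
  move=> f0; rewrite [RHS]Rintegral_mkcond; apply: eq_Rintegral => w _.
  rewrite patchE; case: ifPn => // /negP nB; apply: f0 => Bw; apply: nB; exact: mem_set.
rewrite /tent_mean /wmean (restr (tent z rho))//; congr (_ * _).
by apply: restr => w /out ->; rewrite mul0r.
Qed.

(** Some point [y] of T' lies within 3/2 rho of [z], because [idist z <= rho]; the ball of radius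
    rho/2 about it stays within 2 rho of [z], where the tent has its full height. *)
Lemma mass_ge (B : set (caratheodory_type nu)) z rho : measurable B -> (nu B < +oo)%E ->
  0 < rho -> idist z <= rho ->
  (forall w, mdist z (io w) < 3 * rho -> B w) ->
  exists y, rho * fine (nu (ball y (rho / 2))) <= \int[cara nu]_(w in B) tent z rho w.
Proof.
move=> mB Boo r0 zr zB.
have [y zy] : exists y, mdist z (io y) < 3 / 2 * rho by apply: idist_lt; lra.
exists y; have near w : ball y (rho / 2) w -> mdist z (io w) < 2 * rho.
  move=> /ballP yw; have := metric_triangle z (io y) (io w); rewrite io_isom; lra.
have yB : ball y (rho / 2) `<=` B by move=> w /near zw; apply: zB; lra.
have r20 : 0 < rho / 2 by rewrite divr_gt0.
have /andP[b0 boo] := ball_pos_fin y mnu r20.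
have mb : measurable (ball y (rho / 2) : set (caratheodory_type nu)) by exact: measurable_ball.
have mk (D : set (caratheodory_type nu)) : measurable_fun D (tent z rho).
  by apply: measurable_funTS; exact: measurable_tent.
have ik : (cara nu).-integrable B (EFin \o tent z rho).
  apply: (bounded_integrable mB Boo (mk B)) => w _; exact: tent_norm (ltW r0).
rewrite -lee_fin /Rintegral fineK; last exact: integrable_fin_num.
rewrite EFinM fineK; last by rewrite ge0_fin_numE// ltW.
have -> : (rho%:E * nu (ball y (rho / 2)) =
    \int[cara nu]_(w in ball y (rho / 2)) (tent z rho w)%:E)%E.
  rewrite -(integral_cst (cara nu) mb); apply: eq_integral => w /set_mem/near zw.
  by rewrite tent_full// ltW.
apply: ge0_subset_integral => //; first exact/measurable_EFinP.
by move=> w _; rewrite lee_fin tent_ge0// ltW.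
Qed.

Lemma mass_gt0 (B : set (caratheodory_type nu)) z rho : measurable B -> (nu B < +oo)%E ->
  0 < rho -> idist z <= rho ->
  (forall w, mdist z (io w) < 3 * rho -> B w) ->
  0 < \int[cara nu]_(w in B) tent z rho w.
Proof.
move=> mB Boo r0 zr zB; have [y] := mass_ge mB Boo r0 zr zB; apply: lt_le_trans.
have r20 : 0 < rho / 2 by rewrite divr_gt0.
have /andP[b0 boo] := ball_pos_fin y mnu r20.
by rewrite mulr_gt0// -lte_fin fineK// ge0_fin_numE// ltW.
Qed.

Lemma mass_regular (B : set (caratheodory_type nu)) z rho : measurable B -> (nu B < +oo)%E ->
  0 < rho -> idist z <= rho ->
  (forall w, mdist z (io w) < 3 * rho -> B w) ->
  (exists w w', rho / 32 < mdist w w') ->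
  rho * (C'^-1 * (rho / 2) `^ lam) <= \int[cara nu]_(w in B) tent z rho w.
Proof.
move=> mB Boo r0 zr zB [w [w' ww]]; have [y] := mass_ge mB Boo r0 zr zB; apply: le_trans.
rewrite ler_wpM2l ?(ltW r0)//; have r20 : 0 < rho / 2 by rewrite divr_gt0.
have /andP[b0 boo] := ball_pos_fin y mnu r20.
rewrite -lee_fin fineK; last by rewrite ge0_fin_numE// ltW.
by case: rnu => _ _ _; apply => //; exists w, w'; apply: le_lt_trans ww; lra.
Qed.

(* A ball of [T'] containing the supports of the kernels at scale [2^-i]
   centered near [io y]. *)
Let B i y : set (caratheodory_type nu) := ball y (40 * rad i).

Let B_fin i y : measurable (B i y) /\ (0 < nu (B i y) < +oo)%E.
Proof.
by split; [exact: measurable_ball|apply: ball_pos_fin => //; rewrite mulr_gt0 ?rad_gt0].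
Qed.

(** The support has radius at most 3 * 8 rad i, and 24 + 13 < 40. The 13 is 10, for the distance to
    a net point, plus 3, for the distance between two centres. *)
Let B_sub i y z rho : mdist z (io y) < 13 * rad i -> rho <= 8 * rad i ->
  forall w, mdist z (io w) < 3 * rho -> B i y w.
Proof.
move=> zy r w zw; apply/ballP.
have := metric_triangle (io y) z (io w); rewrite io_isom (metric_sym (io y) z).
by have := @rad_gt0 R i; lra.
Qed.

Let B_int h i y : loc nu h -> (cara nu).-integrable (B i y) (EFin \o h).
Proof. by move=> [_]; apply; rewrite mulr_gt0 ?rad_gt0. Qed.

Let mtent z rho (D : set (caratheodory_type nu)) : measurable_fun D (tent z rho).
Proof. by apply: measurable_funTS; exact: measurable_tent. Qed.

Lemma tent_mean_cst z rho c : 0 < rho -> idist z <= rho -> tent_mean (cst c) z rho = c.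
Proof.
move=> r0 zr; have zl : idist z < 2 * rho by lra.
have [y zy] := idist_lt zl.
have [i /andP[ri ri2]] := rad_approx r0.
have zy' : mdist z (io y) < 13 * rad i by lra.
have rr : rho <= 8 * rad i by have := @rad_gt0 R i; lra.
have [mB /andP[_ Boo]] := B_fin i y.
rewrite (tent_meanE (cst c) (ltW r0) (B_sub zy' rr)) /wmean.
have m0 := mass_gt0 mB Boo r0 zr (B_sub zy' rr).
have ik := bounded_integrable mB Boo (@mtent z rho _) (fun w _ => tent_norm z w (ltW r0)).
rewrite (_ : \int[cara nu]_(w in B i y) (tent z rho w * cst c w) =
   c * \int[cara nu]_(w in B i y) tent z rho w); last first.
  by rewrite -RintegralZl//; apply: eq_Rintegral => w _; rewrite mulrC.
by rewrite mulrCA mulVf ?mulr1// gt_eqF.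
Qed.

Lemma tent_mean_lin h1 h2 z rho c : loc nu h1 -> loc nu h2 -> 0 < rho ->
  tent_mean (fun w => c * h1 w + h2 w) z rho = c * tent_mean h1 z rho + tent_mean h2 z rho.
Proof.
move=> l1 l2 r0; have [y zy] : exists y, mdist z (io y) < idist z + rho.
  by apply: idist_lt; rewrite ltrDl.
have r10 : 0 < idist z + 10 * rho by rewrite ltr_wpDl ?idist_ge0// mulr_gt0.
have [mb /andP[_ boo]] : measurable (ball y (idist z + 10 * rho) : set (caratheodory_type nu)) /\
    (0 < nu (ball y (idist z + 10 * rho)) < +oo)%E.
  by split; [exact: measurable_ball|exact: ball_pos_fin].
have sub w : mdist z (io w) < 3 * rho -> ball y (idist z + 10 * rho) w.
  move=> zw; apply/ballP; have := metric_triangle (io y) z (io w).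
  by rewrite io_isom (metric_sym (io y) z); have := idist_ge0 z; lra.
rewrite !(tent_meanE _ (ltW r0) sub).
apply: (wmean_lin mb c (@mtent _ _ _) (l1.2 _ _ r10) (l2.2 _ _ r10)) => w _.
exact: tent_norm (ltW r0).
Qed.

Lemma eq_tent_mean h1 h2 z rho : loc nu h1 -> loc nu h2 ->
  {ae cara nu, forall w, h1 w = h2 w} -> tent_mean h1 z rho = tent_mean h2 z rho.
Proof.
move=> [m1 _] [m2 _] h12; rewrite /tent_mean /Rintegral; congr (_ * fine _).
apply: ae_eq_integral => //.
- by apply/measurable_EFinP; apply: measurable_funM => //; exact: mtent.
- by apply/measurable_EFinP; apply: measurable_funM => //; exact: mtent.
- by apply: ae_mono h12 => w /= -> _.
Qed.

Let mass_rad : exists2 c : R, 0 < c & forall i y z rho,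
  rad i / 4 <= rho -> rho <= 8 * rad i -> idist z <= rho ->
  mdist z (io y) < 13 * rad i -> (exists w w', rad i / 4 < mdist w w') ->
  c * (rad i * rad i `^ lam) <= \int[cara nu]_(w in B i y) tent z rho w.
Proof.
have C0 : 0 < C' by case: rnu => /(lt_le_trans ltr01).
exists (4^-1 * C'^-1 * (8^-1 `^ lam)); first by rewrite !mulr_gt0 ?invr_gt0 ?powR_gt0.
move=> i y z rho r1 r2 zr zy [w [w' ww]]; have ri0 := @rad_gt0 R i.
have r0 : 0 < rho by apply: lt_le_trans r1; rewrite divr_gt0.
have [mB /andP[_ Boo]] := B_fin i y.
(* The mass is bounded below on a ball of radius rho/2 <= 4 rad i, one sixteenth of which is at most
   [rad i / 4]: the factor in [regular] is just large enough. *)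
have big : exists w w', rho / 32 < mdist w w' by exists w, w'; lra.
apply: le_trans (mass_regular mB Boo r0 zr (B_sub zy r2) big).
apply: (@le_trans _ _ ((rad i / 4) * (C'^-1 * (8^-1 * rad i) `^ lam))).
  rewrite powRM ?(ltW ri0)// le_eqVlt; apply/orP; left; apply/eqP.
  by move: (_ `^ _) (_ `^ _) (_^-1) => x1 x2 x3; ring.
apply: ler_pM => //; first by rewrite divr_ge0// ltW.
  by rewrite mulr_ge0 ?powR_ge0// invr_ge0 ltW.
apply: ler_wpM2l; first by rewrite invr_ge0 ltW.
apply: ge0_ler_powR; rewrite ?nnegrE ?(ltW lam0)//; lra.
Qed.

Let B_le i y : fine (nu (B i y)) <= C' * 40 `^ lam * rad i `^ lam.
Proof.
have [mB /andP[B0 Boo]] := B_fin i y.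
rewrite -lee_fin fineK; last by rewrite ge0_fin_numE// ltW.
rewrite -mulrA -powRM ?rad_ge0//; case: rnu => _ _ + _; apply.
by rewrite mulr_gt0 ?rad_gt0.
Qed.

Let Rint_EFin h i y a : loc nu h ->
  (\int[cara nu]_(w in B i y) `|h w - a|)%:E = (\int[cara nu]_(w in B i y) `|h w - a|%:E)%E.
Proof.
move=> lh; have [mB /andP[_ Boo]] := B_fin i y.
rewrite /Rintegral fineK//; apply: integrable_fin_num => //.
by apply: integrable_norm; exact: (shift_integrable mB Boo a (B_int _ _ lh)).
Qed.

Lemma tent_mean_dist : exists2 M : R, 0 < M & forall h i y z a, loc nu h ->
  idist z <= rad i -> mdist z (io y) < 13 * rad i ->
  (exists w w', rad i / 4 < mdist w w') ->
  (`|tent_mean h z (rad i) - a|%:E <= M%:E * ((rad i `^ lam)^-1%:E *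
     \int[cara nu]_(w in ball y (40 * rad i)) `|h w - a|%:E))%E.
Proof.
have [c c0 Hc] := mass_rad; exists c^-1; first by rewrite invr_gt0.
move=> h i y z a lh zi zy big; rewrite -Rint_EFin// -!EFinM lee_fin.
have [mB /andP[_ Boo]] := B_fin i y; have ri0 := @rad_gt0 R i.
have r1 : rad i / 4 <= rad i :> R by lra.
have r2 : rad i <= 8 * rad i :> R by lra.
have rl0 : 0 < rad i `^ lam :> R by rewrite powR_gt0.
rewrite (tent_meanE h (ltW ri0) (B_sub zy r2)).
have m0 := mass_gt0 mB Boo ri0 zi (B_sub zy r2).
have Hm := Hc i y z _ r1 r2 zi zy big.
apply: le_trans (wmean_dist mB Boo a (@mtent _ _ _) (B_int _ _ lh)
  (fun w _ => tent_norm z w (ltW ri0)) m0) _.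
rewrite [leRHS]mulrA; apply: ler_wpM2r; first exact: Rintegral_ge0.
have cr : 0 < c * (rad i * rad i `^ lam) by rewrite !mulr_gt0.
apply: (@le_trans _ _ ((c * (rad i * rad i `^ lam))^-1 * rad i)).
  by apply: ler_wpM2r; [exact: ltW|rewrite lef_pV2].
have fieldE (x1 x2 x3 : R) : x1 != 0 -> x2 != 0 -> x3 != 0 ->
    (x1 * (x2 * x3))^-1 * x2 = x1^-1 / x3 by move=> ? ? ?; field; apply/and3P; split.
by rewrite fieldE// gt_eqF.
Qed.

Lemma tent_large z rho w : idist z <= rho -> (forall w w', mdist w w' <= rho) ->
  tent z rho w = rho.
Proof.
move=> zr small; apply: tent_full; rewrite leNgt; apply/negP => zw.
have [y zy] : exists y, mdist z (io y) < mdist z (io w) - rho by apply: idist_lt; lra.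
have := metric_triangle z (io y) (io w); rewrite io_isom; have := small y w; lra.
Qed.

(** The weights change by at most three times the displacement, while the masses are bounded below
    by a multiple of rad i times rad i^lam; after division the displacement is measured in units of
    [rad i]. *)
Lemma tent_mean_diff : exists2 M : R, 0 < M & forall h i y z z' rho rho' a, loc nu h ->
  rad i / 4 <= rho -> rho <= 8 * rad i -> rad i / 4 <= rho' -> rho' <= 8 * rad i ->
  idist z <= rho -> idist z' <= rho' -> mdist z z' <= 3 * rad i ->
  mdist z (io y) < 10 * rad i ->
  (`|tent_mean h z rho - tent_mean h z' rho'|%:E <=
    (M * ((mdist z z' + `|rho - rho'|) / rad i))%:E * ((rad i `^ lam)^-1%:E *
     \int[cara nu]_(w in ball y (40 * rad i)) `|h w - a|%:E))%E.
Proof.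
have [c c0 Hc] := mass_rad.
have C0 : 0 < C' by case: rnu => /(lt_le_trans ltr01).
pose K := c^-1 * 8 * (C' * 40 `^ lam).
have K0 : 0 < K by rewrite /K !mulr_gt0 ?invr_gt0 ?powR_gt0.
exists (3 * c^-1 * (1 + K)); first by rewrite !mulr_gt0 ?invr_gt0 ?addr_gt0.
move=> h i y z z' rho rho' a lh r1 r2 r1' r2' zr zr' zz zy.
rewrite -Rint_EFin// -!EFinM lee_fin.
have [mB /andP[_ Boo]] := B_fin i y; have ri0 := @rad_gt0 R i.
have rl0 : 0 < rad i `^ lam :> R by rewrite powR_gt0.
have zy' : mdist z (io y) < 13 * rad i by lra.
have z'y : mdist z' (io y) < 13 * rad i.
  by have := metric_triangle z' z (io y); rewrite (metric_sym z' z); lra.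
have r0 : 0 < rho by apply: lt_le_trans r1; rewrite divr_gt0.
have r0' : 0 < rho' by apply: lt_le_trans r1'; rewrite divr_gt0.
have I0 : 0 <= \int[cara nu]_(w in B i y) `|h w - a| by exact: Rintegral_ge0.
have d0 : 0 <= mdist z z' + `|rho - rho'| by rewrite addr_ge0 ?mdist_ge0.
rewrite (tent_meanE h (ltW r0) (B_sub zy' r2)) (tent_meanE h (ltW r0') (B_sub z'y r2')).
have [[w [w' ww]]|small] := pselect (exists w w', Num.min rho rho' < mdist w w').
  have big : exists w w', rad i / 4 < mdist w w'.
    by exists w, w'; apply: le_lt_trans ww; rewrite le_min r1 r1'.
  have m0 := mass_gt0 mB Boo r0 zr (B_sub zy' r2).
  have m0' := mass_gt0 mB Boo r0' zr' (B_sub z'y r2').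
  have Hm := Hc i y z _ r1 r2 zr zy' big; have Hm' := Hc i y z' _ r1' r2' zr' z'y big.
  apply: le_trans (wmean_diff mB Boo a (@mtent _ _ _) (@mtent _ _ _) (B_int _ _ lh)
    (fun w _ => tent_norm z w (ltW r0)) (fun w _ => tent_norm z' w (ltW r0'))
    (fun w _ => tent_lip z z' rho rho' w) m0 m0') _.
  have HV := B_le i y.
  rewrite mulrA; apply: ler_wpM2r => //.
  have cr : 0 < c * (rad i * rad i `^ lam) by rewrite !mulr_gt0.
  have im : (\int[cara nu]_(w in B i y) tent z rho w)^-1 <= (c * (rad i * rad i `^ lam))^-1.
    by rewrite lef_pV2.
  have im' : (\int[cara nu]_(w in B i y) tent z' rho' w)^-1 <= (c * (rad i * rad i `^ lam))^-1.
    by rewrite lef_pV2.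
  have HK : (\int[cara nu]_(w in B i y) tent z' rho' w)^-1 * rho' * fine (nu (B i y)) <= K.
    have -> : K = (c * (rad i * rad i `^ lam))^-1 * (8 * rad i) * (C' * 40 `^ lam * rad i `^ lam).
      by rewrite /K; move: (40 `^ lam) => x; field; rewrite !gt_eqF.
    apply: ler_pM => //.
    - by rewrite mulr_ge0 ?invr_ge0 ?(ltW m0') ?(ltW r0').
    - by rewrite fine_ge0.
    - by apply: ler_pM => //; [rewrite invr_ge0 (ltW m0')|exact: ltW].
  have -> : 3 * c^-1 * (1 + K) * ((mdist z z' + `|rho - rho'|) / rad i) * (rad i `^ lam)^-1 =
      (c * (rad i * rad i `^ lam))^-1 * (3 * (mdist z z' + `|rho - rho'|)) * (1 + K).
    have fieldE (x1 x2 x3 x4 x5 : R) : x1 != 0 -> x2 != 0 -> x3 != 0 ->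
        3 * x1^-1 * (1 + x4) * (x5 / x2) / x3 = (x1 * (x2 * x3))^-1 * (3 * x5) * (1 + x4).
      by move=> ? ? ?; field; apply/and3P; split.
    by rewrite fieldE// gt_eqF.
  apply: ler_pM.
  - by rewrite !mulr_ge0 ?invr_ge0 ?(ltW m0).
  - by rewrite addr_ge0// !mulr_ge0 ?invr_ge0 ?(ltW m0') ?(ltW r0') ?fine_ge0.
  - by apply: ler_wpM2r => //; rewrite mulr_ge0.
  - by rewrite lerD2l.
(* If [T'] has diameter at most [rho] and [rho'], both averages are the mean of
   [h] over [T']. *)
have sm w w' : mdist w w' <= Num.min rho rho'.
  by rewrite leNgt; apply/negP => ww; apply: small; exists w, w'.
have kE : tent z rho = cst rho.
  apply/funext => w; apply: tent_large => // x x'.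
  by apply: le_trans (sm x x') _; rewrite ge_min lexx.
have kE' : tent z' rho' = cst rho'.
  apply/funext => w; apply: tent_large => // x x'.
  by apply: le_trans (sm x x') _; rewrite ge_min lexx orbT.
rewrite kE kE' !(wmean_cst mB (B_int _ _ lh)) ?gt_eqF// subrr normr0.
apply: mulr_ge0; last by rewrite mulr_ge0// invr_ge0 (ltW rl0).
apply: mulr_ge0; last by rewrite divr_ge0// (ltW ri0).
apply: mulr_ge0; first by rewrite divr_ge0// (ltW c0).
by rewrite addr_ge0// (ltW K0).
Qed.

End extension_kernel.

Lemma rad_lt_double (R : realType) (i k : int) : rad k < 2 * rad i :> R -> i <= k.
Proof.
rewrite leNgt => rki; apply/negP => ki.
have : rad (i - 1) <= rad k :> R by apply: le_rad; lia.
by rewrite (radB i 1) expr1 leNgt rki.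
Qed.

(** * Variation of the tent averages in the centre and the radius *)

Section extension_operator.
Context {R : realType} {T T' : pmetricType R}.
Context (mu : {outer_measure set T -> \bar R}) (Q C : R).
Context (nu : {outer_measure set T' -> \bar R}) (lam C' : R).
Context (io : T' -> T).
Hypotheses (Q0 : 0 < Q) (rmu : regular mu Q C) (mmu : metric_measure_space mu).
Hypotheses (lam0 : 0 < lam) (rnu : regular nu lam C') (mnu : metric_measure_space nu).
Hypothesis io_isom : forall x y, mdist (io x) (io y) = mdist x y.
Context (X : hyperbolic_filling T) (Y : hyperbolic_filling T').
Context (g : int -> T' -> T') (sel : selector nu id Y g).
Context (p sg : R).
Hypotheses (p0 : 0 < p) (psg : 0 < lam * Num.min p 1 + sg).
Hypotheses (Qsg : 0 < Q * Num.min p 1 + sg) (sgp : sg + Q < p).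
Implicit Types h : T' -> R.

Let brmu : borel_regular mu. Proof. by case: rmu. Qed.
Let adm h := admissible nu Y sg p h.

(** A majorant for the oscillation of [h] on the ball of radius [40 * rad i] which contains the
    supports of the tents. The shift 7 is the least for which [40 * rad i] is at most
    [rad (i - 7) / 2], that is, [64 * rad i]. *)
Definition osc h i y : \bar R := tail_mean nu lam id Y (rgrad nu h) 40 7 i y.

Lemma osc_ge0 h i y : (0 <= osc h i y)%E.
Proof. by apply: tail_mean_ge0 => e; exact: rgrad_ge0. Qed.

Definition osc_center h (i : int) y : R :=
  rmean nu (vball ((i - 7)%R, g (i - 7) y)) h.

(** [trace_integral] with [h] in the role of its own trace and the identity as isometry; Lebesgue
    differentiation, through [mean_osc], supplies the hypothesis. *)
Lemma osc_bound h i y : loc nu h ->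
  ((rad i `^ lam)^-1%:E *
     \int[cara nu]_(w in ball y (40 * rad i)) `|h w - osc_center h i y|%:E <=
   2%:E * osc h i y)%E.
Proof.
move=> lh; rewrite /osc /tail_mean muleCA; apply: lee_wpmul2l.
  by rewrite lee_fin invr_ge0 powR_ge0.
have ge0 := rgrad_ge0 nu h.
apply: (trace_integral lam0 rnu rnu (fun x y => erefl) sel
  (u := fun v => rmean nu (vball v) h) (a := rgrad nu h)) => //.
- exact: lh.1.
- by move=> n; apply: (mean_osc lam0 rnu mnu sel lh (a := rgrad nu h)) => // e _; exact: lexx.
- rewrite (radB i 7); have := @rad_gt0 R i; rewrite !exprS expr0; lra.
Qed.

(* Eventually constant in [n] at the points at positive distance from [io]. *)
Definition discext h (n : int) z : R := tent_mean nu io h z (Num.max (idist io z) (rad n)).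

(** Carries the oscillations on F at scale 2^-j to the points of T at distance less than
    [10 * rad j] from the net of F, as a step function with bounded overlap. *)
Definition hull h (j : int) z : \bar R :=
  (\esum_(y in net Y j) (osc h j y * (\1_(ball (io y) (10 * rad j)) z : R)%:E))%E.

Lemma hull_ge0 h j z : (0 <= hull h j z)%E.
Proof. by apply: esum_ge0 => y _; rewrite mule_ge0// osc_ge0. Qed.

Lemma osc_le_hull h j y z : net Y j y -> mdist z (io y) < 10 * rad j ->
  (osc h j y <= hull h j z)%E.
Proof.
move=> Ny zy; have := @esum_ge_term _ _ (net Y j)
  (fun y => osc h j y * (\1_(ball (io y) (10 * rad j)) z : R)%:E)%E y Ny.
by rewrite indicE mem_set ?mule1//; apply/ballP; rewrite metric_sym.
Qed.

Lemma net_close (i : int) z : idist io z <= 9 * rad i ->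
  exists2 y, net Y i y & mdist z (io y) < 10 * rad i.
Proof.
move=> zi; have ri := @rad_gt0 R i.
have [w zw] : exists w, mdist z (io w) < (9 + 2^-1) * rad i.
  by apply: idist_lt; apply: le_lt_trans zi _; rewrite ltr_pM2r//; lra.
have [y Ny yw] := net_near Y i w; exists y => //.
have := metric_triangle z (io w) (io y); rewrite io_isom (metric_sym w y).
by lra.
Qed.

(** The scale [i] is that of the averaging radius at [z0], which is coarser than [k] when [z0] is
    far from F; this gives the gain. [i] and [y] do not depend on [h], [a] or [z], so the bound also
    shows local Lipschitz continuity. *)
Lemma discext_local : exists2 M : R, 0 < M & forall (k : int) z0,
  exists (i : int) (y : T'), [/\ i <= k, net Y i y, mdist z0 (io y) < 10 * rad i &
    forall h a z, loc nu h -> mdist z0 z < 3 * rad k ->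
    (`|discext h k z - discext h k z0|%:E <=
     (M * (mdist z0 z / rad i))%:E * ((rad i `^ lam)^-1%:E *
     \int[cara nu]_(w in ball y (40 * rad i)) `|h w - a|%:E))%E].
Proof.
have [M M0 HM] := tent_mean_diff lam0 rnu mnu io_isom; exists (M * 2); first exact: mulr_gt0.
move=> k z0; pose rho0 := Num.max (idist io z0) (rad k).
have rk0 : rad k <= rho0 by rewrite /rho0 le_max lexx orbT.
have zr0 : idist io z0 <= rho0 by rewrite /rho0 le_max lexx.
have rho00 : 0 < rho0 by apply: lt_le_trans rk0; exact: rad_gt0.
have [i /andP[ri ri2]] := rad_approx rho00.
have ik : i <= k by apply: rad_lt_double; apply: le_lt_trans ri2.
have [y Ny zy] : exists2 y, net Y i y & mdist z0 (io y) < 10 * rad i.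
  apply: net_close; have := @rad_gt0 R i; lra.
exists i, y; split => // h a z lh z0z; rewrite distrC.
pose rho := Num.max (idist io z) (rad k).
have rk : rad k <= rho by rewrite /rho le_max lexx orbT.
have zr : idist io z <= rho by rewrite /rho le_max lexx.
have rki : rad k <= rad i :> R by exact: le_rad.
have := idist_dist io z0 z; rewrite ler_norml => /andP[d1 d2].
have rr : `|rho0 - rho| <= mdist z0 z.
  have d0 := mdist_ge0 z0 z.
  rewrite ler_norml /rho0 /rho /Num.max; case: (ltP (idist io z0)) => c1;
    case: (ltP (idist io z)) => c2; lra.
have rk0' := @rad_gt0 R k.
(* Both radii are at least [rad k] and differ by less than [3 * rad k], so each is at most four
   times the other. With rad i <= rho0 < 2 rad i this gives the range from rad i / 4 to 8 rad i. *)
have r4 : rho0 <= 4 * rho.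
  by move: rr; rewrite ler_norml => /andP[]; lra.
have r4' : rho <= 4 * rho0.
  by move: rr; rewrite ler_norml => /andP[]; lra.
have z3 : mdist z0 z <= 3 * rad i by lra.
have := HM h i y z0 z rho0 rho a lh _ _ _ _ zr0 zr z3 zy.
move=> /(_ _ _ _ _)/le_trans; apply; [by lra|by lra|by lra|by lra|].
apply: lee_wpmul2r.
  rewrite mule_ge0// ?lee_fin ?invr_ge0 ?powR_ge0//.
  by apply: integral_ge0 => w _; rewrite lee_fin.
rewrite lee_fin -mulrA ler_wpM2l ?(ltW M0)// mulrA ler_wpM2r ?invr_ge0 ?rad_ge0//.
lra.
Qed.

(** At distance at least [rad n] from F the averaging radius no longer changes. Closer to F, a net
    point of level [n] is near enough for [hull] to see its oscillation. *)
Lemma discext_step : exists2 M : R, 0 < M & forall h n z, loc nu h ->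
  (`|discext h (n + 1) z - discext h n z|%:E <= M%:E * hull h n z)%E.
Proof.
have [M M0 HM] := tent_mean_diff lam0 rnu mnu io_isom; exists (M * 2); first exact: mulr_gt0.
move=> h n z lh; have rn := @rad_gt0 R n.
have rn1 : rad (n + 1) = rad n / 2 :> R by exact: rad_half.
have [zn|zn] := leP (rad n) (idist io z).
  rewrite /discext !max_l//; last by rewrite rn1; lra.
  by rewrite subrr normr0 mule_ge0 ?hull_ge0// lee_fin mulr_ge0// ltW.
have [y Ny zy] : exists2 y, net Y n y & mdist z (io y) < 10 * rad n by apply: net_close; lra.
rewrite /discext (max_r (ltW zn)).
pose rho := Num.max (idist io z) (rad (n + 1)); rewrite -/rho.
have r1 : rad n / 2 <= rho by rewrite /rho le_max rn1 lexx orbT.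
have r2 : rho <= rad n by rewrite /rho ge_max (ltW zn) rn1; lra.
have zr : idist io z <= rho by rewrite /rho le_max lexx.
have zz : mdist z z <= 3 * rad n by rewrite mdistxx mulr_ge0// ltW.
have := HM h n y z z rho (rad n) (osc_center h n y) lh _ _ _ _ zr (ltW zn) zz zy.
move=> /(_ _ _ _ _)/le_trans; apply; [by lra|by lra|by lra|by lra|].
apply: (@le_trans _ _ (M%:E * (2%:E * osc h n y))%E); last first.
  rewrite muleA -EFinM; apply: lee_wpmul2l; last exact: osc_le_hull.
  by rewrite lee_fin mulr_ge0// ltW.
apply: (@le_trans _ _ (M%:E * ((rad n `^ lam)^-1%:E *
     \int[cara nu]_(w in ball y (40 * rad n)) `|h w - osc_center h n y|%:E))%E).
  apply: lee_wpmul2r.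
    rewrite mule_ge0// ?lee_fin ?invr_ge0 ?powR_ge0//.
    by apply: integral_ge0 => w _; rewrite lee_fin.
  rewrite lee_fin ler_piMr ?(ltW M0)// mdistxx add0r ler_pdivrMr// mul1r.
  by rewrite ler_norml; lra.
apply: lee_wpmul2l; [by rewrite lee_fin ltW|exact: osc_bound].
Qed.

Definition coarse h (k : int) z : \bar R :=
  (\esum_(i in [set i : int | (i <= k)%R]) ((rad k / rad i)%:E * hull h i z))%E.

Lemma coarse_ge0 h k z : (0 <= coarse h k z)%E.
Proof.
by apply: esum_ge0 => i _; rewrite mule_ge0 ?hull_ge0// lee_fin divr_ge0 ?rad_ge0.
Qed.

Lemma discext_osc : exists2 M : R, 0 < M & forall h k z z0, loc nu h ->
  mdist z0 z < 3 * rad k ->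
  (`|discext h k z - discext h k z0|%:E <= M%:E * coarse h k z0)%E.
Proof.
have [M M0 HM] := discext_local; exists (M * 3 * 2); first by rewrite !mulr_gt0.
move=> h k z z0 lh z0z; have [i [y [ik Ny zy]]] := HM k z0.
move=> /(_ h (osc_center h i y) z lh z0z)/le_trans; apply.
have ri := @rad_gt0 R i; have rk := @rad_gt0 R k.
have c1 : ((rad k / rad i)%:E * hull h i z0 <= coarse h k z0)%E.
  exact: (@esum_ge_term _ _ [set i : int | i <= k]
    (fun i => (rad k / rad i)%:E * hull h i z0)%E i ik).
apply: (@le_trans _ _ ((M * (3 * (rad k / rad i)))%:E * (2%:E * hull h i z0))%E).
  apply: (@le_trans _ _ ((M * (3 * (rad k / rad i)))%:E * ((rad i `^ lam)^-1%:E *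
     \int[cara nu]_(w in ball y (40 * rad i)) `|h w - osc_center h i y|%:E))%E).
    apply: lee_wpmul2r.
      rewrite mule_ge0// ?lee_fin ?invr_ge0 ?powR_ge0//.
      by apply: integral_ge0 => w _; rewrite lee_fin.
    by rewrite lee_fin ler_wpM2l ?(ltW M0)// mulrA ler_wpM2r ?invr_ge0 ?(ltW ri)// ltW.
  apply: lee_wpmul2l.
    by rewrite lee_fin mulr_ge0 ?(ltW M0)// mulr_ge0// divr_ge0 ?rad_ge0.
  apply: le_trans (osc_bound _ _ lh) _; apply: lee_wpmul2l => //.
  exact: osc_le_hull.
apply: (@le_trans _ _ ((M * 3 * 2)%:E * ((rad k / rad i)%:E * hull h i z0))%E); last first.
  by apply: lee_wpmul2l; rewrite ?lee_fin ?mulr_ge0 ?(ltW M0).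
rewrite !muleA -!EFinM; apply: lee_wpmul2r; first exact: hull_ge0.
by rewrite lee_fin le_eqVlt; apply/orP; left; apply/eqP; ring.
Qed.

(** [discext_local] with a = 0 makes the function locally Lipschitz, so its superlevel sets are
    open. *)
Lemma measurable_discext h n : loc nu h ->
  measurable_fun [set: caratheodory_type mu] (discext h n).
Proof.
move=> lh; apply: open_measurable_fun => // c; rewrite openE => z0 /= cz; apply/nbhs_ballP.
have [M M0 HM] := discext_local; have [i [y [ni Ny zy Hz]]] := HM n z0.
have ri := @rad_gt0 R i; have rn := @rad_gt0 R n.
have r40 : 0 < 40 * rad i :> R by rewrite mulr_gt0.
have mb : measurable (ball y (40 * rad i) : set (caratheodory_type nu)).
  by apply: measurable_ball; case: rnu.
have [A A0 AE] : exists2 A : R, 0 <= A & ((rad i `^ lam)^-1%:E *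
     \int[cara nu]_(w in ball y (40 * rad i)) `|h w - 0|%:E = A%:E)%E.
  exists ((rad i `^ lam)^-1 * \int[cara nu]_(w in ball y (40 * rad i)) `|h w - 0|).
    by rewrite mulr_ge0 ?invr_ge0 ?powR_ge0// Rintegral_ge0.
  rewrite EFinM /Rintegral fineK//; apply: integrable_fin_num => //.
  apply: integrable_norm; have := lh.2 y _ r40.
  by apply: eq_integrable => // w _; rewrite /= subr0.
pose B := M / rad i * A + 1.
have B0 : 0 < B by rewrite ltr_wpDl// mulr_ge0// divr_ge0// ltW.
exists (Num.min (3 * rad n) ((discext h n z0 - c) / B)).
  by rewrite /= lt_min mulr_gt0//= divr_gt0 ?subr_gt0.
move=> z /ballP; rewrite lt_min => /andP[z3 zB] /=.
have := Hz h 0 z lh z3; rewrite AE -EFinM lee_fin => H.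
have {H} : `|discext h n z - discext h n z0| <= B * mdist z0 z.
  apply: (le_trans H); have -> : M * (mdist z0 z / rad i) * A = (M / rad i * A) * mdist z0 z.
    by ring.
  by rewrite ler_wpM2r ?mdist_ge0// lerDl.
have : B * mdist z0 z < discext h n z0 - c by rewrite mulrC -ltr_pdivlMr.
by rewrite ler_norml => h1 /andP[]; lra.
Qed.

End extension_operator.

(** * Sums of oscillations over scales *)

Section extension_norm.
Context {R : realType} {T T' : pmetricType R}.
Context (mu : {outer_measure set T -> \bar R}) (Q C : R).
Context (nu : {outer_measure set T' -> \bar R}) (lam C' : R).
Context (io : T' -> T).
Hypotheses (Q0 : 0 < Q) (rmu : regular mu Q C) (mmu : metric_measure_space mu).
Hypotheses (lam0 : 0 < lam) (rnu : regular nu lam C') (mnu : metric_measure_space nu).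
Hypothesis io_isom : forall x y, mdist (io x) (io y) = mdist x y.
Context (Y : hyperbolic_filling T').
Context (p sg : R).
Hypotheses (p0 : 0 < p) (psg : 0 < lam * Num.min p 1 + sg).
Hypotheses (Qsg : 0 < Q * Num.min p 1 + sg) (sgp : sg + Q < p).
Implicit Types h : T' -> R.

Let brmu : borel_regular mu. Proof. by case: rmu. Qed.
Local Notation osc := (osc nu lam Y).
Local Notation hull := (hull nu lam io Y).
Local Notation coarse := (coarse nu lam io Y).

Lemma hull_overlap : exists2 N : R, 1 <= N & forall j z,
  (\esum_(y in net Y j) (\1_(ball (io y) (10 * rad j)) z : R)%:E <= N%:E)%E.
Proof.
have [D D0 HD] := net_scattered lam0 rnu.
exists (1 + D * 20 `^ lam); first by rewrite lerDl mulr_ge0 ?powR_ge0// ltW.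
move=> j z; have D200 : 0 <= D * 20 `^ lam by rewrite mulr_ge0 ?powR_ge0// ltW.
have [[y0 [Ny0 /ballP y0z]]|none] := pselect (exists y, net Y j y /\ ball (io y) (10 * rad j) z).
  apply: (@le_trans _ _ (D * 20 `^ lam)%:E); last by rewrite lee_fin lerDr.
  have := HD Y j y0 20; rewrite ler1n => /(_ isT); apply: le_trans.
  apply: le_esum => y Ny; rewrite lee_fin !indicE.
  have [/ballP yz|nyz] := pselect (ball (io y) (10 * rad j) z).
    rewrite [y \in _]mem_set; first by case: (z \in _).
    apply/ballP; have := metric_triangle (io y0) z (io y).
    by rewrite io_isom (metric_sym z (io y)); lra.
  by rewrite memNset.
rewrite esum1 => [|y Ny]; first by rewrite lee_fin addr_ge0.
by rewrite indicE memNset// => yz; apply: none; exists y.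
Qed.

Let mball x r : measurable (ball x r : set (caratheodory_type mu)).
Proof. exact: measurable_ball. Qed.

Let cnet j : countable (net Y j).
Proof. exact: net_countable lam0 rnu Y j. Qed.

Lemma measurable_hull h j (D : set (caratheodory_type mu)) :
  measurable_fun D (hull h j : caratheodory_type mu -> \bar R).
Proof.
apply: measurable_fun_esum; first exact: cnet.
  by move=> y; apply: measurable_funeM; apply/measurable_EFinP; exact: measurable_indic.
by move=> y z; rewrite mule_ge0// osc_ge0.
Qed.

Definition finer h (k : int) z : \bar R :=
  (\esum_(j in [set j : int | (k <= j)%R]) hull h j z)%E.

Lemma finer_ge0 h k z : (0 <= finer h k z)%E.
Proof. by apply: esum_ge0 => j _; exact: hull_ge0. Qed.

Lemma measurable_finer h k (D : set (caratheodory_type mu)) :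
  measurable_fun D (finer h k : caratheodory_type mu -> \bar R).
Proof.
apply: measurable_fun_esum; first exact: countableP.
- by move=> j; exact: measurable_hull.
- by move=> j z; exact: hull_ge0.
Qed.

Definition local_avg h (k : int) z0 : \bar R :=
  ((rad k `^ Q)^-1%:E * \int[cara mu]_(z in ball z0 (3 * rad k)) finer h k z)%E.

Lemma local_avg_ge0 h k z0 : (0 <= local_avg h k z0)%E.
Proof.
rewrite mule_ge0 ?lee_fin ?invr_ge0 ?powR_ge0//.
by apply: integral_ge0 => z _; exact: finer_ge0.
Qed.

(** A majorant for the mean oscillation of the extension on the ball of radius [3 * rad k], which
    contains the edge balls starting at [z0]. Scales up to k are evaluated at the centre; scales
    from k on vary inside the ball and are averaged. *)
Definition spread h k z0 : \bar R := (coarse h k z0 + local_avg h k z0)%E.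

Lemma spread_ge0 h k z0 : (0 <= spread h k z0)%E.
Proof. by rewrite adde_ge0// ?coarse_ge0// local_avg_ge0. Qed.

Definition osc_sum h (j : int) : \bar R :=
  ((2 `^ (j%:~R * sg))%:E * \esum_(y in net Y j) osc h j y `^ p)%E.

Lemma osc_sum_ge0 h j : (0 <= osc_sum h j)%E.
Proof.
rewrite mule_ge0 ?lee_fin ?powR_ge0//.
by apply: esum_ge0 => y _; exact: poweR_ge0.
Qed.

Lemma local_avg_dom (D : R) : 0 < D -> exists M t : R, [/\ 0 < M, 0 < t &
  forall h k (I : choiceType) (E : set I) (ce : I -> T), scattered E ce (rad k) D Q ->
  ((2 `^ (k%:~R * sg))%:E * (\esum_(e in E) local_avg h k (ce e) `^ p) <=
   M%:E * \esum_(j in [set: int]) ((wt t j k)%:E * osc_sum h j))%E].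
Proof.
move=> D0; have [N N1 HN] := hull_overlap.
have A1 : 1 <= 21 :> R by rewrite ler1n.
have [M [t [M0 t0 HM]]] := step_tail_dom rmu 0 p0 Qsg A1 N1 D0.
exists M, t; split => // h k I E ce sE.
have := HM k I T' E ce (fun e => ball (ce e) (3 * rad k)) (net Y)
  (fun j y => ball (io y) (10 * rad j)) (osc h) sE.
rewrite subr0 => /(_ _ _ _ _ _ HN); apply.
- by move=> e; exact: mball.
- by move=> e Ee; apply: le_ball; rewrite ler_wpM2r ?rad_ge0//; lra.
- exact: cnet.
- by move=> j y; exact: mball.
- move=> j y x x' Ny /ballP yx /ballP yx'.
  have := metric_triangle x (io y) x'; rewrite (metric_sym x (io y)).
  by have := @rad_gt0 R j; lra.
- by move=> j y; exact: osc_ge0.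
Qed.

(** A ball of radius [10 * rad j] contains at most a multiple of 2^((k - j) Q) of the centres,
    against the factor 2^(- (k - j) p) of level j. Relative to the weights 2^(k sg) the decay is p -
    Q - sg = 2 t, positive because sg + Q < p. *)
Lemma coarse_dom (D : R) : 0 < D -> exists M t : R, [/\ 0 < M, 0 < t &
  forall h k (I : choiceType) (E : set I) (ce : I -> T), scattered E ce (rad k) D Q ->
  ((2 `^ (k%:~R * sg))%:E * (\esum_(e in E) coarse h k (ce e) `^ p) <=
   M%:E * \esum_(j in [set: int]) ((wt t j k)%:E * osc_sum h j))%E].
Proof.
move=> D0; have [N N1 HN] := hull_overlap.
have N0 : 0 < N by apply: lt_le_trans N1.
have [M1 M10 HM1] := overlap_poweR p0 N0.
have pQ : 0 < p - Q - sg by rewrite -addrA -opprD subr_gt0 addrC.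
pose t := (p - Q - sg) / 2; have t0 : 0 < t by rewrite divr_gt0.
have M2 : 0 < M1 * (D * 10 `^ Q) by rewrite !mulr_gt0 ?powR_gt0.
have [M M0 HM] := esum_levels sg p0 t0 M2.
exists M, t; split => // h k I E ce sE.
pose tt (j : int) (e : I) : \bar R :=
  if (j <= k)%R then ((rad k / rad j)%:E * hull h j (ce e))%E else 0%E.
have tt0 j e : (0 <= tt j e)%E.
  rewrite /tt; case: ifP => // _.
  by rewrite mule_ge0 ?hull_ge0// lee_fin divr_ge0 ?rad_ge0.
have cE e : coarse h k (ce e) = (\esum_(j in [set: int]) tt j e)%E.
  rewrite /coarse esum_mkcond; apply: eq_esum => j _; rewrite /tt.
  have -> // : (j \in [set i : int | i <= k]) = (j <= k) by apply/idP/idP; rewrite inE.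
have -> : (\esum_(e in E) coarse h k (ce e) `^ p =
    \esum_(e in E) (\esum_(j in [set: int]) tt j e) `^ p)%E.
  by apply: eq_esum => e _; rewrite cE.
have S0 j : (0 <= \esum_(y in net Y j) osc h j y `^ p)%E.
  by apply: esum_ge0 => y _; exact: poweR_ge0.
apply: (HM k I E tt (fun j => \esum_(y in net Y j) osc h j y `^ p)%E) => // j.
have [jk|jk] := boolP (j <= k)%R; last first.
  rewrite esum1 => [|e _]; last by rewrite /tt (negbTE jk) poweR0r// gt_eqF.
  by rewrite mule_ge0// lee_fin !mulr_ge0 ?powR_ge0 ?wt_ge0// ltW.
have rj0 := @rad_gt0 R j; have rk0 := @rad_gt0 R k.
have rjk : rad k <= rad j :> R by exact: le_rad.
have q0 : 0 <= rad k / rad j :> R by rewrite divr_ge0// ltW.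
have count y : (\esum_(e in E) (\1_(ball (io y) (10 * rad j)) (ce e) : R)%:E <=
    (D * (10 * (rad j / rad k)) `^ Q)%:E)%E.
  have K1 : 1 <= 10 * (rad j / rad k) :> R.
    have : 1 <= rad j / rad k :> R by rewrite ler_pdivlMr// mul1r.
    lra.
  have := sE (io y) _ K1; apply: le_trans; apply: le_esum => e _.
  by rewrite -mulrA divfK// gt_eqF.
apply: (@le_trans _ _ (\esum_(e in E) (((rad k / rad j) `^ p)%:E * (M1%:E *
    \esum_(y in net Y j) (osc h j y `^ p * (\1_(ball (io y) (10 * rad j)) (ce e) : R)%:E))))%E).
  apply: le_esum => e _; rewrite /tt jk poweRM ?hull_ge0 ?lee_fin// poweR_EFin.
  apply: lee_wpmul2l; first by rewrite lee_fin powR_ge0.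
  apply: (HM1 _ _ _ (fun y => ball (io y) (10 * rad j))); last exact: HN.
  by move=> y; exact: osc_ge0.
have P0 y e : (0 <= osc h j y `^ p * (\1_(ball (io y) (10 * rad j)) (ce e) : R)%:E)%E.
  by rewrite mule_ge0// poweR_ge0.
have P1 e : (0 <= \esum_(y in net Y j)
    (osc h j y `^ p * (\1_(ball (io y) (10 * rad j)) (ce e) : R)%:E))%E by exact: esum_ge0.
rewrite esumZl ?powR_ge0//; last by move=> e; rewrite mule_ge0// lee_fin ltW.
rewrite esumZl ?(ltW M10)// esum_exchange//.
apply: (@le_trans _ _ (((rad k / rad j) `^ p)%:E * (M1%:E *
    \esum_(y in net Y j) ((D * (10 * (rad j / rad k)) `^ Q)%:E * osc h j y `^ p)))%E).
  apply: lee_wpmul2l; first by rewrite lee_fin powR_ge0.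
  apply: lee_wpmul2l; first by rewrite lee_fin ltW.
  apply: le_esum => y _; apply: le_trans (esumZl_le _ _ _) _ => //; first exact: poweR_ge0.
  by rewrite muleC; apply: lee_wpmul2r; [exact: poweR_ge0|exact: count].
rewrite esumZl; last 2 first.
- by rewrite mulr_ge0 ?powR_ge0// ltW.
- by move=> y; exact: poweR_ge0.
rewrite !muleA -!EFinM; apply: lee_wpmul2r => //; rewrite lee_fin.
have r1 : (rad k / rad j) `^ p = 2 `^ (- ((k%:~R - j%:~R) * p)) :> R.
  rewrite /rad -powRN -powRD ?pnatr_eq0 ?implybT// -powRrM.
  by congr (powR _ _); ring.
have r2 : (10 * (rad j / rad k)) `^ Q = 10 `^ Q * 2 `^ ((k%:~R - j%:~R) * Q) :> R.
  rewrite powRM//; last by rewrite divr_ge0// ltW.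
  rewrite /rad -powRN -powRD ?pnatr_eq0 ?implybT// -powRrM.
  by congr (_ * powR _ _); ring.
rewrite r1 r2.
have -> : 2 `^ (- ((k%:~R - j%:~R) * p)) * M1 * (D * (10 `^ Q * 2 `^ ((k%:~R - j%:~R) * Q))) =
    M1 * (D * 10 `^ Q) * (2 `^ (- ((k%:~R - j%:~R) * p)) * 2 `^ ((k%:~R - j%:~R) * Q)) :> R.
  by move: (2 `^ _) (2 `^ _) (10 `^ Q) => x1 x2 x3; ring.
rewrite -!mulrA !(ler_pM2l M10) !(ler_pM2l D0) ler_wpM2l ?powR_ge0//.
rewrite /wt -!powRD ?pnatr_eq0 ?implybT// ler_powR ?ler1n//.
have jkR : (j%:~R <= k%:~R :> R) by rewrite ler_int.
rewrite ler0_norm ?subr_le0// /t.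
by rewrite le_eqVlt; apply/orP; left; apply/eqP; field.
Qed.

Lemma spread_dom (D : R) : 0 < D -> exists M t : R, [/\ 0 < M, 0 < t &
  forall h k (I : choiceType) (E : set I) (ce : I -> T), scattered E ce (rad k) D Q ->
  ((2 `^ (k%:~R * sg))%:E * (\esum_(e in E) spread h k (ce e) `^ p) <=
   M%:E * \esum_(j in [set: int]) ((wt t j k)%:E * osc_sum h j))%E].
Proof.
move=> D0; have [M1 [t1 [M10 t10 H1]]] := coarse_dom D0.
have [M2 [t2 [M20 t20 H2]]] := local_avg_dom D0.
exists (2 `^ p * (M1 + M2)), (Num.min t1 t2); split.
- by rewrite mulr_gt0 ?powR_gt0// addr_gt0.
- by rewrite lt_min t10.
move=> h k I E ce sE.
have S0 t : (0 <= \esum_(j in [set: int]) ((wt t j k)%:E * osc_sum h j))%E.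
  by apply: esum_ge0 => j _; rewrite mule_ge0 ?osc_sum_ge0// lee_fin wt_ge0.
apply: (@le_trans _ _ ((2 `^ (k%:~R * sg))%:E * ((2 `^ p)%:E *
    (\esum_(e in E) coarse h k (ce e) `^ p + \esum_(e in E) local_avg h k (ce e) `^ p)))%E).
  apply: lee_wpmul2l; first by rewrite lee_fin powR_ge0.
  rewrite -esumD; [|by move=> *; exact: poweR_ge0|by move=> *; exact: poweR_ge0].
  rewrite -esumZl ?powR_ge0//; last by move=> *; rewrite adde_ge0 ?poweR_ge0.
  by apply: le_esum => e _; apply: poweRD_le => //; [exact: coarse_ge0|exact: local_avg_ge0].
rewrite muleCA EFinM -[leRHS]muleA; apply: lee_wpmul2l; first by rewrite lee_fin powR_ge0.
rewrite ge0_muleDr; last 2 first.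
- by apply: esum_ge0 => *; exact: poweR_ge0.
- by apply: esum_ge0 => *; exact: poweR_ge0.
rewrite EFinD ge0_muleDl ?lee_fin ?(ltW M10) ?(ltW M20)//.
have mono t M : Num.min t1 t2 <= t -> 0 < M ->
    (M%:E * (\esum_(j in [set: int]) ((wt t j k)%:E * osc_sum h j)) <=
     M%:E * \esum_(j in [set: int]) ((wt (Num.min t1 t2) j k)%:E * osc_sum h j))%E.
  move=> tt M0; apply: lee_wpmul2l; first by rewrite lee_fin ltW.
  apply: le_esum => j _; apply: lee_wpmul2r; first exact: osc_sum_ge0.
  by rewrite lee_fin le_wt.
apply: leeD.
- by apply: le_trans (H1 h k I E ce sE) _; apply: mono => //; rewrite ge_min lexx.
- by apply: le_trans (H2 h k I E ce sE) _; apply: mono => //; rewrite ge_min lexx orbT.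
Qed.

(** Two dominations are composed, from edges of F to oscillations on F and from these to [spread] at
    points of T. The centres are left free: edges give the norm bound, net points the traces, a
    single point finiteness. *)
Lemma spread_alpha (D : R) : 0 < D -> exists M t : R, [/\ 0 < M, 0 < t &
  forall h (I : choiceType) (E : int -> set I) (ce : int -> I -> T),
  (forall k, scattered (E k) (ce k) (rad k) D Q) ->
  dom M t (fun k => (2 `^ (k%:~R * sg))%:E * (\esum_(e in E k) spread h k (ce k e) `^ p))%E
    (alpha sg p Y (rgrad nu h))].
Proof.
move=> D0; have [M1 [t1 [M10 t10 H1]]] := spread_dom D0.
have [D' D'0 HD'] := net_scattered lam0 rnu.
have K1 : 1 <= 40 :> R by rewrite ler1n.
have [M2 [t2 [M20 t20 H2]]] := tail_mean_dom lam0 rnu rnu (fun x y => erefl) 7 p0 psg K1 D'0.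
have [M [t [M0 t0 H]]] := dom_trans M20 t20 M10 t10.
exists M, t; split => // h I E ce sE.
apply: (H _ (osc_sum h)).
- by move=> j; exact: alpha_ge0.
- exact: osc_sum_ge0.
- by move=> j; apply: H2; [exact: rgrad_ge0|exact: HD'].
- by move=> k; exact: H1.
Qed.

End extension_norm.

(** * Boundedness of the extension and its restriction to F *)

Section extension_bounded.
Context {R : realType} {T T' : pmetricType R}.
Context (mu : {outer_measure set T -> \bar R}) (Q C : R).
Context (nu : {outer_measure set T' -> \bar R}) (lam C' : R).
Context (io : T' -> T).
Hypotheses (Q0 : 0 < Q) (rmu : regular mu Q C) (mmu : metric_measure_space mu).
Hypotheses (lam0 : 0 < lam) (rnu : regular nu lam C') (mnu : metric_measure_space nu).
Hypothesis io_isom : forall x y, mdist (io x) (io y) = mdist x y.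
Context (X : hyperbolic_filling T) (Y : hyperbolic_filling T').
Context (g : int -> T' -> T') (sel : selector nu id Y g).
Context (p sg : R).
Hypotheses (p0 : 0 < p) (psg : 0 < lam * Num.min p 1 + sg).
Hypotheses (Qsg : 0 < Q * Num.min p 1 + sg) (sgp : sg + Q < p).
Implicit Types h : T' -> R.

Let brmu : borel_regular mu. Proof. by case: rmu. Qed.
Let adm h := admissible nu Y sg p h.
Local Notation hull := (hull nu lam io Y).
Local Notation coarse := (coarse nu lam io Y).
Local Notation finer := (finer nu lam io Y).
Local Notation spread := (spread mu Q nu lam io Y).
Local Notation discext := (discext nu io).

Definition extend h (z : T) : R := Lim (fun n : nat => discext h n%:Z z).

Lemma discext_itail : exists2 M : R, 0 < M & forall h z, loc nu h ->
  exists b : int -> \bar R, [/\ forall n, (0 <= b n)%E,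
    forall n, (`|discext h (n + 1) z - discext h n z|%:E <= b n)%E &
    forall k, itail b k = (M%:E * finer h k z)%E].
Proof.
have [M M0 HM] := discext_step lam0 rnu mnu io_isom sel; exists M => // h z lh.
exists (fun n => M%:E * hull h n z)%E; split.
- by move=> n; rewrite mule_ge0 ?hull_ge0// lee_fin ltW.
- by move=> n; exact: HM.
- by move=> k; rewrite /itail esumZl ?(ltW M0)// => j; exact: hull_ge0.
Qed.

Lemma extend_near : exists2 M : R, 0 < M & forall h k z z0, loc nu h ->
  mdist z0 z < 3 * rad k ->
  (`|extend h z - discext h k z0|%:E <= M%:E * (finer h k z + coarse h k z0))%E.
Proof.
have [M1 M10 H1] := discext_itail.
have [M2 M20 H2] := discext_osc lam0 rnu mnu io_isom sel.
exists (M1 + M2); first exact: addr_gt0.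
move=> h k z z0 lh z0z; have [b [b0 Hb bE]] := H1 h z lh.
have e1 : (`|extend h z - discext h k z|%:E <= M1%:E * finer h k z)%E.
  by rewrite -bE; apply: (@Lim_itail _ (fun n => discext h n z) b b0 Hb).
have f0 := finer_ge0 nu lam io Y h k z; have c0 := coarse_ge0 nu lam io Y h k z0.
have M12 : (0 <= (M1 + M2)%:E)%E by rewrite lee_fin addr_ge0 ?(ltW M10) ?(ltW M20).
apply: (@le_trans _ _ (`|extend h z - discext h k z|%:E +
   `|discext h k z - discext h k z0|%:E)%E).
  by rewrite -EFinD lee_fin ler_distD.
rewrite ge0_muleDr//; apply: leeD.
  by apply: (le_trans e1); apply: lee_wpmul2r => //; rewrite lee_fin lerDl ltW.
apply: (le_trans (H2 h k z z0 lh z0z)); apply: lee_wpmul2r => //.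
by rewrite lee_fin lerDr ltW.
Qed.

Lemma measurable_extend h : loc nu h ->
  measurable_fun [set: caratheodory_type mu] (extend h).
Proof.
move=> lh; apply: (@measurable_Lim _ _ (caratheodory_type mu)) => n.
exact: (measurable_discext rmu lam0 rnu mnu io_isom).
Qed.

Lemma extend_integral : exists2 M : R, 0 < M & forall h k z0, loc nu h ->
  ((rad k `^ Q)^-1%:E * \int[cara mu]_(z in ball z0 (3 * rad k))
    `|extend h z - discext h k z0|%:E <= M%:E * spread h k z0)%E.
Proof.
have [M M0 HM] := extend_near.
have C1 : 1 <= C by case: rmu.
have C0 : 0 < C by apply: lt_le_trans C1.
have Q30 : 0 < 3 `^ Q :> R by rewrite powR_gt0.
have [A A0 AE] : exists2 A : R, 0 < A & A = 1 + C * 3 `^ Q.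
  by exists (1 + C * 3 `^ Q) => //; rewrite addr_gt0// mulr_gt0.
exists (M * A); first by rewrite mulr_gt0.
move=> h k z0 lh; have rQ : 0 < rad k `^ Q :> R by rewrite powR_gt0// rad_gt0.
have f0 z := finer_ge0 nu lam io Y h k z; have c0 := coarse_ge0 nu lam io Y h k z0.
have mb : measurable (ball z0 (3 * rad k) : set (caratheodory_type mu)) by exact: measurable_ball.
have irQ : (0 <= ((rad k `^ Q)^-1)%:E)%E by rewrite lee_fin invr_ge0 (ltW rQ).
apply: (@le_trans _ _ ((rad k `^ Q)^-1%:E * (M%:E *
    (\int[cara mu]_(z in ball z0 (3 * rad k)) finer h k z +
     coarse h k z0 * mu (ball z0 (3 * rad k)))))%E).
  apply: lee_wpmul2l => //.
  have mf : measurable_fun (ball z0 (3 * rad k) : set (caratheodory_type mu))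
      (finer h k : caratheodory_type mu -> \bar R).
    exact: (measurable_finer io rmu lam0 rnu).
  rewrite -(integral_cst (cara mu) mb) -ge0_integralD// -ge0_integralZl//; last 3 first.
  - exact: emeasurable_funD.
  - by move=> z _; rewrite adde_ge0.
  - by rewrite lee_fin ltW.
  apply: le_integral_ge0 => z; first by rewrite lee_fin.
  by move=> /ballP z0z; exact: HM.
rewrite EFinM muleCA -muleA; apply: lee_wpmul2l; first by rewrite lee_fin ltW.
have I0 : (0 <= \int[cara mu]_(z in ball z0 (3 * rad k)) finer h k z)%E by exact: integral_ge0.
have m0 : (0 <= mu (ball z0 (3 * rad k)))%E by exact: outer_measure_ge0.
have la0 := local_avg_ge0 mu Q nu lam io Y h k z0.
rewrite ge0_muleDr//; last by rewrite mule_ge0.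
have -> : spread h k z0 = (local_avg mu Q nu lam io Y h k z0 + coarse h k z0)%E by rewrite addeC.
rewrite [leRHS](ge0_muleDr _ la0 c0); apply: leeD.
  by rewrite -[leLHS]mul1e; apply: lee_wpmul2r => //; rewrite lee_fin AE lerDl mulr_ge0// ltW.
rewrite muleCA muleC; apply: lee_wpmul2r => //.
apply: (@le_trans _ _ (C * 3 `^ Q)%:E); last by rewrite lee_fin AE lerDr.
apply: (@le_trans _ _ ((rad k `^ Q)^-1%:E * (C * (3 * rad k) `^ Q)%:E)%E).
  apply: lee_wpmul2l => //; case: rmu => _ _ + _; apply.
  by rewrite mulr_gt0 ?rad_gt0.
rewrite -EFinM lee_fin powRM ?rad_ge0// mulrA mulrCA -mulrA ler_wpM2l ?(ltW C0)//.
by rewrite mulVf ?mulr1// gt_eqF.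
Qed.

Lemma spread_fin h k z : adm h -> (spread h k z < +oo)%E.
Proof.
move=> [lh [S HS]].
have [M [t [M0 t0 HM]]] := spread_alpha rmu lam0 rnu io_isom Y p0 psg Qsg sgp ltr01.
have [D D0 HD] := dom_sup M0 t0.
have := HD _ _ _ (fun j => alpha_ge0 sg p Y (rgrad nu h) j)
  (HM h unit (fun=> [set tt]) (fun _ _ => z) (fun i => scattered_point z (rad i) (ltW Q0))) HS k.
rewrite esum_set1 ?poweR_ge0// => H.
have : ((2 `^ (k%:~R * sg))%:E * spread h k z `^ p < +oo)%E by apply: le_lt_trans H (ltry _).
rewrite !ltey; apply: contra => /eqP ->.
rewrite poweRyr; last by rewrite gt_eqF.
by apply/eqP; apply: gt0_muley; rewrite lte_fin powR_gt0.
Qed.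

Lemma extend_loc h : adm h -> loc mu (extend h).
Proof.
move=> ah; have lh := ah.1; have [M M0 HM] := extend_integral.
apply: (loc_osc rmu mmu (measurable_extend lh)) => x k; exists (discext h k x).
have mf : measurable_fun (ball x (3 * rad k) : set (caratheodory_type mu))
    (fun z : caratheodory_type mu => `|extend h z - discext h k x|%:E).
  apply/measurable_EFinP; apply: measurableT_comp => //.
  apply: measurable_funB; last exact: measurable_cst.
  by apply: measurable_funTS; exact: measurable_extend.
apply: (@le_lt_trans _ _ (\int[cara mu]_(z in ball x (3 * rad k))
    `|extend h z - discext h k x|%:E)%E).
  apply: ge0_subset_integral => //; [exact: measurable_ball|exact: measurable_ball|].
  by apply: le_ball; have := @rad_ge0 R k; lra.
have rQ : 0 < rad k `^ Q :> R by rewrite powR_gt0// rad_gt0.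
have := HM h k x lh => /le_lt_trans H.
have {}H := H _ (lte_mul_pinfty (ltW (M0 : (0 < M%:E)%E)) isT (spread_fin k x ah)).
rewrite ltey; apply/eqP => ty; move: H; rewrite ty gt0_muley ?ltxx//.
by rewrite lte_fin invr_gt0.
Qed.

Lemma extend_dom : exists D d : R, [/\ 0 < D, 0 < d & forall h, adm h ->
  dom D d (alpha sg p X (rgrad mu (extend h))) (alpha sg p Y (rgrad nu h))].
Proof.
have [D D0 HD] := edges_scattered Q0 rmu.
have [M [t [M0 t0 HM]]] := spread_alpha rmu lam0 rnu io_isom Y p0 psg Qsg sgp D0.
have [A A0 HA] := extend_integral.
have C0 : 0 < C by case: rmu => /(lt_le_trans ltr01).
pose B := 2 * C * 2 `^ Q * A; have B0 : 0 < B by rewrite !mulr_gt0 ?powR_gt0.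
exists (B `^ p * M), t; split => //; first by rewrite mulr_gt0// powR_gt0.
move=> h ah k; have lh := ah.1.
apply: (@le_trans _ _ ((B `^ p)%:E * ((2 `^ (k%:~R * sg))%:E *
    \esum_(e in edges_at X k) spread h k e.1.2 `^ p))%E); last first.
  rewrite EFinM -muleA; apply: lee_wpmul2l; first by rewrite lee_fin powR_ge0.
  exact: (HM h _ (edges_at X) (fun _ e => e.1.2) (HD X) k).
rewrite /alpha muleCA; apply: lee_wpmul2l; first by rewrite lee_fin powR_ge0.
rewrite -esumZl ?powR_ge0//; last by move=> *; exact: poweR_ge0.
apply: le_esum => e Ee; have s0 := spread_ge0 mu Q nu lam io Y h k e.1.2.
rewrite -poweR_EFin -poweRM ?lee_fin ?(ltW B0)//.
apply: gt0_ler_poweR; rewrite ?in_itv/= ?leey ?andbT ?(ltW p0) ?rgrad_ge0//.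
  by rewrite mule_ge0 ?lee_fin ?(ltW B0).
apply: (le_trans (rmean_edge Q0 rmu mmu (discext h k e.1.2) (extend_loc ah) Ee)).
rewrite /B [in leRHS]EFinM -[leRHS]muleA EFinM -[leLHS]muleA; apply: lee_wpmul2l; last exact: HA.
by rewrite lee_fin !mulr_ge0 ?powR_ge0// ltW.
Qed.

Lemma eq_extend h1 h2 : adm h1 -> adm h2 -> {ae cara nu, forall w, h1 w = h2 w} ->
  extend h1 = extend h2.
Proof.
move=> a1 a2 h12; apply/funext => z; rewrite /extend.
suff -> : (fun n : nat => discext h1 n%:Z z) = (fun n : nat => discext h2 n%:Z z) by [].
by apply/funext => n; exact: (eq_tent_mean rnu io_isom _ _ a1.1 a2.1).
Qed.

Lemma extend_cst c z : extend (cst c) z = c.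
Proof.
apply: cvg_Lim; rewrite (_ : (fun n => _) = cst c); first exact: cvg_cst.
apply/funext => n; apply: (tent_mean_cst rnu mnu io_isom).
  by rewrite lt_max rad_gt0 orbT.
by rewrite le_max lexx.
Qed.

Lemma finer_fin_ae h : adm h -> {ae cara mu, forall z,
  exists m : int, (finer h m z < +oo)%E}.
Proof.
move=> ah; suff H (k : nat) : {ae cara mu, forall z, ball point (3 * rad (- k%:Z)) z ->
    (finer h (- k%:Z)%R z < +oo)%E}.
  have := ae_foralln H; apply: ae_mono => z Hz.
  have d0 : 0 < mdist point z + 1 by rewrite ltr_wpDl// mdist_ge0.
  have [k /andP[_ zk]] := rad_approx d0.
  exists (- (`|k - 1|%N)%:Z); apply: Hz; apply/ballP.
  apply: (@lt_le_trans _ _ (mdist point z + 1)); first by rewrite ltrDl.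
  apply: (@le_trans _ _ (rad (- (`|k - 1|%N)%:Z))).
    apply: (le_trans (ltW zk)).
    have -> : 2 * rad k = rad (k - 1) :> R by rewrite (radB k 1) expr1.
    by apply: le_rad; lia.
  by have := @rad_ge0 R (- (`|k - 1|%N)%:Z); lra.
have mb : measurable (ball point (3 * rad (- k%:Z)) : set (caratheodory_type mu)).
  exact: measurable_ball.
have f0 z := finer_ge0 nu lam io Y h (- k%:Z) z.
have iF : (cara mu).-integrable (ball point (3 * rad (- k%:Z))) (finer h (- k%:Z)).
  apply/integrableP; split; first exact: (measurable_finer io rmu lam0 rnu).
  under eq_integral do rewrite gee0_abs//.
  have la : (local_avg mu Q nu lam io Y h (- k%:Z) point < +oo)%E.
    apply: le_lt_trans (spread_fin (- k%:Z) point ah).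
    by rewrite /spread leeDr// coarse_ge0.
  have rQ : 0 < rad (- k%:Z) `^ Q :> R by rewrite powR_gt0// rad_gt0.
  rewrite ltey; apply/eqP => ty; move: la; rewrite /local_avg ty gt0_muley ?ltxx//.
  by rewrite lte_fin invr_gt0.
by apply: ae_mono (integrable_ae mb iF) => z H /H; rewrite ge0_fin_numE.
Qed.

Lemma extend_cvg h : adm h -> {ae cara mu, forall z,
  discext h n%:Z z @[n --> \oo] --> extend h z}.
Proof.
move=> ah; have [M M0 HM] := discext_itail.
apply: ae_mono (finer_fin_ae ah) => z [m mz]; apply: is_cvg_Lim.
have [b [b0 Hb bE]] := HM h z ah.1.
apply: (@itail_is_cvg _ (fun n => discext h n z) b b0 Hb m).
by rewrite bE lte_mul_pinfty// lee_fin ltW.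
Qed.

Lemma extend_lin c h1 h2 : adm h1 -> adm h2 -> {ae cara mu, forall z,
  extend (fun w => c * h1 w + h2 w) z = c * extend h1 z + extend h2 z}.
Proof.
move=> a1 a2; apply: ae_mono (ae_and (extend_cvg a1) (extend_cvg a2)) => z [e1 e2].
apply: cvg_Lim.
rewrite (_ : (fun n => _) = (fun n : nat => c * discext h1 n%:Z z + discext h2 n%:Z z)).
  exact: (cvgD (cvgM (cvg_cst c) e1) e2).
apply/funext => n; apply: (tent_mean_lin rnu mnu io_isom) => //; [exact: a1.1|exact: a2.1|].
by rewrite lt_max rad_gt0 orbT.
Qed.

Context (gX : int -> T' -> T) (selX : selector nu io X gX).

Lemma extend_admissible h : adm h -> admissible mu X sg p (extend h).
Proof.
move=> ah; split; first exact: extend_loc.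
have [D [d [D0 d0 HD]]] := extend_dom; have [_ [S HS]] := ah.
have [M M0 HM] := dom_sup D0 d0; exists (M * S) => k.
exact: HM (fun j => alpha_ge0 sg p Y (rgrad nu h) j) (HD h ah) HS k.
Qed.

(** A majorant on F of the p-th power of [spread] at the selected vertex. Being a sum over the net,
    it can be integrated over F term by term. *)
Definition spread_step h (n : int) w : \bar R :=
  (\esum_(x in net X n) (spread h n x `^ p * (\1_(io @^-1` ball x (rad n)) w : R)%:E))%E.

Lemma spread_step_ge0 h n w : (0 <= spread_step h n w)%E.
Proof. by apply: esum_ge0 => x _; rewrite mule_ge0 ?poweR_ge0. Qed.

Lemma spread_le_step h n w : (spread h n (gX n w) `^ p <= spread_step h n w)%E.
Proof.
have [/(_ w) Nx /(_ w) xw _] := selX n.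
have := @esum_ge_term _ _ (net X n) (fun x => spread h n x `^ p *
  (\1_(io @^-1` ball x (rad n)) w : R)%:E)%E _ Nx.
rewrite indicE mem_set ?mule1//; apply/ballP; apply: lt_le_trans xw _.
by have := @rad_ge0 R n; lra.
Qed.

Lemma measurable_preimage_ball x r :
  measurable (io @^-1` ball x r : set (caratheodory_type nu)).
Proof. by apply: measurable_open; [case: rnu|exact: open_preimage_ball]. Qed.

Lemma measurable_spread_step h n :
  measurable_fun [set: caratheodory_type nu] (spread_step h n : caratheodory_type nu -> \bar R).
Proof.
apply: measurable_fun_esum; first exact: net_countable Q0 rmu X n.
- move=> x; apply: measurable_funeM; apply/measurable_EFinP; apply: measurable_indic.
  exact: measurable_preimage_ball.
- by move=> x w; rewrite mule_ge0// poweR_ge0.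
Qed.

(** The centre need not lie on F; a point of F in the ball replaces it, at the cost of doubling the
    radius. *)
Lemma nu_preimage_ball x r : 0 < r ->
  (nu (io @^-1` ball x r) <= (C' * (2 * r) `^ lam)%:E)%E.
Proof.
move=> r0; have [[y /ballP xy]|none] := pselect (exists y, ball x r (io y)).
  apply: (@le_trans _ _ (nu (ball y (2 * r)))).
    apply: le_outer_measure => w /ballP xw; apply/ballP.
    have := metric_triangle (io y) x (io w); rewrite io_isom (metric_sym (io y)); lra.
  by case: rnu => _ _ + _; apply; rewrite mulr_gt0.
have -> : io @^-1` ball x r = set0.
  by apply/seteqP; split => w // xw; apply: none; exists w.
rewrite outer_measure0 lee_fin mulr_ge0 ?powR_ge0//.
by case: rnu => /(le_trans ler01).
Qed.

(** The integrals of [spread_step] decay geometrically in n, so the sum over n >= 0 is integrable,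
    hence finite almost everywhere, and its terms tend to 0. *)
Lemma spread_cvg0 h : adm h -> {ae cara nu, forall w, forall e : R, 0 < e ->
  \forall n \near \oo, (spread h n%:Z (gX n%:Z w) < e%:E)%E}.
Proof.
move=> ah; have [D D0 HD] := net_scattered Q0 rmu.
have [M [t [M0 t0 HM]]] := spread_alpha rmu lam0 rnu io_isom Y p0 psg Qsg sgp D0.
have [A A0 HA] := dom_sup M0 t0; have [_ [S HS]] := ah.
have HB := HA _ _ _ (fun j => alpha_ge0 sg p Y (rgrad nu h) j)
  (HM h _ (net X) (fun _ => id) (HD X)) HS.
have C'0 : 0 < C' by case: rnu => /(lt_le_trans ltr01).
(* Weaker than [psg], because min(p, 1) <= 1. *)
pose dl := lam + sg; have dl0 : 0 < dl.
  apply: lt_le_trans psg _; rewrite /dl lerD2r ler_piMr ?(ltW lam0)//.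
  by rewrite ge_min lexx orbT.
pose K := C' * 2 `^ lam; have K0 : 0 < K by rewrite mulr_gt0// powR_gt0.
have I1 (n : int) : (\int[cara nu]_w spread_step h n w <=
    (K * (A * S))%:E * (2 `^ (- (n%:~R * dl)))%:E)%E.
  rewrite integral_esum_indic//; last 3 first.
  - exact: net_countable Q0 rmu X n.
  - by move=> x; exact: measurable_preimage_ball.
  - by move=> x; exact: poweR_ge0.
  apply: (@le_trans _ _ (\esum_(x in net X n) ((K * rad n `^ lam)%:E * spread h n x `^ p))%E).
    apply: le_esum => x _; rewrite muleC; apply: lee_wpmul2r; first exact: poweR_ge0.
    rewrite setIT; apply: le_trans (nu_preimage_ball x (rad_gt0 n)) _.
    by rewrite lee_fin powRM ?rad_ge0// mulrA.
  rewrite esumZl; last 2 first.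
  - by rewrite mulr_ge0 ?powR_ge0// ltW.
  - by move=> x; exact: poweR_ge0.
  have := HB n => /= HBn.
  have E0 : (2 `^ (- (n%:~R * dl)) = rad n `^ lam * 2 `^ (- (n%:~R * sg)) :> R).
    rewrite rad_powR -powRD ?pnatr_eq0 ?implybT//.
    by congr (powR _ _); rewrite /dl; ring.
  apply: (@le_trans _ _ ((K * rad n `^ lam * 2 `^ (- (n%:~R * sg)))%:E *
      ((2 `^ (n%:~R * sg))%:E * (\esum_(x in net X n) spread h n x `^ p)))%E).
    rewrite muleA -EFinM -[X in (_ <= X%:E * _)%E]mulrA -powRD ?pnatr_eq0 ?implybT//.
    by rewrite addNr powRr0 mulr1.
  have c0 : (0 <= (K * rad n `^ lam * 2 `^ (- (n%:~R * sg)))%:E)%E.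
    by rewrite lee_fin !mulr_ge0 ?powR_ge0// ltW.
  apply: le_trans (lee_wpmul2l c0 HBn) _.
  rewrite -!EFinM lee_fin E0 le_eqVlt; apply/orP; left; apply/eqP.
  by move: (rad n `^ lam) (2 `^ _) => x1 x2; ring.
have [G G0 HG] := wt_esum_fin dl0.
have AS0 : 0 <= A * S.
  rewrite mulr_ge0 ?(ltW A0)// -lee_fin.
  by apply: le_trans (HS 0); exact: alpha_ge0.
have m0 j (B : set (caratheodory_type nu)) : measurable_fun B
    (spread_step h j : caratheodory_type nu -> \bar R).
  by apply: measurable_funTS; exact: measurable_spread_step.
have I2 : (\int[cara nu]_w itail (fun j => spread_step h j w) 0 < +oo)%E.
  rewrite ge0_integral_esum//; last 2 first.
  - exact: countableP.
  - by move=> j w; exact: spread_step_ge0.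
  apply: (@le_lt_trans _ _ (\esum_(j in [set j : int | (0 <= j)%R])
      ((K * (A * S))%:E * (wt dl j 0)%:E))%E).
    apply: le_esum => j /= j0; apply: le_trans (I1 j) _; apply: lee_wpmul2l.
      by rewrite lee_fin mulr_ge0// ltW.
    rewrite lee_fin /wt subr0 ger0_norm ?ler0z// le_eqVlt; apply/orP; left; apply/eqP.
    by congr (powR _ _); ring.
  rewrite esumZl; last 2 first.
  - by rewrite mulr_ge0// ltW.
  - by move=> j; rewrite lee_fin wt_ge0.
  apply: (@le_lt_trans _ _ ((K * (A * S))%:E * G%:E)%E); last exact: ltry.
  apply: lee_wpmul2l; first by rewrite lee_fin mulr_ge0// ltW.
  by apply: le_trans (HG 0); apply: le_esum_set.
have mI : measurable_fun [set: caratheodory_type nu]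
    (fun w : caratheodory_type nu => itail (fun j => spread_step h j w) 0).
  apply: measurable_fun_esum; first exact: countableP.
  - by move=> j; exact: m0.
  - by move=> j w; exact: spread_step_ge0.
have iI : (cara nu).-integrable setT (fun w => itail (fun j => spread_step h j w) 0).
  have it0 w : (0 <= itail (fun j => spread_step h j w) 0)%E.
    by apply: itail_ge0 => j; exact: spread_step_ge0.
  by apply/integrableP; split => //; under eq_integral do rewrite gee0_abs//.
apply: ae_mono (integrable_ae measurableT iI) => w /(_ Logic.I) fw e e0.
have s0 j : (0 <= spread_step h j w)%E by exact: spread_step_ge0.
have fw' : (itail (fun j => spread_step h j w) 0 < +oo)%E.
  by rewrite -ge0_fin_numE// itail_ge0.
have ep0 : 0 < e `^ p by rewrite powR_gt0.
have [n n0 ne] := itail_cvg0 s0 fw' ep0.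
exists `|n|%N => // k /= nk; rewrite ltNge; apply/negP => es.
suff : (e `^ p < e `^ p) by rewrite ltxx.
rewrite -lte_fin; apply: le_lt_trans ne.
have nk' : n <= k%:Z by apply: le_trans (lez_abs n) _.
apply: (@le_trans _ _ (spread_step h k%:Z w)); last first.
  exact: (@esum_ge_term _ _ [set j : int | n <= j] (fun j => spread_step h j w) k%:Z nk').
apply: le_trans (spread_le_step h k%:Z w).
rewrite -poweR_EFin; apply: gt0_ler_poweR; rewrite ?in_itv/= ?leey ?andbT ?(ltW p0) ?lee_fin ?(ltW e0)//.
exact: (spread_ge0 mu Q nu lam io Y h).
Qed.

(** The mean of the extension is compared with [discext] at the vertex, this with a mean of [h] at
    level n - 7 near [y], and this with [h w]. The first two comparisons need lower bounds on
    measures, hence the condition that F has two points more than [rad n / 4] apart. *)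
Lemma trace_extend_dist : exists2 M : R, 0 < M & forall h n w, adm h ->
  (exists w w' : T', rad n / 4 < mdist w w') ->
  (`|h w - rmean nu (vball ((n - 7)%R, g (n - 7) w)) h|%:E <=
    tail_step id Y (rgrad nu h) (n - 7)%R w)%E ->
  (`|rmean mu (vball (n, gX n w)) (extend h) - h w|%:E <=
   M%:E * spread h n (gX n w) + 2%:E * tail_step id Y (rgrad nu h) (n - 7)%R w)%E.
Proof.
have [A A0 HA] := extend_integral.
have [B B0 HB] := tent_mean_dist lam0 rnu mnu io_isom.
have C0 : 0 < C by case: rmu => /(lt_le_trans ltr01).
pose A' := C * 2 `^ Q * A; have A'0 : 0 < A' by rewrite !mulr_gt0 ?powR_gt0.
exists (A' + B * 2); first by rewrite addr_gt0// mulr_gt0.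
move=> h n w ah [w1 [w2 big]] hw; have lh := ah.1; have rn := @rad_gt0 R n.
set x := gX n w; have [_ /(_ w) xw _] := selX n; rewrite -/x in xw.
have s0 : (0 <= spread h n x)%E by exact: spread_ge0.
have zx : idist io x <= rad n by apply: le_trans (idist_le io x w) _; lra.
have [y Ny xy] : exists2 y, net Y n y & mdist x (io y) < 10 * rad n.
  by apply: net_close => //; lra.
have dE : discext h n x = tent_mean nu io h x (rad n).
  change (tent_mean nu io h x (Num.max (idist io x) (rad n)) = tent_mean nu io h x (rad n)).
  by rewrite max_r.
have b1 : (`|rmean mu (vball (n, x)) (extend h) - discext h n x|%:E <= A'%:E * spread h n x)%E.
  have vs : vball (n, x) `<=` ball x (3 * rad n).
    by rewrite vballE; apply: le_ball; rewrite /=; lra.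
  have mb : measurable (ball x (3 * rad n) : set (caratheodory_type mu)) by exact: measurable_ball.
  have rQ : 0 < rad n `^ Q :> R by rewrite powR_gt0.
  have Bp : 0 < C * 2 `^ Q * (rad n `^ Q)^-1 by rewrite !mulr_gt0 ?powR_gt0// invr_gt0.
  have big' : exists y z : T, rad n / 16 < mdist y z.
    by exists (io w1), (io w2); rewrite io_isom; lra.
  have vge := vball_ge Q0 rmu (v := (n, x)) (or_introl erefl) big'.
  apply: (le_trans (rmean_ball_dist rmu mmu (discext h n x) Bp (extend_loc ah) mb vs vge)).
  rewrite /A' [in leRHS]EFinM -[leRHS]muleA EFinM -[leLHS]muleA; apply: lee_wpmul2l.
    by rewrite lee_fin mulr_ge0 ?powR_ge0// ltW.
  exact: HA.
have b2 : (`|discext h n x - osc_center nu g h n y|%:E <= (B * 2)%:E * spread h n x)%E.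
  rewrite dE; have xy' : mdist x (io y) < 13 * rad n by lra.
  have big' : exists w w' : T', rad n / 4 < mdist w w' by exists w1, w2.
  apply: (le_trans (HB h n y x _ lh zx xy' big')).
  rewrite EFinM -muleA; apply: lee_wpmul2l; first by rewrite lee_fin ltW.
  apply: (le_trans (osc_bound lam0 rnu mnu sel n y lh)); apply: lee_wpmul2l => //.
  apply: le_trans (osc_le_hull nu lam h Ny xy) _.
  apply: (@le_trans _ _ (coarse h n x)); last first.
    exact: (leeDl (coarse h n x) (local_avg_ge0 mu Q nu lam io Y h n x)).
  have := @esum_ge_term _ _ [set i : int | i <= n]
    (fun i => (rad n / rad i)%:E * hull h i x)%E n (lexx n).
  by rewrite mulfV ?gt_eqF// mul1e.
(* The right side is [64 * rad n], while [y] and [w] are within [10 * rad n] and [rad n / 2] of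
   [x]. *)
have yw : mdist y w < rad (n - 7) / 2.
  rewrite (radB n 7) !exprS expr0 -io_isom.
  by have := metric_triangle (io y) x (io w); rewrite (metric_sym (io y) x); lra.
have ge0 := rgrad_ge0 nu h.
have b3 : (`|h w - osc_center nu g h n y|%:E <=
    2%:E * tail_step id Y (rgrad nu h) (n - 7)%R w)%E.
  by apply: (tail_osc (u := fun v => rmean nu (vball v) h) (a := rgrad nu h) _ ge0 sel
    (fun x y => erefl) hw yw).
apply: (@le_trans _ _ ((`|rmean mu (vball (n, x)) (extend h) - discext h n x|%:E +
  `|discext h n x - osc_center nu g h n y|%:E) + `|h w - osc_center nu g h n y|%:E)%E).
  rewrite -!EFinD lee_fin (distrC (h w)).
  apply: le_trans (ler_distD (osc_center nu g h n y) _ _) _; rewrite lerD2r.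
  exact: ler_distD.
apply: leeD => //; rewrite EFinD ge0_muleDl ?lee_fin ?(ltW A'0) ?mulr_ge0 ?(ltW B0)//.
exact: leeD.
Qed.

Lemma trace_extend h : adm h -> (exists w w' : T', 0 < mdist w w') ->
  {ae cara nu, forall w, rtrace mu gX (extend h) w = h w}.
Proof.
move=> ah [w1 [w2 big]]; have lh := ah.1; have ge0 := rgrad_ge0 nu h.
have cv := rtrace_cvg Q0 rmu lam0 rnu io_isom selX p0 psg (extend_admissible ah).
have os := ae_foralln (fun k : nat => mean_osc lam0 rnu mnu sel lh
  (fun e _ => lexx (rgrad nu h e)) ge0 (k%:Z - 7)).
have tl := tail_step_fin_ae lam0 rnu lam0 rnu (fun x y => erefl) p0 psg ah.
have sp := spread_cvg0 ah.
have [M M0 HM] := trace_extend_dist.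
have := ae_and (ae_and cv os) (ae_and tl sp).
apply: ae_mono => w [[cvw osw] [[m mw] spw]].
suff hw : rmean mu (vball (n%:Z, gX n%:Z w)) (extend h) @[n --> \oo] --> h w.
  exact: (cvg_unique _ cvw hw).
apply/cvgrPdist_lt => e e0.
have e4 : 0 < e / 4 by rewrite divr_gt0.
have [N mN Ne] := itail_cvg0 (fun j => edge_step_ge0 Y j w ge0) mw e4.
have eM : 0 < e / 2 / M by rewrite !divr_gt0.
have d0 : 0 < mdist w1 w2 by [].
have [l /andP[wl _]] := rad_approx d0.
have large : \forall n \near \oo, (l <= n%:Z) /\ (N <= n%:Z - 7).
  exists (`|l| + `|N| + 7)%N => // n /= nl; clear - nl; lia.
have := spw _ eM; move: large; apply: filterS2 => n [ln Nn] sn.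
have bign : exists w w' : T', rad n%:Z / 4 < mdist w w'.
  exists w1, w2; have : rad n%:Z <= rad l :> R by exact: le_rad.
  by have := @rad_gt0 R n%:Z; lra.
rewrite distrC -lte_fin; apply: (le_lt_trans (HM h n%:Z w ah bign (osw n))).
rewrite [in ltRHS](splitr e) [in ltRHS]EFinD; apply: lteD.
  have -> : (e / 2)%:E = (M%:E * (e / 2 / M)%:E)%E.
    by rewrite -EFinM [M * _]mulrC divfK// gt_eqF.
  by rewrite lte_pmul2l.
have -> : (e / 2)%:E = (2%:E * (e / 4)%:E)%E by rewrite -EFinM; congr EFin; field.
rewrite lte_pmul2l//; apply: le_lt_trans Ne; exact: (itail_le _ Nn).
Qed.

End extension_bounded.

(** * Nondegeneracy of F and the final assembly *)

Section nondegenerate.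
Context {R : realType} {T : pmetricType R}.

Lemma hausdorff_measure_point (lam : R) : 0 < lam ->
  (forall x y : T, mdist x y <= 0) -> hausdorff_measure lam [set: T] = 0%E.
Proof.
move=> lam0 small; apply/eqP; rewrite eq_le hausdorff_measure_ge0 andbT.
have d0 : diam [set: T] = 0%E.
  apply/eqP; rewrite eq_le; apply/andP; split.
    by apply: ge_ereal_sup => _ [->//|[[x y] _ <-]]; rewrite lee_fin; exact: small.
  by apply: ereal_sup_ubound; left.
apply: ge_ereal_sup => _ [delta _ <-].
apply: ereal_inf_lbound; exists (fun n => if n is 0%N then setT else set0).
  split; last by move=> x _; exists 0%N.
  by case=> [|n]; rewrite ?d0 ?diam_set0 lee_fin.
rewrite eseries0// => -[|n] _ _; last exact: hausdorff_gauge0.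
by rewrite /hausdorff_gauge; case: ifPn => // _; rewrite d0 poweR0r// gt_eqF.
Qed.

Lemma diam_setT_gt0 (x y : T) : 0 < mdist x y -> (0 < diam [set: T])%E.
Proof.
move=> xy; apply: (@lt_le_trans _ _ (mdist x y)%:E); first by rewrite lte_fin.
by apply: ereal_sup_ubound; right; exists (x, y).
Qed.

(** A one-point space has measure 0 for lam > 0, against the positive measure of balls. So F, and
    with it Z, has positive diameter. *)
Lemma hausdorff_two_points (lam : R) : 0 < lam ->
  metric_measure_space (hausdorff_measure lam : {outer_measure set T -> \bar R}) ->
  exists x y : T, 0 < mdist x y.
Proof.
move=> lam0 [_ pos]; apply: contrapT => none.
have small (x y : T) : mdist x y <= 0.
  by rewrite leNgt; apply/negP => xy; apply: none; exists x, y.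
have /andP[+ _] := pos point 1 ltr01; apply/negP; rewrite -leNgt.
rewrite -(hausdorff_measure_point lam0 small).
exact: (le_outer_measure (hausdorff_measure lam : {outer_measure set T -> \bar R})).
Qed.

End nondegenerate.

Section complex_continuity.
Context {R : realType} {T : topologicalType}.

Lemma Re_Im_continuous (f : T -> R[i]) (z : T) :
  {for z, continuous (f : T -> R[i]^o)} ->
  {for z, continuous (fun y => complex.Re (f y))} /\
  {for z, continuous (fun y => complex.Im (f y))}.
Proof.
move=> /cvgrPdist_lt cf.
have near (e : R) : 0 < e -> \forall y \near z, Normc.normc (f z - f y) < e.
  move=> e0; have e0' : 0 < (e%:C)%C by rewrite ltcR.
  apply: filterS (cf _ e0') => y.
  have -> : `|f z - f y| = (Normc.normc (f z - f y))%:C%C.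
    by rewrite normc_def; case: (f z - f y).
  by rewrite ltcR.
split; apply/cvgrPdist_lt => e /near; apply: filterS => y; apply: le_lt_trans.
- by have := Re_le_normc (f z - f y); case: (f z) (f y) => [? ?] [? ?].
- by have := Im_le_normc (f z - f y); case: (f z) (f y) => [? ?] [? ?].
Qed.

End complex_continuity.

Theorem theorem1p1 (R : realType) (Q : R) (Z : pmetricType R)
    (mu : {outer_measure set Z -> \bar R}) (lam : R) (F : set Z)
    (F0 : F !=set0) (s p : R) (q : \bar R)
    (X : hyperbolic_filling Z) (Y : hyperbolic_filling (submetric F0)) :
  0 < Q -> ahlfors_regular mu Q ->
  0 < lam -> lam <= Q ->
  closed F ->
  let nu : {outer_measure set (submetric F0) -> \bar R} :=
    hausdorff_measure lam in
  ahlfors_regular nu lam ->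
  0 < s -> s < 1 ->
  Num.max (Q / (lam + s)) ((Q - lam) / s) < p ->
  (0 < q)%E ->
  let t := s - (Q - lam) / p in
  exists (Rop : (Z -> R[i]) -> (submetric F0 -> R[i]))
         (Eop : (submetric F0 -> R[i]) -> (Z -> R[i])),
    [/\ bounded_linear_besov mu X s nu Y t p%:E q Rop,
        bounded_linear_besov nu Y t mu X s p%:E q Eop,
        (forall f, besov mu X s p%:E q f -> continuous (f : Z -> R[i]^o) ->
           Rop f = (fun x : submetric F0 => f (set_val x))) &
        (forall f, besov nu Y t p%:E q f ->
           Rop (Eop f) = f %[ae cara nu])].
Proof.
move=> Q0 rQ lam0 lamQ _ nu rlam s0 s1 ps q0 t.
have lams0 : 0 < lam + s by rewrite addr_gt0.
move: ps; rewrite gt_max => /andP[p1 p2].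
have p0 : 0 < p by apply: lt_trans p1; rewrite divr_gt0.
have {}p1 : Q < p * (lam + s) by rewrite -ltr_pdivrMr.
have {}p2 : Q - lam < p * s by rewrite -ltr_pdivrMr.
have [sg sgE] : exists sg : R, s * p - Q = sg by exists (s * p - Q).
have sgE' : t * p - lam = sg by rewrite -sgE /t mulrBl divfK ?gt_eqF//; ring.
(* sg + Q = s p, so this is the hypothesis s < 1; it makes the coarse scales of the extension
   summable. *)
have sgp : sg + Q < p by rewrite -sgE subrK gtr_pMl.
(* The two lower bounds on [p] are the two cases of this positivity: Q < p (lam + s) for p <= 1, and
   Q - lam < p s for p > 1. *)
have [m0 psg] : 0 < Num.min p 1 /\ 0 < lam * Num.min p 1 + sg.
  rewrite -sgE; case: (leP p 1) => _; split => //; last by rewrite mulr1; lra.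
  by move: p1; rewrite mulrDr (mulrC lam) (mulrC s); lra.
have Qsg : 0 < Q * Num.min p 1 + sg.
  by apply: lt_le_trans psg _; rewrite lerD2r ler_wpM2r// ltW.
have mmu : metric_measure_space mu by case: rQ.
have mnu : metric_measure_space nu by case: rlam.
have [w1 [w2 ww]] := hausdorff_two_points lam0 mnu.
have io_isom (x y : submetric F0) : mdist (set_val x) (set_val y) = mdist x y by [].
have zz : 0 < mdist (set_val w1) (set_val w2) by rewrite io_isom.
have [C rmu] := ahlfors_regularP Q0 (diam_setT_gt0 zz) rQ.
have [C' rnu] := ahlfors_regularP lam0 (diam_setT_gt0 ww) rlam.
have brnu : borel_regular nu by case: rnu.
have [gX selX] := selector_exists io_isom X Q0 rmu brnu.
(* The extension looks at F intrinsically, so this selector uses the identity of F as isometry. *)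
have [gY selY] := selector_exists (fun x y => erefl) Y lam0 rnu brnu.
have two : exists w w' : submetric F0, 0 < mdist w w' by exists w1, w2.
pose Rop := componentwise (rtrace mu gX).
pose Eop := componentwise (extend nu set_val).
exists Rop, Eop; split.
- apply: (componentwise_bounded_linear Q0 rmu mmu lam0 rnu p0 q0 sgE sgE').
  + exact: (rtrace_loc Q0 rmu lam0 rnu mnu io_isom selX p0 psg).
  + by move=> h1 h2 a1 a2 h12; rewrite (eq_rtrace mmu gX a1 a2 h12); exact: aeW.
  + by move=> c; apply: aeW => y; exact: rtrace_cst.
  + exact: (rtrace_lin Q0 rmu mmu lam0 rnu io_isom selX p0 psg).
  + exact: (rtrace_dom Q0 rmu lam0 rnu mnu io_isom Y selX p0 psg).
- apply: (componentwise_bounded_linear lam0 rnu mnu Q0 rmu p0 q0 sgE' sgE).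
  + exact: (extend_loc Q0 rmu mmu lam0 rnu mnu io_isom selY p0 psg Qsg sgp).
  + by move=> h1 h2 a1 a2 h12; rewrite (eq_extend rnu io_isom a1 a2 h12); exact: aeW.
  + by move=> c; apply: aeW => y; exact: (extend_cst rnu mnu io_isom).
  + exact: (extend_lin Q0 rmu lam0 rnu mnu io_isom selY p0 psg Qsg sgp).
  + exact: (extend_dom Q0 rmu mmu lam0 rnu mnu io_isom X selY p0 psg Qsg sgp).
- move=> f Bf cf; have [[lr _] [li _]] := besov_admissible Q0 rmu p0 q0 sgE Bf.
  apply/funext => x; have [cr ci] := Re_Im_continuous (cf (set_val x)).
  rewrite /Rop /componentwise.
  rewrite (rtrace_continuous Q0 mmu lam0 selX p0 psg lr cr).
  rewrite (rtrace_continuous Q0 mmu lam0 selX p0 psg li ci).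
  by case: (f _).
- move=> f Bf; have [ar ai] := besov_admissible lam0 rnu p0 q0 sgE' Bf.
  have tr := trace_extend Q0 rmu mmu lam0 rnu mnu io_isom selY p0 psg Qsg sgp selX ar two.
  have ti := trace_extend Q0 rmu mmu lam0 rnu mnu io_isom selY p0 psg Qsg sgp selX ai two.
  apply: ae_mono (ae_and tr ti) => w [e1 e2] _.
  apply/eqP; rewrite eq_complex; apply/andP; split; apply/eqP; [exact: e1|exact: e2].
Qed.
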